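(* Let $(\phi_t)_{t\ge 0}$ be a non-elliptic semigroup of holomorphic functions in the unit disk $\mathbb{D}$, let $\Delta$ be a petal of $(\phi_t)$, and let $K\subset\Delta$ be compact. Then $$\lim_{t\to-\infty}\mathrm{A}_h^{\mathbb{D}}(\phi_t(K))=\mathrm{A}_h^{\Delta}(K),$$ and, for every integer $n\ge2$, $$\lim_{t\to-\infty}d_{n,h}^{\mathbb{D}}(\phi_t(K))=d_{n,h}^{\Delta}(K).$$
   Context: $\mathbb{D}$ is the open unit disk. A (one-parameter) semigroup of holomorphic functions in $\mathbb{D}$ is a family $(\phi_t)_{t\ge0}$ of holomorphic maps $\phi_t:\mathbb{D}\to\mathbb{D}$ such that $\phi_0$ is the identity, $\phi_{t+s}=\phi_t\circ\phi_s$ for all $s,t\ge0$, and $\phi_t(z)\to z$ as $t\to0^+$ uniformly on compact subsets of $\mathbb{D}$. It is called non-elliptic if there is a point $\tau\in\partial\mathbb{D}$ (the Denjoy–Wolff point) with $\lim_{t\to+\infty}\phi_t(z)=\tau$ for every $z\in\mathbb{D}$. A non-elliptic semigroup is called parabolic if the angular derivatives satisfy $\phi_t'(\tau)=1$. The hyperbolic density of $\mathbb{D}$ is $\lambda_{\mathbb{D}}(z)=\frac{1}{1-|z|^2}$. For a simply connected domain $U\subsetneq\mathbb{C}$, $\lambda_U(z)=\lambda_{\mathbb{D}}(f(z))|f'(z)|$ for any conformal map $f$ of $U$ onto $\mathbb{D}$, and $d_U(a,b)=\inf_\gamma\int_\gamma\lambda_U(z)|dz|$, the infimum over rectifiable curves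 $\gamma\subset U$ joining $a$ and $b$; in particular $d_{\mathbb{D}}(z,w)=\operatorname{arctanh}\left|\frac{z-w}{1-\bar z w}\right|$. For a compact set $E\subset U$, the hyperbolic area is $\mathrm{A}_h^{U}(E)=\int_E\lambda_U(z)^2\,dA(z)$, with $A$ the Lebesgue area measure, and for an integer $n\ge2$ the hyperbolic $n$-th diameter is $$d_{n,h}^{U}(E)=\sup_{w_1,\dots,w_n\in E}\ \prod_{1\le\mu<\nu\le n}\big(\tanh d_U(w_\mu,w_\nu)\big)^{\frac{2}{n(n-1)}}$$ (for $U=\mathbb{D}$, $\tanh d_{\mathbb{D}}(z,w)=\left|\frac{z-w}{1-\bar z w}\right|$; the supremum over the empty set is $0$). A backward orbit of $(\phi_t)$ starting at a point $z\in\mathbb{D}$ is a continuous curve $\gamma:[0,+\infty)\to\mathbb{D}$ with $\gamma(0)=z$ and $\phi_s(\gamma(t))=\gamma(t-s)$ for all $t\ge0$, $s\in[0,t]$; it is regular if $\limsup_{t\to+\infty}d_{\mathbb{D}}(\gamma(t),\gamma(t+1))<+\infty$. The backward invariant set is $\mathcal{W}=\bigcap_{t\ge0}\phi_t(\mathbb{D})$. A petal $\Delta$ of $(\phi_t)$ is a non-empty simply connected component of the interior of $\mathcal{W}$ such that: (i) $\phi_t(\Delta)=\Delta$ for all $t\ge0$ and $(\phi_t|_{\Delta})$ is a group of automorphisms of $\Delta$; (ii) $\tau\in\partial\Delta$; (iii) there is a point $\sigma\in\partial\mathbb{D}\cap\partial\Delta$ (possibly $\sigma=\tau$) such that for every $z\in\Delta$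 the curve $[0,+\infty)\ni t\mapsto(\phi_t|_\Delta)^{-1}(z)$ is a regular backward orbit for $(\phi_t)$ converging to $\sigma$; moreover $\sigma$ is a boundary regular fixed point (a boundary fixed point at which each $\phi_t$ has finite angular derivative), and if $\sigma=\tau$ then the semigroup is parabolic. For $t>0$ and $z\in\Delta$ one writes $\phi_{-t}(z):=(\phi_t|_\Delta)^{-1}(z)$, so $\phi_t$ is defined on $\Delta$ for all $t\in\mathbb{R}$. *)

(* Defs.v *)
From HB Require Import structures.
From mathcomp Require Import all_boot all_order all_algebra.
From mathcomp Require Import all_classical all_reals all_analysis.
From mathcomp.real_closed Require Import complex.

Set Implicit Arguments.
Unset Strict Implicit.
Unset Printing Implicit Defensive.
Import Order.TTheory GRing.Theory Num.Theory.
Import numFieldNormedType.Exports.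
Local Open Scope classical_set_scope.
Local Open Scope ring_scope.

(** [R[i]] packed as a [numFieldType]: this is the structure through which
    MathComp-Analysis provides the topology of the plane and the complex
    derivative ([derivable f z 1], [derive1 f z]). *)
Definition cplx (R : realType) : numFieldType := R[i].

Section plane.
Context {R : realType}.
Local Notation C := (cplx R).
Implicit Types (U V K E : set C) (f g : C -> C) (z w s : C).

(** The norm [`|z|] of [R[i]] is itself complex valued; this is the same modulus
    as an element of [R]. *)
Definition modulus z : R := Normc.normc z.

Definition disk : set C := [set z | modulus z < 1].

Definition boundary U : set C := closure U `\` U°.

Definition holomorphic_on U f := forall z, U z -> derivable f z 1.

(** A holomorphic bijection; its inverse is then holomorphic as well. *)
Definition conformal_map U V f := holomorphic_on U f /\ set_bij U V f.

Definition unit_square : set (R * R) := `[0, 1]%classic `*` `[0, 1]%classic.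

Definition null_homotopic U (c : R -> C) := exists H : R * R -> C,
  [/\ {within unit_square, continuous H},
      forall p, unit_square p -> U (H p),
      forall x : R, 0 <= x <= 1 -> H (x, 0) = c x,
      forall x : R, 0 <= x <= 1 -> H (x, 1) = c 0 &
      forall u : R, 0 <= u <= 1 -> H (0, u) = c 0 /\ H (1, u) = c 0].

Definition simply_connected U := connected U /\
  forall c : R -> C, {within `[0, 1], continuous c} ->
    (forall x : R, 0 <= x <= 1 -> U (c x)) -> c 0 = c 1 -> null_homotopic U c.

Definition stolz_region s (M : R) : set C :=
  [set z | disk z /\ modulus (z - s) < M * (1 - modulus z)].

Definition angular_limit f s z := forall M : R, 1 < M ->
  f @ within (stolz_region s M) (nbhs s) --> z.

Definition boundary_fixed_point f s := modulus s = 1 /\ angular_limit f s s.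

(** Angular derivative at a boundary fixed point, where [f s] stands for [s]. *)
Definition angular_derivative f s (a : C) :=
  angular_limit (fun z => (f z - s) / (z - s)) s a.

Definition disk_density z : R := (1 - modulus z ^+ 2)^-1.

(** By the Schwarz-Pick lemma the set below is a singleton for [z] in a simply
    connected domain [U] other than the plane: the value does not depend on the
    conformal map. *)
Definition hyp_density U z : R := xget 0
  [set l | exists2 f, conformal_map U disk f &
           l = disk_density (f z) * modulus (derive1 f z)].

(** Curves are parametrized by [0, 1]. As in [itv_partition], the
    sequence [p] stands for the partition [0 :: p]; [node p k] is the [k]-th point
    of that partition. *)
Definition node (p : seq R) (k : nat) : R := nth 0 (0 :: p) k.

Definition chord (c : R -> C) (p : seq R) (k : nat) : R :=
  modulus (c (node p k.+1) - c (node p k)).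

Definition rectifiable (c : R -> C) := exists M : R,
  forall p : seq R, itv_partition 0 1 p -> \sum_(k < size p) chord c p k <= M.

(** [l] is the integral of [rho] along [c] with respect to arc length, as the
    limit of the tagged sums over partitions of mesh tending to [0]. *)
Definition is_arclength_integral (rho : C -> R) (c : R -> C) (l : R) :=
  forall e : R, 0 < e -> exists2 d : R, 0 < d &
    forall (p : seq R) (x : nat -> R), itv_partition 0 1 p ->
      (forall k, (k < size p)%N ->
         node p k <= x k <= node p k.+1 /\ node p k.+1 - node p k < d) ->
      `| \sum_(k < size p) rho (c (x k)) * chord c p k - l | < e.

Definition joins U z w (c : R -> C) :=
  [/\ {within `[0, 1], continuous c}, forall x : R, 0 <= x <= 1 -> U (c x),
      c 0 = z & c 1 = w].

Definition hyp_dist U z w : R :=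
  inf [set l | exists c : R -> C,
         [/\ joins U z w c, rectifiable c &
             is_arclength_integral (hyp_density U) c l]].

Definition tanh (x : R) : R :=
  (expR x - expR (- x)) / (expR x + expR (- x)).

(** The integral is over the coordinates in [R * R], with planar Lebesgue measure
    as the product of two copies of [lebesgue_measure]. *)
Definition hyp_area U E : \bar R :=
  (\int[(@lebesgue_measure R) \x (@lebesgue_measure R)]_(p in
      [set p : R * R | E (p.1 +i* p.2)%C])
    ((hyp_density U (p.1 +i* p.2)%C ^+ 2)%:E))%E.

(** [sup set0 = 0]. *)
Definition hyp_diam (n : nat) U E : R :=
  sup [set \prod_(i < n) \prod_(j < n | (i < j)%N)
             (tanh (hyp_dist U (w i) (w j)) `^ (2 / (n * n.-1)%:R))
      | w in [set w : 'I_n -> C | forall i, E (w i)]].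

End plane.

Section semigroup.
Context {R : realType}.
Local Notation C := (cplx R).
Implicit Types (phi : R -> C -> C) (D : set C) (tau : C).

Record semigroup phi : Prop := Semigroup {
  semigroup_holomorphic : forall t : R, 0 <= t -> holomorphic_on disk (phi t);
  semigroup_disk : forall (t : R) z, 0 <= t -> disk z -> disk (phi t z);
  semigroup_id : forall z, disk z -> phi 0 z = z;
  semigroup_add : forall (t s : R) z, 0 <= t -> 0 <= s -> disk z ->
    phi (t + s) z = phi t (phi s z);
  semigroup_cvg : forall K : set C, compact K -> K `<=` disk ->
    {uniform K, phi @ 0^'+ --> id} }.

(** [phi] is non-elliptic when it has such a point [tau]. *)
Definition denjoy_wolff phi tau :=
  modulus tau = 1 /\ forall z, disk z -> phi t z @[t --> +oo] --> tau.

Definition parabolic phi tau :=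
  forall t : R, 0 <= t -> angular_derivative (phi t) tau 1.

Definition boundary_regular_fixed_point phi (s : C) :=
  forall t : R, 0 <= t -> boundary_fixed_point (phi t) s /\
                      exists a, angular_derivative (phi t) s a.

Definition backward_orbit phi (z : C) (c : R -> C) :=
  [/\ {within `[0, +oo[, continuous c},
      forall t : R, 0 <= t -> disk (c t),
      c 0 = z &
      forall t s : R, 0 <= s <= t -> phi s (c t) = c (t - s)].

Definition regular_orbit (c : R -> C) :=
  (limf_esup (fun t : R => (hyp_dist disk (c t) (c (t + 1)))%:E) +oo_R < +oo)%E.

Definition backward_invariant_set phi : set C :=
  \bigcap_(t in [set t : R | 0 <= t]) (phi t @` disk).

(** [phi t] on [D] for every real [t]: for [t < 0] it is the inverse of the
    restriction of [phi (- t)] to [D]. *)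
Definition flow phi D (t : R) : C -> C :=
  if 0 <= t then phi t else pinv D (phi (- t)).

Record petal phi tau D : Prop := Petal {
  petal_component : exists2 z, (backward_invariant_set phi)° z &
    D = connected_component (backward_invariant_set phi)° z;
  petal_simply_connected : simply_connected D;
  petal_automorphism : forall t : R, 0 <= t -> conformal_map D D (phi t);
  petal_boundary : boundary D tau;
  petal_fixed_point : exists s,
    [/\ modulus s = 1, boundary D s,
        forall z, D z ->
          [/\ backward_orbit phi z (fun t => flow phi D (- t) z),
              regular_orbit (fun t => flow phi D (- t) z) &
              flow phi D (- t) z @[t --> +oo] --> s],
        boundary_regular_fixed_point phi s &
        s = tau -> parabolic phi tau] }.

End semigroup.

(* Main.v *)
Require Import Defs.
From HB Require Import structures.
From mathcomp Require Import all_boot all_order all_algebra.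
From mathcomp Require Import all_classical all_reals all_analysis.
From mathcomp Require Import measurable_realfun.
From mathcomp.real_closed Require Import complex.
From mathcomp Require Import ring lra.

Import Order.TTheory GRing.Theory Num.Theory.
Import numFieldNormedType.Exports.
Local Open Scope classical_set_scope.
Local Open Scope ring_scope.

(** Write [D] for the petal and [psi t] for the inverse of [phi t] on [D]. The
    hyperbolic density of the disk pulled back to [D] by [psi t] and the
    pseudo-hyperbolic distance of [psi t z] and [psi t w] increase with [t],
    because [psi s] is [psi t] followed by the holomorphic self-map [phi (t -
    s)] of the disk, a contraction by the Schwarz-Pick lemma. The theorem
    amounts to the fact that these quantities increase to the hyperbolic
    density and distance of the petal ([petal_uniformization]).

    To see it, normalize: let [a t = psi t z0] for a base point [z0] of [D],
    and let [gt t] be [psi t] followed by the Moebius map sending [a t] to [0],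
    and [ft t] the inverse Moebius map followed by [phi t]. These maps [D ->
    disk] and [disk -> disk] satisfy [ft t (gt t z) = z]. Take their pointwise
    limits [g] and [f] along an ultrafilter finer than the neighbourhoods of
    infinity. The image of [f] is open, connected, contains [z0] and consists
    of points of the backward invariant set, so it is contained in the
    component [D]; hence [g \o f] is a self-map of the disk that fixes the
    origin with derivative [1], the identity by the equality case of Schwarz's
    lemma. So [g] is a Riemann map of [D] ([backward_uniformization]); as the
    normalization consists of isometries, the pulled back densities and
    distances tend to those of [g].

    The complex analysis needed here is derived from [goursat]: applied in
    logarithmic coordinates it gives the mean value property, then the maximum
    principle and Schwarz's lemma. Schwarz's lemma for difference quotients
    yields a second order Taylor estimate with a constant that depends on a
    bound for the function only ([quad_bound]). It makes pointwise limits of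
    bounded families holomorphic ([lim_along_derive]), and shows that
    derivatives and difference quotients of holomorphic functions are
    holomorphic, whence isolated zeros, the open mapping theorem and the
    holomorphy of inverses.

    For the diameters, the hyperbolic distance of the disk is computed from its
    definition by curves: conformal maps transport curves and their hyperbolic
    lengths ([hyp_dist_conformal]), and rays from the origin are shortest
    ([artanh_le_integral], [ray_integral]). So the products that define the
    [n]-th diameter of [psi t @` K] increase to those for [K] in [D], and their
    suprema follow ([hyp_diam_petal]).

    For the areas, the change of variables formula [conformal_area] turns the
    hyperbolic area of [psi t @` K] into an integral over [K] of the square of
    the pulled back density, to which monotone convergence applies
    ([hyp_area_petal]). One inequality in this formula comes from covering the
    image of [K] by images of small squares under tangent similarities, whose
    area is found by Tonelli's theorem ([integral_rotation],
    [area_transport_le]); the other inequality is the first one for the inverse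
    map. *)

Set Implicit Arguments.
Unset Strict Implicit.
Unset Printing Implicit Defensive.

(** * Modulus, complex derivative and one-variable integrals *)

Section basics.
Context {R : realType}.
Local Notation C := (cplx R).
Implicit Types (z w : C).
Local Notation re := (@complex.Re R).
Local Notation im := (@complex.Im R).

Lemma modulus_ge0 z : 0 <= modulus z.
Proof. by case: z => a b; exact: sqrtr_ge0. Qed.

Lemma modulus0 : modulus (0 : C) = 0. Proof. exact: Normc.normc0. Qed.
Lemma modulus1 : modulus (1 : C) = 1. Proof. exact: Normc.normc1. Qed.
Lemma modulusM z w : modulus (z * w) = modulus z * modulus w.
Proof. exact: Normc.normcM. Qed.
Lemma modulusV z : modulus z^-1 = (modulus z)^-1.
Proof. exact: Normc.normcV. Qed.
Lemma modulusN z : modulus (- z) = modulus z.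
Proof. exact: normcN. Qed.
Lemma modulusB z w : modulus (z - w) = modulus (w - z).
Proof. by rewrite -modulusN opprB. Qed.
Lemma modulusD z w : modulus (z + w) <= modulus z + modulus w.
Proof. exact: le_normcD. Qed.
Lemma modulus_eq0 z : (modulus z == 0) = (z == 0).
Proof.
apply/eqP/eqP => [|->]; [exact: Normc.eq0_normc | exact: modulus0].
Qed.
Lemma modulus_gt0 z : (0 < modulus z) = (z != 0).
Proof. by rewrite lt_def modulus_ge0 andbT modulus_eq0. Qed.
Lemma modulusX z n : modulus (z ^+ n) = modulus z ^+ n.
Proof. by elim: n => [|n IH]; rewrite ?expr0 ?modulus1// !exprS modulusM IH. Qed.

Lemma normE z : `|z| = (modulus z)%:C%C.
Proof. by case: z. Qed.

Lemma sqr_modulus z : modulus z ^+ 2 = re z ^+ 2 + im z ^+ 2.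
Proof. by case: z => a b /=; rewrite sqr_sqrtr// addr_ge0// sqr_ge0. Qed.

Lemma modulus_real (x : R) : modulus (x%:C%C : C) = `|x|.
Proof. by rewrite /modulus /= expr0n addr0 sqrtr_sqr. Qed.

Lemma abs_Re_le z : `|re z| <= modulus z.
Proof.
rewrite -ler_sqr ?nnegrE ?modulus_ge0// sqr_modulus -normrX ger0_norm ?sqr_ge0//.
by rewrite lerDl sqr_ge0.
Qed.

Lemma abs_Im_le z : `|im z| <= modulus z.
Proof.
rewrite -ler_sqr ?nnegrE ?modulus_ge0// sqr_modulus -normrX ger0_norm ?sqr_ge0//.
by rewrite lerDr sqr_ge0.
Qed.

Lemma modulus_le_ReIm z : modulus z <= `|re z| + `|im z|.
Proof.
rewrite -ler_sqr ?nnegrE ?modulus_ge0 ?addr_ge0//.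
by rewrite sqr_modulus sqrrD !real_normK ?num_real// lerD2r lerDl mulrn_wge0// mulr_ge0.
Qed.

Lemma modulus_nat n : modulus (n%:R : C) = n%:R.
Proof.
have -> : n%:R = (n%:R : R)%:C%C :> C by rewrite rmorph_nat.
by rewrite modulus_real ger0_norm.
Qed.

Lemma modulus_sub_le z w : `|modulus z - modulus w| <= modulus (z - w).
Proof.
rewrite ler_norml; apply/andP; split.
  have := modulusD (w - z) z; rewrite subrK modulusB; lra.
have := modulusD (z - w) w; rewrite subrK; lra.
Qed.

Definition cball z (r : R) : set C := [set w | modulus (w - z) < r].

Lemma nbhs_cballP z (A : set C) :
  nbhs z A <-> exists2 r : R, 0 < r & cball z r `<=` A.
Proof.
split.
  move=> /nbhs_ballP [e /= e0 H].
  have er : e = (re e)%:C%C.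
    by case: e e0 {H} => a b; rewrite ltcE /= => /andP[/eqP -> _].
  exists (re e); first by move: e0; rewrite ltcE => /andP[].
  move=> w wz; apply: H; rewrite -ball_normE /= distrC normE er ltcR.
  exact: wz.
move=> [r r0 H]; apply/nbhs_ballP; exists (r%:C%C : C); first by rewrite /= ltcR.
move=> w; rewrite -ball_normE /= distrC normE ltcR; exact: H.
Qed.

Lemma nbhs_cball z r : 0 < r -> nbhs z (cball z r).
Proof. by move=> r0; apply/nbhs_cballP; exists r. Qed.

Lemma open_cball z r : open (cball z r).
Proof.
rewrite openE => w wz; apply/nbhs_cballP; exists (r - modulus (w - z)).
  by rewrite subr_gt0.
move=> v; rewrite /cball /= => vw.
have := modulusD (v - w) (w - z); rewrite addrA subrK; lra.
Qed.

Lemma openP (U : set C) :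
  open U <-> forall z, U z -> exists2 r : R, 0 < r & cball z r `<=` U.
Proof.
by rewrite openE; split=> H z /H /nbhs_cballP.
Qed.

Lemma continuous_epsP (f : C -> C) z :
  {for z, continuous f} <-> forall e : R, 0 < e -> exists2 d : R, 0 < d &
    forall w, modulus (w - z) < d -> modulus (f w - f z) < e.
Proof.
split=> H.
  move=> e e0; have /H/nbhs_cballP := nbhs_cball (f z) e0.
  by move=> [d d0 Hd]; exists d.
move=> A /nbhs_cballP [e e0 He]; have [d d0 Hd] := H e e0.
apply/nbhs_cballP; exists d => // w wz; apply: He; exact: Hd.
Qed.

(** Division-free form of [f] having the derivative [a] at [z], with the real
    valued modulus: it is the form that composes well and survives limits. *)
Definition cdiff (f : C -> C) z (a : C) := forall e : R, 0 < e ->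
  exists2 d : R, 0 < d & forall w, modulus (w - z) < d ->
    modulus (f w - f z - a * (w - z)) <= e * modulus (w - z).

Lemma cdiffP f z a : is_derive z 1 f a <-> cdiff f z a.
Proof.
split.
  move=> [df fa] e e0.
  have : h^-1 *: (f (h *: 1 + z) - f z) @[h --> 0^'] --> a.
    by rewrite -fa; exact: df.
  move=> /(_ _ (nbhs_cball a e0)); rewrite !near_simpl.
  rewrite /dnbhs /= => /nbhs_cballP [d d0 H]; exists d => // w wz.
  have [->|wz0] := eqVneq w z; first by rewrite !subrr mulr0 subrr modulus0 mulr0.
  have h0 : w - z != 0 by rewrite subr_eq0.
  have := H (w - z); rewrite /cball/= subr0 => /(_ wz h0).
  rewrite scaler1 subrK /GRing.scale /= => {}H.
  have -> : f w - f z - a * (w - z) = ((w - z)^-1 * (f w - f z) - a) * (w - z).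
    by rewrite mulrBl mulrAC mulVf// mul1r.
  by rewrite modulusM ler_wpM2r ?modulus_ge0// ltW.
move=> H.
have L : h^-1 *: (f (h *: 1 + z) - f z) @[h --> 0^'] --> a.
  move=> A /nbhs_cballP [e e0 He].
  have [d d0 Hd] := H _ (divr_gt0 e0 (ltr0Sn R 1)).
  rewrite !near_simpl /dnbhs /=; apply/nbhs_cballP; exists d => // h.
  rewrite /cball /= subr0 => hd h0; apply: He; rewrite /cball /=.
  have := Hd (h + z); rewrite addrK => /(_ hd).
  rewrite scaler1 /GRing.scale /=.
  have -> : h^-1 * (f (h + z) - f z) - a = h^-1 * (f (h + z) - f z - a * h).
    by rewrite [RHS]mulrBr [h^-1 * (a * h)]mulrC mulfK.
  rewrite modulusM modulusV => {}Hd.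
  have hp : 0 < modulus h by rewrite modulus_gt0.
  apply: le_lt_trans (_ : e / 2 < e); last lra.
  by rewrite mulrC ler_pdivrMr.
apply: DeriveDef; first by apply/cvg_ex; exists a.
exact: cvg_lim L.
Qed.

End basics.

Section calculus.
Context {R : realType}.
Local Notation C := (cplx R).
Implicit Types (z w a b : C) (f g : C -> C).

Lemma cdiff_continuous f z a : cdiff f z a -> {for z, continuous f}.
Proof.
move=> /cdiffP[df _]; apply: differentiable_continuous.
exact/derivable1_diffP.
Qed.

Lemma cdiff_cst z c : cdiff (fun=> c) z 0.
Proof. by apply/cdiffP; exact: is_derive_cst. Qed.

Lemma cdiff_id z : cdiff id z 1.
Proof. by apply/cdiffP; exact: is_derive_id. Qed.

Lemma cdiff_eq f z a b : cdiff f z a -> a = b -> cdiff f z b.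
Proof. by move=> ? <-. Qed.

Lemma cdiffD f g z a b : cdiff f z a -> cdiff g z b ->
  cdiff (fun w => f w + g w) z (a + b).
Proof. by move=> /cdiffP fa /cdiffP gb; apply/cdiffP; exact: is_deriveD. Qed.

Lemma cdiffN f z a : cdiff f z a -> cdiff (fun w => - f w) z (- a).
Proof. by move=> /cdiffP fa; apply/cdiffP; exact: is_deriveN. Qed.

Lemma cdiffB f g z a b : cdiff f z a -> cdiff g z b ->
  cdiff (fun w => f w - g w) z (a - b).
Proof. by move=> fa gb; apply: cdiffD => //; exact: cdiffN. Qed.

Lemma cdiffM f g z a b : cdiff f z a -> cdiff g z b ->
  cdiff (fun w => f w * g w) z (f z * b + g z * a).
Proof. by move=> /cdiffP fa /cdiffP gb; apply/cdiffP; exact: is_deriveM. Qed.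

Lemma cdiffZ f z a c : cdiff f z a -> cdiff (fun w => c * f w) z (c * a).
Proof.
move=> fa; apply: cdiff_eq (cdiffM (cdiff_cst z c) fa) _.
by rewrite mulr0 addr0.
Qed.

Lemma cdiff_near f g z a : (exists2 r : R, 0 < r &
    forall w, modulus (w - z) < r -> f w = g w) -> cdiff f z a -> cdiff g z a.
Proof.
move=> [r r0 fg] fa e /fa[d d0 H]; exists (Num.min d r).
  by rewrite lt_min d0.
move=> w; rewrite lt_min => /andP[wd wr].
rewrite -(fg _ wr) -(fg z) ?subrr ?modulus0//; exact: H.
Qed.

Lemma cdiff_comp f g z a b : cdiff f z a -> cdiff g (f z) b ->
  cdiff (fun w => g (f w)) z (b * a).
Proof.
move=> fa gb e e0.
pose M := modulus b + modulus a + 1.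
have M0 : 0 < M by rewrite /M; have := modulus_ge0 a; have := modulus_ge0 b; lra.
pose e1 := Num.min 1 (e / (2 * M)).
have e10 : 0 < e1 by rewrite lt_min ltr01/= divr_gt0// mulr_gt0.
have e1e : 2 * M * e1 <= e.
  by rewrite mulrC -ler_pdivlMr ?mulr_gt0// ge_min lexx orbT.
have e11 : e1 <= 1 by rewrite ge_min lexx.
have [d1 d10 H1] := fa _ e10.
have [d2 d20 H2] := gb _ e10.
exists (Num.min d1 (d2 / M)); first by rewrite lt_min d10 divr_gt0.
move=> w; rewrite lt_min => /andP[/H1 {}H1]; rewrite ltr_pdivlMr// => wz.
set h := w - z in H1 wz *; set k := f w - f z in H1 *.
have hk : modulus k <= (modulus a + e1) * modulus h.
  have := modulusD (k - a * h) (a * h); rewrite subrK modulusM mulrDl; lra.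
have h0 : 0 <= modulus h by exact: modulus_ge0.
have hkM : modulus k <= M * modulus h.
  apply: le_trans hk _; rewrite ler_wpM2r// /M; have := modulus_ge0 b; lra.
have /H2 {}H2 : modulus k < d2 by apply: le_lt_trans hkM _; rewrite mulrC.
have -> : g (f w) - g (f z) - b * a * h =
   (g (f w) - g (f z) - b * k) + b * (k - a * h) by ring.
apply: le_trans (modulusD _ _) _; rewrite modulusM.
have : modulus b * modulus (k - a * h) <= modulus b * (e1 * modulus h).
  by rewrite ler_wpM2l ?modulus_ge0.
have : e1 * modulus k <= e1 * (M * modulus h) by rewrite ler_pM2l.
have : modulus b * (e1 * modulus h) <= M * (e1 * modulus h).
  rewrite ler_wpM2r//; first by rewrite mulr_ge0// ltW.
  by rewrite /M; have := modulus_ge0 a; lra.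
have : 2 * M * e1 * modulus h <= e * modulus h by rewrite ler_wpM2r.
rewrite -/k; move: H2; lra.
Qed.

Lemma cdiffV z : z != 0 -> cdiff (fun w => w^-1) z (- z ^- 2).
Proof.
move=> z0 e e0; have mz : 0 < modulus z by rewrite modulus_gt0.
exists (Num.min (modulus z / 2) (e * modulus z ^+ 3 / 2)).
  by rewrite lt_min !divr_gt0// mulr_gt0// exprn_gt0.
move=> w; rewrite lt_min => /andP[wz1 wz2].
have wz : modulus z / 2 <= modulus w.
  have := modulusD (z - w) w; rewrite subrK modulusB; lra.
have w0 : w != 0 by rewrite -modulus_gt0; lra.
have -> : w^-1 - z^-1 - - z ^- 2 * (w - z) = (w - z) * (w - z) / (w * z ^+ 2).
  by field; rewrite z0.
rewrite !modulusM modulusV modulusM modulusX -mulrA [leRHS]mulrC.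
rewrite ler_wpM2l ?modulus_ge0// ler_pdivrMr; last first.
  by rewrite mulr_gt0 ?exprn_gt0// modulus_gt0.
apply: le_trans (ltW wz2) _.
rewrite -!mulrA ler_pM2l//.
have -> : modulus z * (modulus z * (modulus z / 2)) = modulus z / 2 * modulus z ^+ 2 by field.
by rewrite ler_wpM2r// exprn_ge0// modulus_ge0.
Qed.

Lemma cdiff_inv f z a : f z != 0 -> cdiff f z a ->
  cdiff (fun w => (f w)^-1) z (- a / f z ^+ 2).
Proof.
move=> fz fa; apply: cdiff_eq (cdiff_comp fa (cdiffV fz)) _; field.
exact: fz.
Qed.

Lemma cdiff_div f g z a b : g z != 0 -> cdiff f z a -> cdiff g z b ->
  cdiff (fun w => f w / g w) z ((a * g z - f z * b) / g z ^+ 2).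
Proof.
move=> gz fa gb; apply: cdiff_eq (cdiffM fa (cdiff_inv gz gb)) _; field.
exact: gz.
Qed.

Lemma holomorphicP (U : set C) f :
  holomorphic_on U f <-> forall z, U z -> exists a, cdiff f z a.
Proof.
split=> H z Uz.
  exists (derive1 f z); apply/cdiffP; rewrite derive1E.
  by split => //; exact: H.
by have [a /cdiffP[]] := H z Uz.
Qed.

Lemma cdiff_derive1 f z a : cdiff f z a -> derive1 f z = a.
Proof. by move=> /cdiffP[_ <-]; rewrite derive1E. Qed.

Lemma holomorphic_cdiff (U : set C) f z :
  holomorphic_on U f -> U z -> cdiff f z (derive1 f z).
Proof. by move=> /holomorphicP H /H[a fa]; rewrite (cdiff_derive1 fa). Qed.

End calculus.

Section integrals.
Context {R : realType}.
Implicit Types (u v : R -> R) (a b c d m : R).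
Local Notation mu := (@lebesgue_measure R).

Definition integ a b u : R := (\int[mu]_(x in `[a, b]) u x)%R.

Lemma cont_integrable a b u : {in `[a, b], continuous u} ->
  mu.-integrable `[a, b] (EFin \o u).
Proof.
move=> cu; apply: continuous_compact_integrable; first exact: segment_compact.
by apply: continuous_in_subspaceT => x; rewrite inE/=; exact: cu.
Qed.

Lemma integ_split a m b u : a <= m -> m <= b -> {in `[a, b], continuous u} ->
  integ a b u = integ a m u + integ m b u.
Proof.
move=> am mb cu; have iu := cont_integrable cu.
rewrite /integ; have := @Rintegral_itvB R u (BLeft a) (BRight b) m iu.
rewrite !bnd_simp => /(_ am mb) /eqP; rewrite subr_eq => /eqP ->.
rewrite addrC; congr (_ + _).
rewrite Rintegral_itv_obnd_cbnd//; apply: integrableS iu => //.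
by apply: subset_itvr; rewrite bnd_simp.
Qed.

Lemma integ_sub a b u v : {in `[a, b], continuous u} ->
  {in `[a, b], continuous v} ->
  integ a b (fun x => u x - v x) = integ a b u - integ a b v.
Proof. by move=> cu cv; rewrite /integ RintegralB//; exact: cont_integrable. Qed.

Lemma integ_le a b u v : {in `[a, b], continuous u} ->
  {in `[a, b], continuous v} -> {in `[a, b], forall x, u x <= v x} ->
  integ a b u <= integ a b v.
Proof.
by move=> cu cv uv; apply: le_Rintegral => //; exact: cont_integrable.
Qed.

Lemma integ_cst a b k : a <= b -> integ a b (fun=> k) = k * (b - a).
Proof.
move=> ab; rewrite /integ Rintegral_cst//; congr (_ * _).
transitivity (fine (lebesgue_measure (`[a, b]%classic : set R))) => //.
rewrite lebesgue_measure_itv/= lte_fin.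
have [//|ba] := ltP a b.
have -> : a = b by apply/eqP; rewrite eq_le ab.
by rewrite subrr.
Qed.

Lemma integ_bound a b u M : a <= b -> {in `[a, b], continuous u} ->
  {in `[a, b], forall x, `|u x| <= M} -> `|integ a b u| <= M * (b - a).
Proof.
move=> ab cu uM; have ck k : {in `[a, b], continuous (fun=> k : R)}.
  by move=> x _; exact: cst_continuous.
have := integ_le cu (ck M) _; have := integ_le (ck (- M)) cu _.
rewrite !integ_cst// ler_norml -mulNr => -> /=; first apply; move=> x /uM;
  by rewrite ler_norml => /andP[].
Qed.

Lemma eq_int a b u v : {in `[a, b], u =1 v} -> integ a b u = integ a b v.
Proof. by move=> uv; apply: eq_Rintegral => x; rewrite inE/=; exact: uv. Qed.

Lemma integ_ge0 a b u : {in `[a, b], forall x, 0 <= u x} -> 0 <= integ a b u.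
Proof. by move=> H; apply: Rintegral_ge0 => x; exact: H. Qed.

(** A positive value at an interior point bounds [u] from below on an interval
    ending there, which contributes a positive amount. *)
Lemma integ_eq0 a b u : {in `[a, b], continuous u} ->
  {in `[a, b], forall x, 0 <= u x} -> integ a b u = 0 ->
  {in `]a, b[, forall x, u x = 0}.
Proof.
move=> cu u0 iu x xab; apply/eqP; rewrite eq_le u0 ?andbT; last first.
  exact: subset_itv_oo_cc xab.
rewrite leNgt; apply/negP => ux.
have cux : {for x, continuous u} by apply: cu; exact: subset_itv_oo_cc xab.
have : \forall y \near x, u x / 2 < u y.
  by apply: (cvgr_gt _ cux); lra.
move=> /nbhs_ballP[e /= e0 He].
move: xab; rewrite in_itv/= => /andP[ax xb].
pose r := Num.min (e / 2) (Num.min (x - a) (b - x)).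
have r0 : 0 < r by rewrite !lt_min !subr_gt0 ax xb divr_gt0.
have re : r <= e / 2 by rewrite /r ge_min lexx.
have ra : r <= x - a by rewrite /r !ge_min lexx orbT.
have rb : r <= b - x by rewrite /r !ge_min lexx !orbT.
have [h1 h2 h3 h4] : [/\ a <= x - r, x - r <= x, x <= b & x - r <= b].
  by split; lra.
have sub p q : a <= p -> q <= b -> {in `[p, q], forall y, y \in `[a, b]}.
  move=> ap qb y; rewrite !in_itv/= => /andP[py yq].
  by rewrite (le_trans ap py) (le_trans yq qb).
have S1 := integ_split h1 h4 cu; rewrite iu in S1.
have S2 := integ_split h2 h3 (fun y hy => cu y (sub _ _ h1 (lexx b) y hy)).
have P1 := integ_ge0 (fun y hy => u0 y (sub a (x - r) (lexx a) h4 y hy)).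
have P2 := integ_ge0 (fun y hy => u0 y (sub x b (le_trans h1 h2) (lexx b) y hy)).
have ck k : {in `[x - r, x], continuous (fun=> k : R)}.
  by move=> y _; exact: cst_continuous.
have := @integ_le (x - r) x (fun=> u x / 2) u (ck _)
  (fun y hy => cu y (sub _ _ h1 h3 y hy)).
rewrite integ_cst// => I.
have {}I : u x / 2 * (x - (x - r)) <= integ (x - r) x u.
  apply: I => y; rewrite in_itv/= => /andP[y1 y2].
  apply/ltW/He; rewrite /ball/= ltr_norml; clear -y1 y2 re r0 e0; lra.
have : 0 < u x / 2 * (x - (x - r)) by rewrite mulr_gt0// ?divr_gt0//; lra.
clear -I P1 P2 S1 S2; lra.
Qed.

End integrals.

(** * Goursat's theorem for rectangles *)

Section goursat.
Context {R : realType}.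
Local Notation C := (cplx R).
Local Notation re := (@complex.Re R).
Local Notation im := (@complex.Im R).
Implicit Types (a b c d e k x y : R) (F G : C -> C).

Lemma reD (z w : C) : re (z + w) = re z + re w. Proof. by case: z; case: w. Qed.
Lemma imD (z w : C) : im (z + w) = im z + im w. Proof. by case: z; case: w. Qed.
Lemma reN (z : C) : re (- z) = - re z. Proof. by case: z. Qed.
Lemma imN (z : C) : im (- z) = - im z. Proof. by case: z. Qed.
Lemma reM (z w : C) : re (z * w) = re z * re w - im z * im w.
Proof. by case: z; case: w. Qed.
Lemma imM (z w : C) : im (z * w) = re z * im w + im z * re w.
Proof. by case: z; case: w. Qed.

Definition pt x y : C := (x +i* y)%C.

Lemma ptB x y x' y' : pt x y - pt x' y' = pt (x - x') (y - y').
Proof. by []. Qed.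

Lemma modulus_hor x : modulus (pt x 0) = `|x|.
Proof. exact: modulus_real. Qed.

Lemma modulus_ver y : modulus (pt 0 y) = `|y|.
Proof. by rewrite /modulus /= expr0n add0r sqrtr_sqr. Qed.

Lemma modulus_pt_le x y : modulus (pt x y) <= `|x| + `|y|.
Proof. exact: modulus_le_ReIm. Qed.

Lemma continuous_hor F x y : {for pt x y, continuous F} ->
  {for x, continuous (fun x => re (F (pt x y)))} /\
  {for x, continuous (fun x => im (F (pt x y)))}.
Proof.
move=> /continuous_epsP cF.
have H e : 0 < e -> \forall t \near x, modulus (F (pt t y) - F (pt x y)) < e.
  move=> e0; have [d d0 Hd] := cF _ e0; apply/nbhs_ballP; exists d => // t.
  rewrite /ball/= distrC => xt; apply: Hd.
  by rewrite ptB subrr modulus_hor.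
split; apply/cvgrPdist_lt => e e0; apply: filterS (H e e0) => t;
  rewrite distrC; apply: le_lt_trans.
- by rewrite -reN -reD; exact: abs_Re_le.
- by rewrite -imN -imD; exact: abs_Im_le.
Qed.

Lemma continuous_ver F x y : {for pt x y, continuous F} ->
  {for y, continuous (fun y => re (F (pt x y)))} /\
  {for y, continuous (fun y => im (F (pt x y)))}.
Proof.
move=> /continuous_epsP cF.
have H e : 0 < e -> \forall t \near y, modulus (F (pt x t) - F (pt x y)) < e.
  move=> e0; have [d d0 Hd] := cF _ e0; apply/nbhs_ballP; exists d => // t.
  rewrite /ball/= distrC => xt; apply: Hd.
  by rewrite ptB subrr modulus_ver.
split; apply/cvgrPdist_lt => e e0; apply: filterS (H e e0) => t;
  rewrite distrC; apply: le_lt_trans.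
- by rewrite -reN -reD; exact: abs_Re_le.
- by rewrite -imN -imD; exact: abs_Im_le.
Qed.

Lemma continuous_subfun (u v : R -> R) x : {for x, continuous u} ->
  {for x, continuous v} -> {for x, continuous (fun x => u x - v x)}.
Proof. exact: continuousB. Qed.

(** The real part of the integral of [F z dz] along the boundary of the rectangle
    with horizontal sides [a, b] and vertical sides [c, d]. *)
Definition boundary_integ F a b c d : R :=
  integ a b (fun x => re (F (pt x c)) - re (F (pt x d))) -
  integ c d (fun y => im (F (pt b y)) - im (F (pt a y))).

Definition rect_cont F a b c d := forall x y,
  x \in `[a, b] -> y \in `[c, d] -> {for pt x y, continuous F}.

Lemma itv_endl a b : a <= b -> a \in `[a, b].
Proof. by move=> ab; rewrite in_itv/= lexx. Qed.
Lemma itv_endr a b : a <= b -> b \in `[a, b].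
Proof. by move=> ab; rewrite in_itv/= lexx andbT. Qed.

Lemma rect_cont_hor F a b c d y : rect_cont F a b c d -> y \in `[c, d] ->
  {in `[a, b], continuous (fun x => re (F (pt x y)))}.
Proof. by move=> cF yc x xab; have [] := continuous_hor (cF _ _ xab yc). Qed.

Lemma rect_cont_ver F a b c d x : rect_cont F a b c d -> x \in `[a, b] ->
  {in `[c, d], continuous (fun y => im (F (pt x y)))}.
Proof. by move=> cF xc y yab; have [] := continuous_ver (cF _ _ xc yab). Qed.

Lemma in_sub (p q u v t : R) : u <= p -> q <= v -> t \in `[p, q] -> t \in `[u, v].
Proof.
move=> ap qb; rewrite !in_itv/= => /andP[py yq].
by rewrite (le_trans ap py) (le_trans yq qb).
Qed.

Lemma rect_cont_sub F a b c d a' b' c' d' : a <= a' -> b' <= b -> c <= c' ->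
  d' <= d -> rect_cont F a b c d -> rect_cont F a' b' c' d'.
Proof.
move=> aa bb cc dd cF x y xa ya; apply: cF; [exact: in_sub xa|exact: in_sub ya].
Qed.

Lemma boundary_integE F a b c d : a <= b -> c <= d -> rect_cont F a b c d ->
  boundary_integ F a b c d =
    integ a b (fun x => re (F (pt x c))) - integ a b (fun x => re (F (pt x d))) -
    (integ c d (fun y => im (F (pt b y))) - integ c d (fun y => im (F (pt a y)))).
Proof.
move=> ab cd cF; rewrite /boundary_integ !integ_sub//.
- exact: rect_cont_ver cF (itv_endr ab).
- exact: rect_cont_ver cF (itv_endl ab).
- exact: rect_cont_hor cF (itv_endl cd).
- exact: rect_cont_hor cF (itv_endr cd).
Qed.

Lemma boundary_integ_hsplit F a m b c d : a <= m -> m <= b -> c <= d ->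
  rect_cont F a b c d ->
  boundary_integ F a b c d = boundary_integ F a m c d + boundary_integ F m b c d.
Proof.
move=> am mb cd cF; have ab := le_trans am mb.
rewrite !boundary_integE//.
- rewrite (integ_split am mb (rect_cont_hor cF (itv_endl cd))).
  rewrite (integ_split am mb (rect_cont_hor cF (itv_endr cd))).
  by ring.
- exact: rect_cont_sub am (lexx _) (lexx _) (lexx _) cF.
- exact: rect_cont_sub (lexx _) mb (lexx _) (lexx _) cF.
Qed.

Lemma boundary_integ_vsplit F a b c n d : a <= b -> c <= n -> n <= d ->
  rect_cont F a b c d ->
  boundary_integ F a b c d = boundary_integ F a b c n + boundary_integ F a b n d.
Proof.
move=> ab cn nd cF; have cd := le_trans cn nd.
rewrite !boundary_integE//.
- rewrite (integ_split cn nd (rect_cont_ver cF (itv_endl ab))).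
  rewrite (integ_split cn nd (rect_cont_ver cF (itv_endr ab))).
  by ring.
- exact: rect_cont_sub (lexx _) (lexx _) cn (lexx _) cF.
- exact: rect_cont_sub (lexx _) (lexx _) (lexx _) nd cF.
Qed.

Lemma integ_near_cst a b (u : R -> R) k M : a <= b -> {in `[a, b], continuous u} ->
  {in `[a, b], forall x, `|u x - k| <= M} ->
  `|integ a b u - k * (b - a)| <= M * (b - a).
Proof.
move=> ab cu H; have ck : {in `[a, b], continuous (fun=> k : R)}.
  by move=> y _; exact: cst_continuous.
rewrite -integ_cst// -integ_sub//; apply: integ_bound => //.
by move=> x xab; apply: continuousB; [exact: cu | exact: cst_continuous].
Qed.

(** The contributions of an affine function to opposite sides cancel, so only
    the error [k] is integrated over the perimeter. *)
Lemma boundary_integ_affine F a b c d (A L p : C) k : a <= b -> c <= d ->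
  rect_cont F a b c d ->
  (forall x y, x \in `[a, b] -> y \in `[c, d] ->
    modulus (F (pt x y) - A - L * (pt x y - p)) <= k) ->
  `|boundary_integ F a b c d| <= 2 * k * ((b - a) + (d - c)).
Proof.
move=> ab cd cF Fk.
have Ek x y x' y' : x \in `[a, b] -> y \in `[c, d] -> x' \in `[a, b] ->
   y' \in `[c, d] ->
   modulus (F (pt x y) - F (pt x' y') - L * (pt (x - x') (y - y'))) <= 2 * k.
  move=> xa yc xa' yc'; rewrite -ptB.
  have -> : F (pt x y) - F (pt x' y') - L * (pt x y - pt x' y') =
    (F (pt x y) - A - L * (pt x y - p)) -
    (F (pt x' y') - A - L * (pt x' y' - p)) by ring.
  apply: le_trans (modulusD _ _) _; rewrite modulusN.
  have := Fk _ _ xa yc; have := Fk _ _ xa' yc'; lra.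
have H1 := @integ_near_cst a b (fun x => re (F (pt x c)) - re (F (pt x d)))
  (re (L * pt 0 (c - d))) (2 * k) ab.
have H2 := @integ_near_cst c d (fun y => im (F (pt b y)) - im (F (pt a y)))
  (im (L * pt (b - a) 0)) (2 * k) cd.
have {}H1 := H1 _ _; have {}H2 := H2 _ _.
rewrite /boundary_integ.
set I1 := integ a b _ in H1 *; set I2 := integ c d _ in H2 *.
have E : re (L * pt 0 (c - d)) * (b - a) = im (L * pt (b - a) 0) * (d - c).
  by rewrite reM imM /=; ring.
have {}H1 : `|I1 - re (L * pt 0 (c - d)) * (b - a)| <= 2 * k * (b - a).
  apply: H1 => x xa.
    apply: continuous_subfun.
      exact: rect_cont_hor cF (itv_endl cd) _ xa.
    exact: rect_cont_hor cF (itv_endr cd) _ xa.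
  rewrite -!reN -!reD; apply: le_trans (abs_Re_le _) _.
  have := Ek x c x d xa (itv_endl cd) xa (itv_endr cd).
  by rewrite subrr.
have {}H2 : `|I2 - im (L * pt (b - a) 0) * (d - c)| <= 2 * k * (d - c).
  apply: H2 => y ya.
    apply: continuous_subfun.
      exact: rect_cont_ver cF (itv_endr ab) _ ya.
    exact: rect_cont_ver cF (itv_endl ab) _ ya.
  rewrite -!imN -!imD; apply: le_trans (abs_Im_le _) _.
  have := Ek b y a y (itv_endr ab) ya (itv_endl ab) ya.
  by rewrite subrr.
rewrite E in H1; move: H1 H2; rewrite !ler_norml mulrDr.
move=> /andP[? ?] /andP[? ?]; apply/andP; split; lra.
Qed.

End goursat.

Section goursat_bisection.
Context {R : realType}.
Local Notation C := (cplx R).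
Variables (F : C -> C) (a b c d : R).
Hypothesis ab : a <= b.
Hypothesis cd : c <= d.
Hypothesis dF : forall x y, x \in `[a, b] -> y \in `[c, d] ->
  exists L, cdiff F (pt x y) L.

Let cF : rect_cont F a b c d.
Proof. by move=> x y xa yc; have [L /cdiff_continuous] := dF xa yc. Qed.

Let w n : R := (b - a) / 2 ^+ n.
Let h n : R := (d - c) / 2 ^+ n.
Let wS n : w n = w n.+1 + w n.+1.
Proof. by rewrite /w exprS; field; rewrite expf_neq0. Qed.
Let hS n : h n = h n.+1 + h n.+1.
Proof. by rewrite /h exprS; field; rewrite expf_neq0. Qed.
Let w0 n : 0 <= w n. Proof. by rewrite divr_ge0 ?subr_ge0// exprn_ge0. Qed.
Let h0 n : 0 <= h n. Proof. by rewrite divr_ge0 ?subr_ge0// exprn_ge0. Qed.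

(* A rectangle of the n-th generation, given by its corner, that carries its
   share of the boundary integral. *)
Let heavy (J : R) (q : nat * (R * R)) := let: (n, (x, y)) := q in
  [/\ a <= x, x + w n <= b, c <= y & y + h n <= d] /\
  J / 4 ^+ n <= `|boundary_integ F x (x + w n) y (y + h n)|.

Let step (q q' : nat * (R * R)) := q'.1 = q.1.+1 /\
  [/\ q.2.1 <= q'.2.1, q'.2.1 + w q'.1 <= q.2.1 + w q.1,
      q.2.2 <= q'.2.2 & q'.2.2 + h q'.1 <= q.2.2 + h q.1].

Let bisect J q : heavy J q -> exists2 q', heavy J q' & step q q'.
Proof.
case: q => n [x y] [[ax xb cy yd]] Jle.
have w1 := w0 n.+1; have h1 := h0 n.+1; have ws := wS n; have hs := hS n.
have cQ : rect_cont F x (x + w n) y (y + h n).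
  exact: rect_cont_sub ax xb cy yd cF.
have xe : x + w n.+1 + w n.+1 = x + w n by rewrite ws addrA.
have ye : y + h n.+1 + h n.+1 = y + h n by rewrite hs addrA.
have [l1 l2 l3 l4] : [/\ x <= x + w n.+1, x + w n.+1 <= x + w n,
  y <= y + h n.+1 & y + h n.+1 <= y + h n] by split; lra.
have := boundary_integ_hsplit l1 l2 (le_trans l3 l4) cQ.
rewrite (boundary_integ_vsplit l1 l3 l4 (rect_cont_sub (lexx _) l2 (lexx _) (lexx _) cQ)).
rewrite (boundary_integ_vsplit l2 l3 l4 (rect_cont_sub l1 (lexx _) (lexx _) (lexx _) cQ)).
move=> E; rewrite {}E in Jle; move: Jle.
set J1 := boundary_integ F x _ y _; set J2 := boundary_integ F x _ (y + _) _.
set J3 := boundary_integ F _ _ y _; set J4 := boundary_integ F _ _ _ _ => Jle.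
have Jd : J / 4 ^+ n = 4 * (J / 4 ^+ n.+1).
  by rewrite exprS; field; rewrite expf_neq0.
have : [|| J / 4 ^+ n.+1 <= `|J1|, J / 4 ^+ n.+1 <= `|J2|,
           J / 4 ^+ n.+1 <= `|J3| | J / 4 ^+ n.+1 <= `|J4|].
  apply/negP => /negP; rewrite !negb_or -!ltNge => /and4P[? ? ? ?].
  have := ler_normD (J1 + J2) (J3 + J4); have := ler_normD J1 J2.
  have := ler_normD J3 J4; lra.
case/or4P => HJ.
- exists (n.+1, (x, y)); first by rewrite /heavy ?xe ?ye; split => //; split; lra.
  by split => //=; split; lra.
- exists (n.+1, (x, y + h n.+1)); first by rewrite /heavy ?xe ?ye; split => //; split; lra.
  by split => //=; split; lra.
- exists (n.+1, (x + w n.+1, y)); first by rewrite /heavy ?xe ?ye; split => //; split; lra.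
  by split => //=; split; lra.
- exists (n.+1, (x + w n.+1, y + h n.+1)); first by rewrite /heavy ?xe ?ye; split => //; split; lra.
  by split => //=; split; lra.
Qed.

Let nested (u v : nat -> R) : (forall n, u n <= u n.+1) ->
  (forall n, v n.+1 <= v n) -> (forall n, u n <= v n) ->
  exists p, forall n, u n <= p <= v n.
Proof.
move=> ui vd uv.
have um m n : (m <= n)%N -> u m <= u n.
  by move=> mn; apply: (@homo_leq _ u <=%O) mn => //; exact: le_trans.
have vm m n : (m <= n)%N -> v n <= v m.
  by move=> mn; apply: (@homo_leq _ v (fun x y => y <= x)) mn => // x y z xy yz;
    exact: le_trans yz xy.
have U m n : u m <= v n.
  have [mn|/ltnW nm] := leqP m n; first by rewrite (le_trans (um _ _ mn)).
  exact: le_trans (uv m) (vm _ _ nm).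
exists (sup (range u)) => n; apply/andP; split.
  apply: ub_le_sup; last by exists n.
  by exists (v 0%N) => _ [m _ <-]; exact: U.
apply: ge_sup; first by exists (u 0%N), 0%N.
by move=> _ [m _ <-]; exact: U.
Qed.

(** Bisection: one of the four quarters carries at least a fourth of the boundary
    integral. The rectangles obtained shrink to a point where [F] is
    differentiable, and there [boundary_integ_affine] makes the integral an
    arbitrarily small multiple of the square of the diameter. *)
Lemma goursat : boundary_integ F a b c d = 0.
Proof.
apply/eqP/negPn/negP => J0; set J := `|boundary_integ F a b c d|.
have {J0}J0 : 0 < J by rewrite normr_gt0.
have init : heavy J (0%N, (a, c)).
  have wE : w 0 = b - a by rewrite /w expr0 divr1.
  have hE : h 0 = d - c by rewrite /h expr0 divr1.
  by rewrite /heavy wE hE expr0 divr1 !(addrC _ (_ - _)) !subrK; split.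
pose T := {q | heavy J q}.
have next (q : T) : {q' : T | step (projT1 q) (projT1 q')}.
  apply: cid; have [q' hq' sq'] := bisect (projT2 q).
  by exists (exist _ q' hq').
have [s [s0 ss]] := dependent_choice next (exist _ _ init).
pose q n := projT1 (s n).
have q0 : q 0%N = (0%N, (a, c)) by rewrite /q s0.
have qn n : (q n).1 = n.
  by elim: n => [|n IH]; [rewrite q0 | have [-> _] := ss n; rewrite -/(q n) IH].
pose x n := (q n).2.1; pose y n := (q n).2.2.
have qE n : q n = (n, (x n, y n)) by rewrite /x /y; have := qn n; case: (q n) => k [u v] /= ->.
have st n : [/\ x n <= x n.+1, x n.+1 + w n.+1 <= x n + w n,
   y n <= y n.+1 & y n.+1 + h n.+1 <= y n + h n].
  by have [_] := ss n; rewrite -/(q n) -/(q n.+1) !qn.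
have hv n : heavy J (n, (x n, y n)) by rewrite -qE; exact: projT2 (s n).
have [p1 Hp1] := @nested x (fun n => x n + w n) (fun n => let: And4 h _ _ _ := st n in h)
  (fun n => let: And4 _ h _ _ := st n in h) (fun n => ler_wpDr (w0 n) (lexx _)).
have [p2 Hp2] := @nested y (fun n => y n + h n) (fun n => let: And4 _ _ h _ := st n in h)
  (fun n => let: And4 _ _ _ h := st n in h) (fun n => ler_wpDr (h0 n) (lexx _)).
have xq0 : x 0%N = a by rewrite /x q0.
have yq0 : y 0%N = c by rewrite /y q0.
have p1a : p1 \in `[a, b].
  by rewrite in_itv/=; have := Hp1 0%N; rewrite xq0 /w expr0 divr1 addrC subrK.
have p2c : p2 \in `[c, d].
  by rewrite in_itv/=; have := Hp2 0%N; rewrite yq0 /h expr0 divr1 addrC subrK.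
have [L] := dF p1a p2c.
pose D := (b - a) + (d - c).
have D0 : 0 <= D by rewrite /D; have := ab; have := cd; lra.
pose e := J / (2 * D ^+ 2 + 1).
have D2 : 0 <= D ^+ 2 by exact: sqr_ge0.
have e0 : 0 < e by rewrite divr_gt0//; lra.
move=> /(_ e e0)[r r0 Hr].
have [n Hn] : exists n, D / 2 ^+ n < r.
  have : geometric D 2^-1 n @[n --> \oo] --> (0 : R).
    by apply: cvg_geometric; rewrite ger0_norm ?invr_ge0// invf_lt1// ltr1n.
  move=> /cvgr_lt/(_ _ r0)[N _ /(_ _ (leqnn N))].
  by rewrite /geometric/= exprVn; exists N.
have [[ax xb cy yd] HJ] := hv n.
have := @boundary_integ_affine _ F (x n) (x n + w n) (y n) (y n + h n)
  (F (pt p1 p2)) L (pt p1 p2) (e * (D / 2 ^+ n)).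
have -> : x n + w n - x n + (y n + h n - y n) = D / 2 ^+ n.
  by transitivity (w n + h n); [ring | rewrite /w /h -mulrDl].
move=> H; have {}H := H _ _ _ _.
have : `|boundary_integ F (x n) (x n + w n) (y n) (y n + h n)| <=
       2 * (e * (D / 2 ^+ n)) * (D / 2 ^+ n).
  apply: H.
  - by rewrite ler_wpDr.
  - by rewrite ler_wpDr.
  - exact: rect_cont_sub ax xb cy yd cF.
  move=> x' y' xx yy.
  have M : modulus (pt x' y' - pt p1 p2) <= D / 2 ^+ n.
    apply: le_trans (modulus_pt_le _ _) _.
    rewrite /D mulrDl; apply: lerD; rewrite ler_norml.
      by move: xx (Hp1 n); rewrite in_itv/= -/(w n) => /andP[? ?] /andP[? ?]; lra.
    by move: yy (Hp2 n); rewrite in_itv/= -/(h n) => /andP[? ?] /andP[? ?]; lra.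
  apply: le_trans (Hr _ _) _; first exact: le_lt_trans M Hn.
  by rewrite ler_pM2l.
apply/negP; rewrite -ltNge; apply: lt_le_trans HJ.
have -> : 2 * (e * (D / 2 ^+ n)) * (D / 2 ^+ n) = (2 * D ^+ 2 * e) / 4 ^+ n.
  have -> : (4 : R) ^+ n = 2 ^+ n * 2 ^+ n by rewrite -exprMn; congr (_ ^+ _); ring.
  by field; rewrite expf_neq0.
rewrite ltr_pM2r ?invr_gt0 ?exprn_gt0//.
rewrite /e mulrA ltr_pdivrMr; last by lra.
by rewrite mulrC ltr_pM2l//; lra.
Qed.

End goursat_bisection.

(** * Mean value property *)

Section plane_topology.
Context {R : realType}.
Local Notation C := (cplx R).
Local Notation re := (@complex.Re R).
Local Notation im := (@complex.Im R).
Implicit Types (z w c : C) (r : R).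

Definition cdisc c r : set C := [set z | modulus (z - c) <= r].

Lemma closed_epsP (A : set C) : closed A <->
  forall z, ~ A z -> exists2 r : R, 0 < r & forall w, modulus (w - z) < r -> ~ A w.
Proof.
rewrite -openC openP; split=> H z /H [r r0 Hr]; exists r => // w /Hr; exact.
Qed.

Lemma closed_cdisc c r : closed (cdisc c r).
Proof.
apply/closed_epsP => z /negP; rewrite -ltNge => zr.
exists (modulus (z - c) - r); first by rewrite subr_gt0.
move=> w wz; apply/negP; rewrite -ltNge.
have := modulusD (z - w) (w - c); rewrite addrA subrK [modulus (z - w)]modulusB; lra.
Qed.

Lemma continuous_pt : continuous (fun p : R * R => pt p.1 p.2).
Proof.
move=> [x y] A /nbhs_cballP [e e0 He].
have : \forall p \near (x, y), `|x - p.1| < e / 2 /\ `|y - p.2| < e / 2.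
  have e2 : 0 < e / 2 by rewrite divr_gt0.
  exists (ball x (e / 2), ball y (e / 2)).
    by split; apply/nbhs_ballP; exists (e / 2).
  by move=> [u v] [/= ? ?]; split.
apply: filterS => -[u v] /= [ux vy]; apply: He.
change (modulus (pt u v - pt x y) < e); rewrite ptB.
apply: le_lt_trans (modulus_pt_le _ _) _; rewrite distrC (distrC v); lra.
Qed.

Lemma compact_square r : compact [set pt p.1 p.2 | p in
  (`[- r, r]%classic `*` `[- r, r]%classic)].
Proof.
apply: continuous_compact; first exact/continuous_subspaceT/continuous_pt.
by apply: compact_setX; exact: segment_compact.
Qed.

Lemma compact_bounded_closed (A : set C) (r : R) :
  closed A -> (forall z, A z -> modulus z <= r) -> compact A.
Proof.
move=> clA Ar; apply: (subclosed_compact clA (@compact_square r)) => z Az.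
have /Ar zr := Az.
exists (re z, im z); last by case: z {Az zr}.
by split; rewrite /= in_itv/= -ler_norml;
  [apply: le_trans (abs_Re_le _) _|apply: le_trans (abs_Im_le _) _].
Qed.

Lemma compact_cdisc c r : compact (cdisc c r).
Proof.
apply: (@compact_bounded_closed _ (modulus c + r)); first exact: closed_cdisc.
rewrite /cdisc => z /= zc; have := modulusD (z - c) c; rewrite subrK; lra.
Qed.

Lemma continuous_comp_plane (f g : C -> C) z : {for z, continuous f} ->
  {for f z, continuous g} -> {for z, continuous (fun w => g (f w))}.
Proof.
move=> /continuous_epsP cf /continuous_epsP cg.
apply/continuous_epsP => e /cg[d /cf[d' d'0 Hd'] Hd].
by exists d' => // w /Hd' /Hd.
Qed.

Lemma continuous_modulus (q : C -> C) z : {for z, continuous q} ->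
  {for z, continuous (fun w => modulus (q w))}.
Proof.
move=> /continuous_epsP cq A /nbhs_ballP[e e0 He].
have [d d0 Hd] := cq _ e0; apply/nbhs_cballP; exists d => // w /Hd Hw.
apply: He; rewrite /ball/=; move: Hw.
by rewrite modulusB; exact/le_lt_trans/modulus_sub_le.
Qed.

End plane_topology.

Section polar.
Context {R : realType}.
Local Notation C := (cplx R).
Local Notation re := (@complex.Re R).
Local Notation im := (@complex.Im R).
Implicit Types (z w c : C) (r x y t : R).

(** The complex exponential. *)
Definition polar z : C :=
  pt (expR (re z) * cos (im z)) (expR (re z) * sin (im z)).

Lemma polarD z w : polar (z + w) = polar z * polar w.
Proof.
rewrite /polar reD imD expRD cosD sinD /pt.
by congr (_ +i* _)%C; ring.
Qed.

Lemma modulus_polar z : modulus (polar z) = expR (re z).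
Proof.
apply/eqP; rewrite -(@eqrXn2 _ 2)// ?modulus_ge0 ?expR_ge0//.
by rewrite sqr_modulus /= !exprMn -mulrDr cos2Dsin2 mulr1.
Qed.

Lemma is_derive_eps (f : R -> R) x a : is_derive x 1 f a ->
  forall e : R, 0 < e -> exists2 d : R, 0 < d &
    forall y, `|y - x| < d -> `|f y - f x - a * (y - x)| <= e * `|y - x|.
Proof.
move=> [df fa] e e0.
have : h^-1 *: (f (h *: 1 + x) - f x) @[h --> 0^'] --> a.
  by rewrite -fa; exact: df.
move=> /cvgrPdist_lt/(_ e e0).
rewrite /dnbhs /= => /nbhs_ballP [d /= d0 H]; exists d => // y yx.
have [->|yx0] := eqVneq y x; first by rewrite !subrr mulr0 subrr normr0 mulr0.
have h0 : y - x != 0 by rewrite subr_eq0.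
have := H (y - x); rewrite /ball/= sub0r normrN => /(_ yx h0).
rewrite scaler1 subrK /GRing.scale /= => {}H.
have -> : f y - f x - a * (y - x) = - ((a - (y - x)^-1 * (f y - f x)) * (y - x)).
  by rewrite mulrBl mulrAC mulVf// mul1r opprB.
by rewrite normrN normrM ler_wpM2r// ltW.
Qed.

Lemma polar0 : polar 0 = 1.
Proof. by rewrite /polar /= expR0 cos0 sin0 !mul1r. Qed.

(** The derivatives at [0] of the real functions exp, cos and sin, put together. *)
Lemma cdiff_polar0 : cdiff polar 0 1.
Proof.
move=> e e0; pose k := Num.min 1 (e / 6).
have k0 : 0 < k by rewrite lt_min ltr01/= divr_gt0.
have k1 : k <= 1 by rewrite /k ge_min lexx.
have ke : k <= e / 6 by rewrite /k ge_min lexx orbT.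
have [d1 d10 H1] := is_derive_eps (is_derive_expR 0) k0.
have [d2 d20 H2] := is_derive_eps (is_derive_cos 0) k0.
have [d3 d30 H3] := is_derive_eps (is_derive_sin 0) k0.
exists (Num.min (Num.min d1 d2) (Num.min d3 (k / 2))).
  by rewrite !lt_min d10 d20 d30 divr_gt0.
move=> w; rewrite subr0 mul1r !lt_min => /andP[/andP[w1 w2] /andP[w3 w4]].
set m := modulus w in w1 w2 w3 w4 *.
have xm : `|re w| <= m by exact: abs_Re_le.
have ym : `|im w| <= m by exact: abs_Im_le.
have {}H1 := H1 (re w); rewrite subr0 expR0 mul1r in H1.
have {H1}/H1 H1 : `|re w| < d1 by exact: le_lt_trans xm w1.
have {}H2 := H2 (im w); rewrite subr0 cos0 sin0 oppr0 mul0r subr0 in H2.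
have {H2}/H2 H2 : `|im w| < d2 by exact: le_lt_trans ym w2.
have {}H3 := H3 (im w); rewrite subr0 cos0 sin0 mul1r subr0 in H3.
have {H3}/H3 H3 : `|im w| < d3 by exact: le_lt_trans ym w3.
have km1 : k * `|re w| <= k * m by rewrite ler_pM2l.
have km2 : k * `|im w| <= k * m by rewrite ler_pM2l.
have m0 : 0 <= m by exact: modulus_ge0.
have kmm : k * m <= m by rewrite ler_piMl.
have E1 : `|expR (re w) - 1| <= k.
  have := ler_normD (expR (re w) - 1 - re w) (re w); rewrite subrK.
  move: H1 km1 kmm w4 xm; lra.
have E2 : `|expR (re w)| <= 2.
  have := ler_normD (expR (re w) - 1) 1; rewrite subrK normr1; move: E1 k1; lra.
rewrite polar0; apply: le_trans (modulus_le_ReIm _) _.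
rewrite !reD !imD !reN !imN /= oppr0 addr0.
have -> : expR (re w) * cos (im w) - 1 - re w =
   expR (re w) * (cos (im w) - 1) + (expR (re w) - 1 - re w) by ring.
have -> : expR (re w) * sin (im w) - im w =
   expR (re w) * (sin (im w) - im w) + (expR (re w) - 1) * im w by ring.
have A1 := ler_normD (expR (re w) * (cos (im w) - 1)) (expR (re w) - 1 - re w).
have A2 := ler_normD (expR (re w) * (sin (im w) - im w)) ((expR (re w) - 1) * im w).
have B1 : `|expR (re w) * (cos (im w) - 1)| <= 2 * (k * m).
  by rewrite normrM ler_pM//; exact: le_trans H2 km2.
have B2 : `|expR (re w) * (sin (im w) - im w)| <= 2 * (k * m).
  by rewrite normrM ler_pM//; exact: le_trans H3 km2.
have B3 : `|(expR (re w) - 1) * im w| <= k * m by rewrite normrM ler_pM.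
have : k * m <= e / 6 * m by rewrite ler_wpM2r.
move: A1 A2 B1 B2 B3 H1 km1; lra.
Qed.

Lemma cdiff_polar z : cdiff polar z (polar z).
Proof.
have H : cdiff (fun w => w - z) z 1.
  by apply: cdiff_eq (cdiffB (@cdiff_id _ z) (cdiff_cst z z)) _; rewrite subr0.
have H0 := @cdiff_polar0; rewrite -(subrr z) in H0.
have := cdiffZ (polar z) (cdiff_comp H H0); rewrite !mulr1.
apply: cdiff_near; exists 1 => // w _.
by rewrite -polarD addrC subrK.
Qed.

End polar.

Section mean_value.
Context {R : realType}.
Local Notation C := (cplx R).
Local Notation re := (@complex.Re R).
Local Notation im := (@complex.Im R).
Implicit Types (z w c p : C) (r x y t : R).

Definition circle_pt p r t : C := p + pt (r * cos t) (r * sin t).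

Lemma circle_pt_polar p r t : 0 < r -> circle_pt p r t = p + polar (pt (ln r) t).
Proof. by move=> r0; rewrite /circle_pt /polar /= lnK ?posrE. Qed.

Lemma circle_pt_dist p r t : 0 < r -> modulus (circle_pt p r t - p) = r.
Proof.
move=> r0; rewrite circle_pt_polar// addrC addKr modulus_polar /=.
by rewrite lnK ?posrE.
Qed.

Lemma continuous_circle (q : C -> C) p r t : 0 < r ->
  {for circle_pt p r t, continuous q} ->
  {for t, continuous (fun t => im (q (circle_pt p r t)))}.
Proof.
move=> r0; rewrite circle_pt_polar// => cq.
have cF : {for pt (ln r) t, continuous (fun z => q (p + polar z))}.
  pose G : C -> C := fun z => p + polar z.
  apply: (@continuous_comp_plane _ G q _ _ cq).
  exact: (cdiff_continuous (cdiffD (cdiff_cst _ p) (cdiff_polar _))).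
have E : (fun y => im (q (p + polar (pt (ln r) y)))) =
    (fun t => im (q (circle_pt p r t))).
  by apply/funext => y; rewrite circle_pt_polar.
by rewrite -E; have [_] := continuous_ver cF.
Qed.

(** In the coordinate [z = p + exp(s + i t)] the function becomes periodic in [t],
    so the vertical sides of [goursat] on [s, ln r] x [0, 2 pi] give means over
    two circles while the horizontal sides cancel: the mean does not depend on
    the radius, and for small radii it is close to the value at [p]. Continuity
    at [p] is what a difference quotient has at its base point. *)
Lemma mean_value (q : C -> C) p (rho r : R) :
  (forall z, modulus (z - p) < rho -> {for z, continuous q}) ->
  (forall z, 0 < modulus (z - p) < rho -> exists L, cdiff q z L) ->
  0 < r < rho ->
  integ 0 (pi *+ 2) (fun t => im (q (circle_pt p r t))) = im (q p) * (pi *+ 2).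
Proof.
move=> cq dq /andP[r0 rrho].
pose F z := q (p + polar z).
have pi2 : 0 <= pi *+ 2 :> R by rewrite mulrn_wge0// ltW// pi_gt0.
pose m s := integ 0 (pi *+ 2) (fun t => im (F (pt s t))).
have inr z : re z <= ln r -> 0 < modulus (p + polar z - p) < rho.
  move=> zr; rewrite addrC addKr modulus_polar expR_gt0/=.
  by apply: le_lt_trans rrho; rewrite -[leRHS]lnK ?posrE// ler_expR.
have dF z : re z <= ln r -> exists L, cdiff F z L.
  move=> /inr /dq[L HL]; exists (L * (0 + polar z)).
  exact: (cdiff_comp (cdiffD (cdiff_cst z p) (cdiff_polar z)) HL).
have cF s t : s <= ln r -> {for t, continuous (fun t => im (F (pt s t)))}.
  move=> sr; have [L /cdiff_continuous cF] := dF (pt s t) sr.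
  by have [] := continuous_ver cF.
have meq s : s <= ln r -> m s = m (ln r).
  move=> sr.
  have := @goursat _ F s (ln r) 0 (pi *+ 2) sr pi2.
  have dFr x y : x \in `[s, ln r] -> y \in `[0, pi *+ 2] ->
      exists L, cdiff F (pt x y) L.
    by rewrite in_itv/= => /andP[_ xr] _; exact: dF.
  move=> /(_ dFr); rewrite /boundary_integ (@eq_int _ _ _ _ (fun=> 0)); last first.
    by move=> x _; rewrite /F /polar /= cos0 sin0 cos2pi sin2pi subrr.
  rewrite (integ_cst 0 sr) mul0r sub0r => /eqP; rewrite oppr_eq0.
  rewrite (@integ_sub _ 0 (pi *+ 2) (fun t => im (F (pt (ln r) t)))
    (fun t => im (F (pt s t)))).
  - by rewrite subr_eq0 => /eqP E; exact: esym E.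
  - by move=> t _; exact: cF.
  - by move=> t _; exact: cF.
transitivity (m (ln r)).
  by apply: eq_int => t _ /=; rewrite circle_pt_polar.
apply/eqP; rewrite -subr_eq0 -normr_le0; apply/ler_addgt0Pl => e e0.
rewrite addr0; pose e1 := e / (pi *+ 2 + 1).
have e10 : 0 < e1 by rewrite divr_gt0//; lra.
have [d d0 Hd] : exists2 d : R, 0 < d & forall w, modulus (w - p) < d ->
    modulus (q w - q p) < e1.
  have /continuous_epsP/(_ _ e10) // : {for p, continuous q}.
  by apply: cq; rewrite subrr modulus0; lra.
pose s := Num.min (ln r) (ln (d / 2)).
have sr : s <= ln r by rewrite /s ge_min lexx.
have sd : expR s < d.
  apply: (@le_lt_trans _ _ (d / 2)); last lra.
  by rewrite -[leRHS]lnK ?posrE ?divr_gt0// ler_expR /s ge_min lexx orbT.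
rewrite -(meq s sr) -[X in _ * X](subr0).
apply: le_trans (@integ_near_cst _ 0 (pi *+ 2) _ _ e1 pi2 _ _) _.
- by move=> t _; exact: cF.
- move=> t _; rewrite -imN -imD; apply: le_trans (abs_Im_le _) _.
  by apply/ltW/Hd; rewrite addrC addKr modulus_polar.
rewrite subr0 /e1 mulrAC ler_pdivrMr; last lra.
by rewrite ler_pM2l//; lra.
Qed.

End mean_value.

(** * Maximum principle and Schwarz's lemma *)

Section max_principle.
Context {R : realType}.
Local Notation C := (cplx R).
Local Notation re := (@complex.Re R).
Local Notation im := (@complex.Im R).
Implicit Types (z w c p : C) (r x y t M : R).

Lemma max_modulus_compact (A : set C) (g : C -> R) : A !=set0 -> compact A ->
  (forall z, A z -> {for z, continuous g}) ->
  exists2 z, A z & forall w, A w -> g w <= g z.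
Proof.
move=> A0 cA cg; have [|z] := compact_EVT_max A0 cA (f := g).
  by apply: continuous_in_subspaceT => z; rewrite inE; exact: cg.
by rewrite inE => Az H; exists z => // w Aw; apply: H; rewrite inE.
Qed.

(** After multiplication by a constant, [q p = i m] with [m] the maximal modulus.
    The imaginary part of [q] is at most [m] on the circle and has mean [m] there,
    so it equals [m], and the bound on the modulus makes the real part vanish. *)
Lemma circle_max (q : C -> C) p (rho r t : R) :
  (forall z, modulus (z - p) < rho -> {for z, continuous q}) ->
  (forall z, 0 < modulus (z - p) < rho -> exists L, cdiff q z L) ->
  0 < r < rho -> 0 < t < pi *+ 2 ->
  (forall z, modulus (z - p) < rho -> modulus (q z) <= modulus (q p)) ->
  q p = q (circle_pt p r t).
Proof.
move=> cq dq rr tpi qm; have /andP[r0 rrho] := rr.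
have cin s : modulus (circle_pt p r s - p) < rho by rewrite circle_pt_dist.
have [q0|q0] := eqVneq (q p) 0.
  have := qm _ (cin t); rewrite q0 modulus0 => h.
  by apply/esym/eqP; rewrite -modulus_eq0 eq_le h modulus_ge0.
set m := modulus (q p) in qm; have m0 : 0 < m by rewrite modulus_gt0.
pose k : C := pt 0 m / q p.
have kp : k * q p = pt 0 m by rewrite /k divfK.
have mk : modulus k = 1.
  by rewrite /k modulusM modulusV modulus_ver gtr0_norm// divff// gt_eqF.
have ckq z : modulus (z - p) < rho -> {for z, continuous (fun w => k * q w)}.
  move=> /cq/continuous_epsP H; apply/continuous_epsP => e /H[d d0 Hd].
  by exists d => // w /Hd; rewrite -mulrBr modulusM mk mul1r.
have dkq z : 0 < modulus (z - p) < rho -> exists L, cdiff (fun w => k * q w) z L.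
  by move=> /dq[L HL]; exists (k * L); exact: cdiffZ.
have := mean_value ckq dkq rr; rewrite kp /=.
pose h s := m - im (k * q (circle_pt p r s)).
have pi2 : 0 <= pi *+ 2 :> R by rewrite mulrn_wge0// ltW// pi_gt0.
have cc : {in `[0, pi *+ 2],
    continuous (fun s => im (k * q (circle_pt p r s)) : R)}.
  move=> s _; apply: (@continuous_circle _ (fun z => k * q z)) => //.
  exact: ckq.
have cm : {in `[0, pi *+ 2], continuous (fun _ : R => m)}.
  by move=> s _; exact: cst_continuous.
move=> E.
have h0 : integ 0 (pi *+ 2) h = 0.
  by rewrite /h integ_sub// E integ_cst// subr0 subrr.
have him s : im (k * q (circle_pt p r s)) <= m.
  apply: le_trans (ler_norm _) _; apply: le_trans (abs_Im_le _) _.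
  by rewrite modulusM mk mul1r qm.
have := @integ_eq0 _ 0 (pi *+ 2) h _ _ h0 t.
rewrite in_itv/= => /(_ _ _ tpi) ht.
have {}ht : h t = 0.
  apply: ht => s sI; last by rewrite /h subr_ge0.
  by apply: continuous_subfun; [exact: cm | exact: cc].
move/eqP: ht; rewrite /h subr_eq0 => /eqP/esym ht.
have k0 : k != 0 by rewrite -modulus_gt0 mk.
apply: (mulfI k0); rewrite kp.
set u := k * _ in ht *.
have um : modulus u <= m by rewrite /u modulusM mk mul1r qm.
have : re u ^+ 2 <= 0.
  have : modulus u ^+ 2 <= m ^+ 2 by rewrite ler_sqr ?nnegrE ?modulus_ge0// ltW.
  rewrite sqr_modulus ht; lra.
move=> u2; have /eqP : re u ^+ 2 == 0 by rewrite eq_le u2 sqr_ge0.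
move/eqP; rewrite sqrf_eq0 => /eqP ru.
by case: (u) ht ru => a b /= -> ->.
Qed.

(** Among the points of the closed disk where the modulus is maximal, take one
    farthest from the centre. If it were inside, [circle_max] would make the
    modulus maximal on a small circle around it, which reaches farther out. *)
Lemma max_principle (q : C -> C) c r M : 0 < r ->
  (forall z, modulus (z - c) <= r -> {for z, continuous q}) ->
  (forall z, modulus (z - c) < r -> exists2 rho, 0 < rho &
     forall w, 0 < modulus (w - z) < rho -> exists L, cdiff q w L) ->
  (forall z, modulus (z - c) = r -> modulus (q z) <= M) ->
  forall z, modulus (z - c) <= r -> modulus (q z) <= M.
Proof.
move=> r0 cq dq qM z0 z0r; rewrite leNgt; apply/negP => Mz0.
have D0 : cdisc c r !=set0 by exists z0.
have cmod z : cdisc c r z -> {for z, continuous (fun w => modulus (q w))}.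
  by move=> /cq; exact: continuous_modulus.
have [z1 Dz1 Hz1] := max_modulus_compact D0 (@compact_cdisc _ c r) cmod.
pose Z := [set z | cdisc c r z /\ modulus (q z) = modulus (q z1)].
have Z0 : Z !=set0 by exists z1.
have clZ : closed Z.
  apply/closed_epsP => z nZ.
  have [Dz|nDz] := pselect (cdisc c r z); last first.
    have /closed_epsP/(_ _ nDz)[d d0 Hd] := @closed_cdisc _ c r.
    by exists d => // w /Hd nDw [].
  have nq : modulus (q z) != modulus (q z1) by apply/eqP => E; exact: nZ.
  have e0 : 0 < `|modulus (q z) - modulus (q z1)| by rewrite normr_gt0 subr_eq0.
  have /continuous_epsP/(_ _ e0)[d d0 Hd] := cq _ Dz.
  exists d => // w /Hd wz [_ E]; move: wz; rewrite -E.
  by rewrite modulusB; apply/negP; rewrite -leNgt modulus_sub_le.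
have cZ : compact Z.
  by apply: (subclosed_compact clZ (@compact_cdisc _ c r)) => z [].
have cdist z : Z z -> {for z, continuous (fun w => modulus (w - c))}.
  move=> _; apply: continuous_modulus.
  exact: (cdiff_continuous (cdiffB (cdiff_id _) (cdiff_cst _ _))).
have [z2 [Dz2 qz2] Hz2] := max_modulus_compact Z0 cZ cdist.
have M2 : M < modulus (q z2) by rewrite qz2; apply: lt_le_trans Mz0 (Hz1 _ z0r).
have z2r : modulus (z2 - c) < r.
  rewrite lt_neqAle [X in _ && X]Dz2 andbT; apply/eqP => /qM; lra.
have [rho rho0 Hrho] := dq _ z2r.
pose d := Num.min rho (r - modulus (z2 - c)).
have d0 : 0 < d by rewrite lt_min rho0 subr_gt0.
have dD z : modulus (z - z2) < d -> cdisc c r z.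
  rewrite lt_min => /andP[_ zd]; rewrite /cdisc /=.
  have := modulusD (z - z2) (z2 - c); rewrite addrA subrK; lra.
have dr : 0 < d / 2 < d by lra.
(* Moving away from the centre: upwards from the upper half plane, downwards
   from the lower one. *)
pose t : R := if 0 <= im (z2 - c) then pi / 2 else pi / 2 + pi.
have tpi : 0 < t < pi *+ 2.
  have H (P : R) b : 0 < P -> 0 < (if b then P / 2 else P / 2 + P) < P + P.
    by move=> P0; case: b; apply/andP; split; lra.
  by rewrite mulr2n; apply/H/pi_gt0.
have E : q z2 = q (circle_pt z2 (d / 2) t).
  apply: (circle_max (rho := d)) => //.
  - by move=> z /dD /cq.
  - move=> z; rewrite lt_min => /and3P[zz zr _]; apply: Hrho; exact/andP.
  - by move=> z /dD zD; rewrite qz2; exact: Hz1.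
have : Z (circle_pt z2 (d / 2) t).
  split; last by rewrite -E.
  by apply: dD; rewrite circle_pt_dist; lra.
move=> /Hz2; apply/negP; rewrite -ltNge.
rewrite -ltr_sqr ?nnegrE ?modulus_ge0// !sqr_modulus /circle_pt.
have -> (u : C) : z2 + u - c = (z2 - c) + u by ring.
rewrite [in ltRHS]reD [in ltRHS]imD /=.
have -> : cos t = 0.
  by rewrite /t; case: ifP => _; rewrite ?cosDpi cos_pihalf ?oppr0.
rewrite mulr0 addr0 ltrD2l.
set v := im (z2 - c); rewrite /t -/v; case: ifP => v0.
  by rewrite sin_pihalf mulr1 ltr_sqr ?nnegrE//; lra.
rewrite sinDpi sin_pihalf -sqrrN -[ltRHS]sqrrN ltr_sqr ?nnegrE; lra.
Qed.

End max_principle.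

Section schwarz.
Context {R : realType}.
Local Notation C := (cplx R).
Implicit Types (z w c p : C) (r x y t M : R) (f : C -> C).

Definition dquot f p z : C := if z == p then derive1 f p else (f z - f p) / (z - p).

Lemma dquotE f p z : z != p -> dquot f p z = (f z - f p) / (z - p).
Proof. by rewrite /dquot => /negPf ->. Qed.

Lemma dquotpp f p : dquot f p p = derive1 f p.
Proof. by rewrite /dquot eqxx. Qed.

Lemma dquotM f p z : dquot f p z * (z - p) = f z - f p.
Proof.
have [->|zp] := eqVneq z p; first by rewrite !subrr mulr0.
by rewrite dquotE// divfK// subr_eq0.
Qed.

Lemma cdiff_dquot f p z a : z != p -> cdiff f z a ->
  cdiff (dquot f p) z ((a * (z - p) - (f z - f p)) / (z - p) ^+ 2).
Proof.
move=> zp fa.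
have H : cdiff (fun w => (f w - f p) / (w - p)) z
    ((a * (z - p) - (f z - f p)) / (z - p) ^+ 2).
  have zp0 : z - p != 0 by rewrite subr_eq0.
  apply: cdiff_eq (@cdiff_div _ (fun w => f w - f p) (fun w => w - p) _ _ _ zp0
    (cdiffB fa (cdiff_cst z (f p))) (cdiffB (cdiff_id z) (cdiff_cst z p))) _.
  by rewrite !subr0 mulr1.
apply: cdiff_near H; exists (modulus (z - p)).
  by rewrite modulus_gt0 subr_eq0.
move=> w wz; rewrite dquotE//; apply: contraTneq wz => ->.
by rewrite modulusB ltxx.
Qed.

Lemma continuous_dquot f p a : cdiff f p a -> {for p, continuous (dquot f p)}.
Proof.
move=> fa; apply/continuous_epsP => e e0.
have [d d0 Hd] := fa _ (divr_gt0 e0 (ltr0Sn R 1)); exists d => // w wp.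
rewrite dquotpp (cdiff_derive1 fa).
have [->|wp0] := eqVneq w p.
  by rewrite dquotpp (cdiff_derive1 fa) subrr modulus0.
have m0 : 0 < modulus (w - p) by rewrite modulus_gt0 subr_eq0.
rewrite -(ltr_pM2r m0) -modulusM mulrBl dquotM.
apply: le_lt_trans (Hd _ wp) _; rewrite ltr_pM2r//; lra.
Qed.

Lemma le_of_lt_radius x a r M : 0 <= x -> a < r -> 0 <= r -> 0 <= M ->
  (forall s, a < s < r -> x * s <= M) -> x * r <= M.
Proof.
move=> x0 ar r0 M0 H; rewrite leNgt; apply/negP => Mx.
have x1 : 0 < x.
  rewrite lt_neqAle x0 andbT; apply: contraTneq Mx => <-.
  by rewrite mul0r -leNgt.
pose k := M / x; have kr : k < r by rewrite /k ltr_pdivrMr// mulrC.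
pose s := Num.max ((a + r) / 2) ((k + r) / 2).
have := H s; rewrite mulrC -ler_pdivlMr// -/k.
have : (a + r) / 2 <= s by rewrite /s le_max lexx.
have : (k + r) / 2 <= s by rewrite /s le_max lexx orbT.
have : s < r by rewrite /s gt_max; lra.
move=> h1 h2 h3 h4; have := h4 _; rewrite h1 andbT.
have as_ : a < s by lra.
by move=> /(_ as_); lra.
Qed.

(** On a circle of radius [s < r] the quotient is at most [M / s]; the maximum
    principle propagates this inside, and [s] may tend to [r]. *)
Lemma dquot_bound f p r M : 0 < r ->
  (forall z, modulus (z - p) < r -> exists a, cdiff f z a) ->
  (forall z, modulus (z - p) < r -> modulus (f z - f p) <= M) ->
  forall z, modulus (z - p) < r -> modulus (dquot f p z) * r <= M.
Proof.
move=> r0 df fM z zr.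
have M0 : 0 <= M by apply: le_trans (modulus_ge0 _) (fM _ zr).
apply: (@le_of_lt_radius _ (modulus (z - p))) => //; first exact: modulus_ge0.
  exact: ltW.
move=> s /andP[zs sr].
have s0 : 0 < s by apply: le_lt_trans zs; exact: modulus_ge0.
rewrite -ler_pdivlMr//.
have pp : modulus (p - p) < r by rewrite subrr modulus0.
apply: (@max_principle _ (dquot f p) p s) => //; last exact: ltW.
- move=> w ws; have wr : modulus (w - p) < r by exact: le_lt_trans sr.
  have [->|wp] := eqVneq w p; first by have [a /continuous_dquot] := df _ pp.
  by have [a /(cdiff_dquot wp)/cdiff_continuous] := df _ wr.
- move=> w ws; have [wE|wp] := eqVneq w p.
    exists r => // v /andP[vw vr]; rewrite wE in vw vr.
    have vp : v != p by rewrite -subr_eq0 -modulus_gt0.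
    by have [a fa] := df _ vr; eexists; exact: cdiff_dquot fa.
  exists (Num.min (modulus (w - p)) (s - modulus (w - p))).
    by rewrite lt_min modulus_gt0 subr_eq0 wp subr_gt0.
  move=> v; rewrite lt_min => /and3P[vw vp vs].
  have vp0 : v != p by apply: contraTneq vp => ->; rewrite modulusB ltxx.
  have vr : modulus (v - p) < r.
    have := modulusD (v - w) (w - p); rewrite addrA subrK; lra.
  by have [a fa] := df _ vr; eexists; exact: cdiff_dquot fa.
- move=> w ws; have wp : w != p.
    by apply: contraTneq s0 => E; rewrite -ws E subrr modulus0 ltxx.
  rewrite ler_pdivlMr// -ws -modulusM dquotM; apply: fM; lra.
Qed.

Lemma schwarz f r M : 0 < r -> forall p,
  (forall z, modulus (z - p) < r -> exists a, cdiff f z a) ->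
  (forall z, modulus (z - p) < r -> modulus (f z - f p) <= M) ->
  forall z, modulus (z - p) < r -> modulus (f z - f p) <= M / r * modulus (z - p).
Proof.
move=> r0 p df fM z zr; rewrite -dquotM modulusM ler_wpM2r ?modulus_ge0//.
by rewrite ler_pdivlMr//; exact: dquot_bound.
Qed.

End schwarz.

(** * Second order estimate and limits along an ultrafilter *)

Section local_estimates.
Context {R : realType}.
Local Notation C := (cplx R).
Implicit Types (z w c p h u : C) (r x y t M e : R) (f : C -> C).

Definition hol_ball f p r := forall z, modulus (z - p) < r -> exists a, cdiff f z a.
Definition bnd_ball f p r M := forall z, modulus (z - p) < r -> modulus (f z) <= M.

Lemma hol_ball_derive f p r z : hol_ball f p r -> modulus (z - p) < r ->
  cdiff f z (derive1 f z).
Proof. by move=> H /H[a fa]; rewrite (cdiff_derive1 fa). Qed.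

Lemma sub_ball p q r s (z : C) : modulus (q - p) + s <= r -> modulus (z - q) < s ->
  modulus (z - p) < r.
Proof.
have := modulusD (z - q) (q - p); rewrite addrA subrK; lra.
Qed.

Lemma hol_ballS f p q r s : modulus (q - p) + s <= r -> hol_ball f p r ->
  hol_ball f q s.
Proof. by move=> h H z /(sub_ball h); exact: H. Qed.

Lemma bnd_ballS f p q r s M : modulus (q - p) + s <= r -> bnd_ball f p r M ->
  bnd_ball f q s M.
Proof. by move=> h H z /(sub_ball h); exact: H. Qed.

Lemma bnd_ball_diff f p r M z : 0 < r -> bnd_ball f p r M ->
  modulus (z - p) < r -> modulus (f z - f p) <= 2 * M.
Proof.
move=> r0 H zr; apply: le_trans (modulusD _ _) _; rewrite modulusN.
have := H _ zr; have := H p; rewrite subrr modulus0 => /(_ r0); lra.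
Qed.

Lemma lipschitz_ball f p r M z : 0 < r -> hol_ball f p r -> bnd_ball f p r M ->
  modulus (z - p) < r -> modulus (f z - f p) <= 2 * M / r * modulus (z - p).
Proof.
move=> r0 hf bf; apply: (schwarz r0 hf) => w; exact: bnd_ball_diff.
Qed.

Lemma cauchy_bound f p r M : 0 < r -> hol_ball f p r -> bnd_ball f p r M ->
  modulus (derive1 f p) <= 2 * M / r.
Proof.
move=> r0 hf bf; rewrite ler_pdivlMr// -dquotpp.
apply: (dquot_bound r0 hf) => [w|]; first exact: bnd_ball_diff.
by rewrite subrr modulus0.
Qed.

(** The difference quotient with fixed increment, as a function of the base
    point; [dquot] fixes the base point instead. *)
Definition fdq f h z : C := (f (z + h) - f z) / h.

Lemma fdqM f h z : h != 0 -> fdq f h z * h = f (z + h) - f z.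
Proof. by move=> h0; rewrite /fdq divfK. Qed.

Lemma fdq_hol f p r h : hol_ball f p r -> modulus h < r / 2 ->
  hol_ball (fdq f h) p (r / 2).
Proof.
move=> hf hr w wr.
have [a fa] : exists a, cdiff f (w + h) a.
  apply: hf; have -> : w + h - p = (w - p) + h by ring.
  have := modulusD (w - p) h; lra.
have [b fb] : exists a, cdiff f w a.
  by apply: hf; have := modulus_ge0 h; lra.
have T := cdiffD (cdiff_id w) (cdiff_cst w h).
by eexists; apply: cdiffM (cdiffB (cdiff_comp T fa) fb) (cdiff_cst w h^-1).
Qed.

Lemma fdq_bnd f p r M h : 0 < r -> hol_ball f p r -> bnd_ball f p r M ->
  h != 0 -> modulus h < r / 2 -> bnd_ball (fdq f h) p (r / 2) (4 * M / r).
Proof.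
move=> r0 hf bf h0 hr w wr.
have r2 : 0 < r / 2 by rewrite divr_gt0.
rewrite /fdq modulusM modulusV ler_pdivrMr ?modulus_gt0//.
have h1 : hol_ball f w (r / 2) by apply: hol_ballS hf; lra.
have b1 : bnd_ball f w (r / 2) M by apply: bnd_ballS bf; lra.
have := lipschitz_ball (z := w + h) r2 h1 b1; rewrite addrC addKr => /(_ hr).
move=> /le_trans; apply; rewrite ler_wpM2r ?modulus_ge0//.
by rewrite le_eqVlt; apply/orP; left; apply/eqP; field; rewrite gt_eqF.
Qed.

Lemma fdq_lipschitz f p r M h z : 0 < r -> hol_ball f p r -> bnd_ball f p r M ->
  h != 0 -> modulus h < r / 2 -> modulus (z - p) < r / 2 ->
  modulus (fdq f h z - fdq f h p) <= 16 * M / r ^+ 2 * modulus (z - p).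
Proof.
move=> r0 hf bf h0 hr zr.
have r2 : 0 < r / 2 by rewrite divr_gt0.
apply: le_trans (lipschitz_ball r2 (fdq_hol hf hr) (fdq_bnd r0 hf bf h0 hr) zr) _.
rewrite le_eqVlt; apply/orP; left; apply/eqP; field; by rewrite gt_eqF.
Qed.

Lemma fdq_cvg f p a e : cdiff f p a -> 0 < e -> exists2 d : R, 0 < d &
  forall h, h != 0 -> modulus h < d -> modulus (fdq f h p - a) <= e.
Proof.
move=> fa e0; have [d d0 Hd] := fa _ e0; exists d => // h h0 hd.
have := Hd (p + h); rewrite addrAC subrr add0r => /(_ hd).
have m0 : 0 < modulus h by rewrite modulus_gt0.
move=> H; rewrite -(ler_pM2r m0) -modulusM.
by have -> : (fdq f h p - a) * h = f (p + h) - f p - a * h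
  by rewrite [LHS]mulrBl fdqM.
Qed.

(** Write [f z - f p] as a sum over [n] steps of length [h = (z - p) / n]. Each step
    is [h] times a value of [fdq f h], a bounded holomorphic function whose
    Lipschitz constant does not depend on [h] by Schwarz's lemma. As [h] tends to
    [0], [fdq f h p] tends to the derivative. *)
Lemma quad_bound f p r M z : 0 < r -> hol_ball f p r -> bnd_ball f p r M ->
  modulus (z - p) < r / 2 ->
  modulus (f z - f p - derive1 f p * (z - p)) <=
    16 * M / r ^+ 2 * modulus (z - p) ^+ 2.
Proof.
move=> r0 hf bf zr; set u := z - p in zr *; set K := 16 * M / r ^+ 2.
have [u0|u0] := eqVneq u 0.
  have -> : z = p by apply/eqP; rewrite -subr_eq0 -/u u0.
  by rewrite subrr u0 mulr0 subrr modulus0 expr0n mulr0.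
have pp : modulus (p - p) < r by rewrite subrr modulus0.
have mu0 : 0 < modulus u by rewrite modulus_gt0.
apply/ler_addgt0Pr => e e0.
have [d d0 Hd] := fdq_cvg (hol_ball_derive hf pp) (divr_gt0 e0 mu0).
pose n := (Num.bound (modulus u / d)).+1.
have n0 : (n%:R : R) != 0 by rewrite pnatr_eq0.
have n0' : (n%:R : C) != 0 by rewrite pnatr_eq0.
have n1 : 1 <= n%:R :> R by rewrite ler1n.
pose h := u / n%:R.
have mh : modulus h = modulus u / n%:R by rewrite /h modulusM modulusV modulus_nat.
have h0 : h != 0 by rewrite /h mulf_neq0// invr_eq0.
have hd : modulus h < d.
  rewrite mh ltr_pdivrMr ?ltr0n// mulrC -ltr_pdivrMr//.
  apply: lt_le_trans (archi_boundP _) _; first by rewrite divr_ge0// ltW.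
  by rewrite ler_nat.
have hu : modulus h <= modulus u by rewrite mh ler_pdivrMr// ler_peMr// ltW.
have nh : n%:R * h = u by rewrite /h mulrC divfK.
have T m : f (p + m%:R * h) - f p = h * \sum_(k < m) fdq f h (p + k%:R * h).
  elim: m => [|m IH]; first by rewrite big_ord0 mul0r addr0 subrr mulr0.
  rewrite big_ord_recr/= mulrDr -IH [h * fdq _ _ _]mulrC fdqM//.
  have -> : p + m.+1%:R * h = p + m%:R * h + h by rewrite -natr1; ring.
  by ring.
have E : f z - f p - u * fdq f h p =
   h * \sum_(k < n) (fdq f h (p + k%:R * h) - fdq f h p).
  have -> : z = p + n%:R * h by rewrite nh /u addrC subrK.
  rewrite T sumrB sumr_const card_ord -[_ *+ n]mulr_natl -nh; ring.
have B : modulus (f z - f p - u * fdq f h p) <= K * modulus u ^+ 2.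
  rewrite E modulusM.
  have : modulus (\sum_(k < n) (fdq f h (p + k%:R * h) - fdq f h p)) <=
      \sum_(k < n) K * modulus u.
    elim/big_ind2: _ => [|x1 x2 y1 y2 H1 H2|k _]; first by rewrite modulus0.
      by apply: le_trans (modulusD _ _) _; exact: lerD.
    have ku : modulus (p + k%:R * h - p) <= modulus u.
      rewrite addrAC subrr add0r modulusM modulus_nat mh mulrCA.
      apply: ler_piMr; first exact: ltW.
      by rewrite ler_pdivrMr ?ltr0n// mul1r ler_nat ltnW.
    apply: le_trans (fdq_lipschitz r0 hf bf h0 _ _) _.
    - exact: le_lt_trans zr.
    - exact: le_lt_trans ku zr.
    rewrite ler_wpM2l// divr_ge0 ?sqr_ge0// mulr_ge0//.
    by apply: le_trans (modulus_ge0 _) (bf _ pp).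
  rewrite sumr_const card_ord -mulr_natr => H.
  apply: le_trans (ler_wpM2l (modulus_ge0 h) H) _.
  by rewrite mh le_eqVlt; apply/orP; left; apply/eqP; field.
have -> : f z - f p - derive1 f p * u =
   (f z - f p - u * fdq f h p) + u * (fdq f h p - derive1 f p) by ring.
apply: le_trans (modulusD _ _) _; apply: lerD => //.
rewrite modulusM mulrC -ler_pdivlMr//; exact: Hd.
Qed.

End local_estimates.

Section ultralimits.
Context {R : realType} {T : Type} (F : set_system T) {FF : UltraFilter F}.
Local Notation C := (cplx R).
Implicit Types (u v : T -> C) (l : C).

Definition lim_along u l := forall e : R, 0 < e -> F [set t | modulus (u t - l) < e].

Lemma lim_along_cst l : lim_along (fun=> l) l.
Proof. by move=> e e0; apply: filterE => t /=; rewrite subrr modulus0. Qed.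

Lemma lim_alongD u v l m : lim_along u l -> lim_along v m ->
  lim_along (fun t => u t + v t) (l + m).
Proof.
move=> ul vm e e0; have e2 : 0 < e / 2 by rewrite divr_gt0.
apply: filterS (filterI (ul _ e2) (vm _ e2)) => t [/= h1 h2].
have -> : u t + v t - (l + m) = (u t - l) + (v t - m) by ring.
have := modulusD (u t - l) (v t - m); lra.
Qed.

Lemma lim_alongZ u l c : lim_along u l -> lim_along (fun t => c * u t) (c * l).
Proof.
move=> ul e e0; have c0 : 0 < modulus c + 1 by have := modulus_ge0 c; lra.
apply: filterS (ul _ (divr_gt0 e0 c0)) => t /=; rewrite ltr_pdivlMr// => h.
rewrite -mulrBr modulusM; apply: le_lt_trans h; rewrite mulrC.
by rewrite ler_wpM2l ?modulus_ge0//; lra.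
Qed.

Lemma lim_alongB u v l m : lim_along u l -> lim_along v m ->
  lim_along (fun t => u t - v t) (l - m).
Proof.
move=> ul /(@lim_alongZ _ _ (-1)) vm; have := lim_alongD ul vm.
by rewrite mulN1r; under eq_fun do rewrite mulN1r.
Qed.

Lemma lim_along_le u l M : lim_along u l -> F [set t | modulus (u t) <= M] ->
  modulus l <= M.
Proof.
move=> ul uM; apply/ler_addgt0Pr => e /ul {}ul.
have [t [/= h1 h2]] := filter_ex (filterI ul uM).
have := modulusD (l - u t) (u t); rewrite subrK modulusB; lra.
Qed.

Lemma lim_along_unique u l m : lim_along u l -> lim_along u m -> l = m.
Proof.
move=> ul um; apply/eqP; rewrite -subr_eq0 -modulus_eq0 eq_le modulus_ge0 andbT.
apply: (lim_along_le (lim_alongB ul um)); apply: filterE => t /=.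
by rewrite subrr modulus0.
Qed.

Lemma lim_along_comp u l (f : C -> C) : lim_along u l -> {for l, continuous f} ->
  lim_along (fun t => f (u t)) (f l).
Proof.
move=> ul /continuous_epsP cf e /cf[d /ul ud Hd].
by apply: filterS ud => t /= /Hd.
Qed.

Lemma lim_alongM u v l m : lim_along u l -> lim_along v m ->
  lim_along (fun t => u t * v t) (l * m).
Proof.
move=> ul vm e e0; pose k := modulus m + 1 + modulus l.
have k1 : 1 <= k by rewrite /k; have := modulus_ge0 l; have := modulus_ge0 m; lra.
have d0 : 0 < Num.min 1 (e / (2 * k)).
  by rewrite lt_min ltr01 divr_gt0// mulr_gt0//; lra.
apply: filterS (filterI (ul _ d0) (vm _ d0)) => t [].
rewrite /mkset !lt_min => /andP[_ u1] /andP[v1 v2].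
have -> : u t * v t - l * m = (u t - l) * v t + l * (v t - m) by ring.
apply: le_lt_trans (modulusD _ _) _; rewrite !modulusM.
have vt : modulus (v t) <= modulus m + 1.
  by have := modulusD (v t - m) m; rewrite subrK; lra.
set d := e / (2 * k) in u1 v2.
have dk : d * k = e / 2 by rewrite /d; field; rewrite gt_eqF//; lra.
have A1 : modulus (u t - l) * modulus (v t) <= d * (modulus m + 1).
  by apply: ler_pM; rewrite ?modulus_ge0// ltW.
have A2 : modulus l * modulus (v t - m) <= modulus l * d.
  by rewrite ler_wpM2l ?modulus_ge0// ltW.
have : d * (modulus m + 1) + modulus l * d = e / 2 by rewrite -dk /k; ring.
lra.
Qed.

Lemma lim_alongV u l : l != 0 -> lim_along u l ->
  lim_along (fun t => (u t)^-1) l^-1.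
Proof.
by move=> l0 ul; apply: (lim_along_comp ul); exact: cdiff_continuous (cdiffV l0).
Qed.

Lemma lim_along_modulus u l (e : R) : lim_along u l -> 0 < e ->
  F [set t | `|modulus (u t) - modulus l| < e].
Proof.
by move=> ul /ul; apply: filterS => t /=; exact/le_lt_trans/modulus_sub_le.
Qed.

(** Closed disks are compact. For families of functions this pointwise limit plays
    the part of a normal families argument: the estimates of holomorphic functions
    in terms of bounds are uniform, so they pass to the limit. *)
Lemma lim_along_ex u M : F [set t | modulus (u t) <= M] -> exists l, lim_along u l.
Proof.
move=> uM; have PF : ProperFilter (u @ F) by exact: fmap_proper_filter.
have [|l [_ cl]] := @compact_cdisc R 0 M (u @ F) PF.
  have : F [set t | cdisc 0 M (u t)].
    by apply: filterS uM => t; rewrite /cdisc/= subr0.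
  exact.
exists l => e e0; have [//|nF] := in_ultra_setVsetC [set t | modulus (u t - l) < e] FF.
exfalso.
have [w [nw lw]] := cl [set w | ~ modulus (w - l) < e] _ nF (nbhs_cball l e0).
exact: nw lw.
Qed.

Variables (f : T -> C -> C) (g : C -> C) (p : C) (r M : R).
Hypothesis r0 : 0 < r.
Hypothesis hf : F [set t | hol_ball (f t) p r].
Hypothesis bf : F [set t | bnd_ball (f t) p r M].
Hypothesis fg : forall z, modulus (z - p) < r -> lim_along (fun t => f t z) (g z).

(** The quadratic bound is uniform over the family, so it survives the limit. *)
Lemma lim_along_cdiff a : lim_along (fun t => derive1 (f t) p) a -> cdiff g p a.
Proof.
move=> fa e e0; set K := 16 * M / r ^+ 2.
have pp : modulus (p - p) < r by rewrite subrr modulus0.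
have K0 : 0 <= K.
  have [t /= bt] := filter_ex bf.
  rewrite divr_ge0 ?sqr_ge0// mulr_ge0//.
  by apply: le_trans (modulus_ge0 _) (bt _ pp).
exists (Num.min (r / 2) (e / (K + 1))).
  by rewrite lt_min !divr_gt0//; lra.
move=> z; rewrite lt_min => /andP[zr zK].
have zr' : modulus (z - p) < r by apply: lt_trans zr _; rewrite ltr_pdivrMr// ltr_pMr// ltr1n.
have L : lim_along (fun t => f t z - f t p - (z - p) * derive1 (f t) p)
    (g z - g p - (z - p) * a).
  by apply: lim_alongB (lim_alongZ _ fa); apply: lim_alongB; exact: fg.
have : modulus (g z - g p - (z - p) * a) <= K * modulus (z - p) ^+ 2.
  apply: (lim_along_le L); apply: filterS (filterI hf bf) => t [/= ht bt].
  by rewrite [(z - p) * _]mulrC; exact: quad_bound.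
rewrite [(z - p) * a]mulrC => /le_trans; apply.
rewrite expr2 mulrA ler_wpM2r ?modulus_ge0//.
move: zK; rewrite ltr_pdivlMr; last lra.
move=> zK; have m0 := modulus_ge0 (z - p).
by apply: le_trans (ltW zK); rewrite mulrDr mulr1 mulrC lerDl.
Qed.

Lemma lim_along_derive : lim_along (fun t => derive1 (f t) p) (derive1 g p) /\
  cdiff g p (derive1 g p).
Proof.
have [a fa] : exists a, lim_along (fun t => derive1 (f t) p) a.
  apply: (@lim_along_ex _ (2 * M / r)).
  apply: filterS (filterI hf bf) => t [/= ht bt]; exact: cauchy_bound.
have ga := lim_along_cdiff fa.
by rewrite (cdiff_derive1 ga).
Qed.

End ultralimits.

(** * Derivatives, difference quotients and isolated zeros *)

Section removable.
Context {R : realType}.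
Local Notation C := (cplx R).
Implicit Types (z w c p h u : C) (r s x y t M L e : R) (f g : C -> C).

Lemma local_bound f p r : 0 < r -> hol_ball f p r ->
  exists s, [/\ 0 < s, s <= r & bnd_ball f p s (modulus (f p) + 1)].
Proof.
move=> r0 hf; have [|a /cdiff_continuous/continuous_epsP/(_ _ ltr01)] := hf p.
  by rewrite subrr modulus0.
move=> [d d0 Hd]; exists (Num.min d r); split.
- by rewrite lt_min d0.
- by rewrite ge_min lexx orbT.
move=> z; rewrite lt_min => /andP[/Hd zd _].
have := modulusD (f z - f p) (f p); rewrite subrK; lra.
Qed.

(** Along [n] equal steps from [p] to [z] the increments are at most
    [L * modulus h] up to the quadratic error of [quad_bound], whose sum is of
    order [1 / n]. *)
Lemma mean_value_ineq f p r M L z : 0 < r -> hol_ball f p (2 * r) ->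
  bnd_ball f p (2 * r) M -> modulus (z - p) < r ->
  (forall w, modulus (w - p) <= modulus (z - p) -> modulus (derive1 f w) <= L) ->
  modulus (f z - f p) <= L * modulus (z - p).
Proof.
move=> r0 hf bf; set u := z - p => ur fL.
pose K := 16 * M / r ^+ 2.
have M0 : 0 <= M.
  apply: le_trans (modulus_ge0 _) (bf p _); rewrite subrr modulus0; lra.
have K0 : 0 <= K by rewrite divr_ge0 ?sqr_ge0// mulr_ge0.
have mu0 := modulus_ge0 u.
apply/ler_addgt0Pr => e e0.
pose B := K * modulus u ^+ 2 / e + 2.
have B0 : 0 <= B.
  apply: addr_ge0 => //; apply: divr_ge0; last exact: ltW.
  by rewrite mulr_ge0// sqr_ge0.
pose n := (Num.bound B).+1.
have nB : B <= n%:R.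
  by apply: ltW; apply: lt_le_trans (archi_boundP B0) _; rewrite ler_nat.
have n2 : 2 <= n%:R :> R.
  apply: le_trans nB; rewrite lerDr; apply: divr_ge0; last exact: ltW.
  by rewrite mulr_ge0// sqr_ge0.
have n0 : (0 : R) < n%:R by lra.
have n0' : (n%:R : C) != 0 by rewrite pnatr_eq0.
pose h := u / n%:R.
have mh : modulus h = modulus u / n%:R by rewrite /h modulusM modulusV modulus_nat.
have nh : n%:R * h = u by rewrite /h mulrC divfK.
have hr : modulus h < r / 2.
  rewrite mh ltr_pdivrMr//; apply: lt_le_trans ur _; rewrite mulrAC -mulrA.
  by apply: ler_peMr; [exact: ltW | rewrite ler_pdivlMr// mul1r].
have T m : (m <= n)%N -> modulus (f (p + m%:R * h) - f p) <=
    m%:R * ((L + K * modulus h) * modulus h).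
  elim: m => [|m IH] mn; first by rewrite !mul0r addr0 subrr modulus0.
  pose w := p + m%:R * h.
  have -> : p + m.+1%:R * h = w + h by rewrite /w -natr1; ring.
  have wu : modulus (w - p) <= modulus u.
    rewrite /w addrC addKr modulusM modulus_nat mh mulrCA.
    by apply: ler_piMr => //; rewrite ler_pdivrMr// mul1r ler_nat ltnW.
  have wr : modulus (w - p) + r <= 2 * r by lra.
  have := @quad_bound _ f w r M (w + h) r0 (hol_ballS wr hf) (bnd_ballS wr bf).
  rewrite [w + h]addrC addrK => /(_ hr) Q.
  have -> : f (h + w) - f p = (f (h + w) - f w - derive1 f w * h) +
    (derive1 f w * h + (f w - f p)) by ring.
  apply: le_trans (modulusD _ _) _; rewrite -natr1 mulrDl mul1r addrC.
  apply: le_trans (lerD (modulusD _ _) Q) _; rewrite modulusM.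
  have := ler_wpM2r (modulus_ge0 h) (fL w wu); have := IH (ltnW mn).
  by rewrite -/w -/K expr2; lra.
have -> : z = p + n%:R * h by rewrite nh /u addrC subrK.
apply: le_trans (T n (leqnn n)) _.
have -> : n%:R * ((L + K * modulus h) * modulus h) =
    L * modulus u + K * modulus u ^+ 2 / n%:R.
  by rewrite mh; field; rewrite gt_eqF.
rewrite lerD2l ler_pdivrMr// [leRHS]mulrC -ler_pdivrMr//.
apply: le_trans nB; rewrite /B; lra.
Qed.

Lemma oo_ultra : exists2 F : set_system nat, UltraFilter F & \oo `<=` F.
Proof. by have [F [UF HF]] := ultraFilterLemma eventually_filter; exists F. Qed.

(** The derivative is the limit of the bounded holomorphic functions [fdq f h]. *)
Lemma derive_cdiff f p r : 0 < r -> hol_ball f p r ->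
  exists a, cdiff (derive1 f) p a.
Proof.
move=> r0 hf; have [s [s0 sr bf]] := local_bound r0 hf; set M := _ + 1 in bf.
have {}hf : hol_ball f p s by move=> z zs; apply: hf; apply: lt_le_trans sr.
have [F UF ooF] := oo_ultra.
pose h n : C := ((s / 2 / n.+2%:R)%:C)%C.
have h0 n : h n != 0.
  by rewrite -modulus_gt0 modulus_real normr_gt0 !mulf_neq0 ?invr_eq0// gt_eqF.
have mh n : modulus (h n) = s / 2 / n.+2%:R.
  by rewrite modulus_real ger0_norm// !divr_ge0// ltW.
have hs n : modulus (h n) < s / 2.
  rewrite mh ltr_pdivrMr ?ltr0n// ltr_pMr ?divr_gt0//; by rewrite ltr1n.
have s2 : 0 < s / 2 by rewrite divr_gt0.
have L z : modulus (z - p) < s / 2 ->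
    lim_along F (fun n => fdq f (h n) z) (derive1 f z).
  move=> zs e e0; apply: ooF.
  have zs' : modulus (z - p) < s by lra.
  have [d d0 Hd] := fdq_cvg (hol_ball_derive hf zs') (divr_gt0 e0 (ltr0Sn R 1)).
  exists (Num.bound (s / d)) => // n /= nN.
  apply: le_lt_trans (Hd _ (h0 n) _) _; last lra.
  have sd : 0 <= s / d by rewrite divr_ge0// ltW.
  have : s / d < n.+2%:R.
    apply: lt_le_trans (archi_boundP sd) _; rewrite ler_nat.
    by apply: leq_trans nN _; rewrite -addn2 leq_addr.
  rewrite mh !ltr_pdivrMr ?ltr0n// [_ * d]mulrC; lra.
have A1 : F [set n | hol_ball (fdq f (h n)) p (s / 2)].
  by apply: filterE => n; exact: fdq_hol.
have A2 : F [set n | bnd_ball (fdq f (h n)) p (s / 2) (4 * M / s)].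
  by apply: filterE => n; exact: fdq_bnd.
have [_ H] := lim_along_derive s2 A1 A2 L.
by exists (derive1 (derive1 f) p).
Qed.

Lemma hol_ball_at f p r z : hol_ball f p r -> modulus (z - p) < r ->
  exists2 s, 0 < s & hol_ball f z s.
Proof.
move=> hf zr; exists (r - modulus (z - p)); first by rewrite subr_gt0.
by apply: hol_ballS hf; lra.
Qed.

Lemma hol_ball_derive1 f p r : hol_ball f p r -> hol_ball (derive1 f) p r.
Proof.
by move=> hf z /(hol_ball_at hf)[s s0 hz]; exact: derive_cdiff hz.
Qed.

(** Subtracting from [f] its second order Taylor polynomial at [p] leaves a function
    [G] whose derivative is of second order by [quad_bound] for [f'], so that [G]
    is of third order by [mean_value_ineq]. *)
Lemma dquot_cdiff f p r : 0 < r -> hol_ball f p r ->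
  exists a, cdiff (dquot f p) p a.
Proof.
move=> r0 hf; pose a := derive1 f p; pose b := derive1 (derive1 f) p.
pose G z := f z - f p - a * (z - p) - b / 2 * (z - p) ^+ 2.
have dG z : modulus (z - p) < r ->
    cdiff G z (derive1 f z - a - b * (z - p)).
  move=> zr; have fz := hol_ball_derive hf zr.
  have idp := cdiffB (cdiff_id z) (cdiff_cst z p).
  have := cdiffB (cdiffB (cdiffB fz (cdiff_cst z (f p))) (cdiffZ a idp))
    (cdiffZ (b / 2) (cdiffM idp idp)).
  by move/cdiff_eq; apply; field.
have hG : hol_ball G p r by move=> z /dG; eexists; eassumption.
have [s [s0 sr bf]] := local_bound r0 (hol_ball_derive1 hf).
have [s' [s'0 s'r bG]] := local_bound r0 hG.
set N := _ + 1 in bf; set M := _ + 1 in bG.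
pose K := 16 * N / s ^+ 2.
have K0 : 0 <= K.
  rewrite divr_ge0 ?sqr_ge0// mulr_ge0// addr_ge0//; exact: modulus_ge0.
exists (b / 2) => e e0.
exists (Num.min (s / 2) (Num.min (s' / 2) (e / (K + 1)))).
  by rewrite !lt_min !divr_gt0//; lra.
move=> z; rewrite !lt_min => /and3P[zs zs' ze].
have [->|zp] := eqVneq z p; first by rewrite !subrr mulr0 subrr modulus0 mulr0.
have GB : modulus (G z - G p) <= K * modulus (z - p) ^+ 2 * modulus (z - p).
  apply: (@mean_value_ineq _ _ (s' / 2) M) => //.
  - by rewrite divr_gt0.
  - by rewrite mulrC divfK// => w ws; apply: hG; exact: lt_le_trans s'r.
  - by rewrite mulrC divfK.
  move=> w wz.
  have wr : modulus (w - p) < r by lra.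
  rewrite (cdiff_derive1 (dG w wr)).
  have hs : hol_ball (derive1 f) p s.
    by move=> v vs; apply: (hol_ball_derive1 hf); exact: lt_le_trans sr.
  apply: le_trans (quad_bound s0 hs bf _) _; first exact: le_lt_trans zs.
  by rewrite -/K ler_wpM2l// ler_sqr ?nnegrE ?modulus_ge0.
have m0 : 0 < modulus (z - p) by rewrite modulus_gt0 subr_eq0.
rewrite dquotpp -(ler_pM2r m0) -modulusM.
have -> : (dquot f p z - f^`()%classic p - b / 2 * (z - p)) * (z - p) = G z - G p.
  by rewrite [LHS]mulrBl mulrBl dquotM /G -/a; ring.
apply: le_trans GB _; rewrite ler_pM2r// expr2 mulrA ler_pM2r//.
move: ze; rewrite ltr_pdivlMr; last lra.
by move=> /ltW; apply: le_trans; rewrite mulrDr mulr1 mulrC lerDl ltW.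
Qed.

Lemma dquot_hol f p r : 0 < r -> hol_ball f p r -> hol_ball (dquot f p) p r.
Proof.
move=> r0 hf z zr; have [->|zp] := eqVneq z p; first exact: dquot_cdiff hf.
by have [a fa] := hf _ zr; eexists; exact: cdiff_dquot fa.
Qed.

(** Either all the quotients by powers of [z - p] vanish at [p], and then [f] is
    bounded by every term of a geometric sequence, or one of them does not. *)
Lemma isolated_zeros f p r M : 0 < r -> hol_ball f p r -> bnd_ball f p r M ->
  (forall z, modulus (z - p) < r -> f z = 0) \/
  (exists2 s, 0 < s & forall z, 0 < modulus (z - p) < s -> f z <> 0).
Proof.
move=> r0 hf bf; have [?|noniso] := pselect (exists2 s, 0 < s &
  forall z, 0 < modulus (z - p) < s -> f z <> 0); [by right|left].
have fac n : exists k, [/\ hol_ball k p r, bnd_ball k p r (M / r ^+ n) &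
    forall z, modulus (z - p) < r -> f z = k z * (z - p) ^+ n].
  elim: n => [|n [k [hk bk fk]]].
    by exists f; split => // [|z _]; rewrite ?expr0 ?divr1 ?mulr1.
  have pp : modulus (p - p) < r by rewrite subrr modulus0.
  have [kp|kp] := eqVneq (k p) 0; last first.
    have [a /cdiff_continuous/continuous_epsP] := hk _ pp.
    have mk : 0 < modulus (k p) by rewrite modulus_gt0.
    move=> /(_ _ mk)[d d0 Hd]; exfalso; apply: noniso.
    exists (Num.min d r); first by rewrite lt_min d0.
    move=> z; rewrite lt_min => /and3P[z0 zd zr].
    rewrite fk//; apply/eqP; rewrite mulf_neq0 ?expf_neq0 -?modulus_gt0//.
    have := Hd _ zd; have := modulusD (k p - k z) (k z).
    by rewrite subrK modulusB; lra.
  exists (dquot k p); split.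
  - exact: dquot_hol.
  - move=> z zr; rewrite exprS invfM mulrCA mulrC ler_pdivlMr//.
    by apply: (dquot_bound r0 hk) => // w wr; rewrite kp subr0; exact: bk.
  - by move=> z zr; rewrite fk// exprS mulrA dquotM kp subr0.
move=> z zr; apply/eqP; rewrite -modulus_eq0 eq_le modulus_ge0 andbT.
have q1 : `|modulus (z - p) / r| < 1.
  by rewrite ger0_norm ?divr_ge0 ?modulus_ge0 ?ltW// ltr_pdivrMr// mul1r.
have /cvgr_lt Hg := cvg_geometric M q1.
apply/ler_addgt0Pr => e /Hg[n _ /(_ _ (leqnn n))].
rewrite add0r /geometric/= => /ltW; apply: le_trans.
have [k [_ bk ->]] := fac n => //.
rewrite modulusM modulusX expr_div_n mulrA mulrAC.
by rewrite ler_wpM2r ?exprn_ge0 ?modulus_ge0//; exact: bk.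
Qed.

End removable.

(** * Open mapping and inverse functions *)

Section open_mapping.
Context {R : realType}.
Local Notation C := (cplx R).
Implicit Types (z w c p h u : C) (r s x y t M L e : R) (f g : C -> C).

Lemma circle_min f p r : 0 < r ->
  (forall z, modulus (z - p) = r -> {for z, continuous f}) ->
  (forall z, modulus (z - p) = r -> f z != 0) ->
  exists2 m : R, 0 < m & forall z, modulus (z - p) = r -> m <= modulus (f z).
Proof.
move=> r0 cf f0; pose A := [set z | modulus (z - p) = r].
have A0 : A !=set0 by exists (circle_pt p r 0); rewrite /A/= circle_pt_dist.
have clA : closed A.
  apply/closed_epsP => z /eqP; rewrite -subr_eq0 -normr_gt0 => zr.
  exists `|modulus (z - p) - r| => // w wz Aw.
  have := modulus_sub_le (z - p) (w - p); rewrite Aw opprB addrA subrK [modulus (z - w)]modulusB.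
  by apply/negP; rewrite -ltNge.
have cA : compact A.
  apply: (subclosed_compact clA (@compact_cdisc _ p r)) => z.
  by rewrite /A /cdisc /= => ->.
have cm z : A z -> {for z, continuous (fun z => - modulus (f z) : R)}.
  by move=> /cf/continuous_modulus; exact: continuousN.
have [z Az Hz] := max_modulus_compact A0 cA cm.
exists (modulus (f z)); first by rewrite modulus_gt0 f0.
by move=> w /Hz; rewrite lerN2.
Qed.

(** The maximum principle for [1 / f]. *)
Lemma min_principle f p r m : 0 < r ->
  (forall z, modulus (z - p) <= r -> exists a, cdiff f z a) ->
  (forall z, modulus (z - p) <= r -> f z != 0) -> 0 < m ->
  (forall z, modulus (z - p) = r -> m <= modulus (f z)) -> m <= modulus (f p).
Proof.
move=> r0 hf f0 m0 fm.
have pp : modulus (p - p) <= r by rewrite subrr modulus0 ltW.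
have dg z : modulus (z - p) <= r -> exists a, cdiff (fun w => (f w)^-1) z a.
  move=> zr; have [a fa] := hf _ zr; have fz := f0 _ zr.
  by eexists; exact: cdiff_inv fz fa.
have := @max_principle _ (fun w => (f w)^-1) p r m^-1 r0 _ _ _ p pp.
rewrite modulusV lef_pV2 ?posrE ?modulus_gt0 ?f0//; apply.
- by move=> z /dg[a /cdiff_continuous].
- move=> z zr; exists (r - modulus (z - p)); first by rewrite subr_gt0.
  move=> w /andP[_ wz]; apply: dg.
  have := modulusD (w - z) (z - p); rewrite addrA subrK; lra.
- move=> z zr; rewrite modulusV lef_pV2 ?posrE ?fm//.
  by rewrite modulus_gt0 f0// zr.
Qed.

(** If [f] avoided a value [w] close to [f p], then [f - w] would have no zero, be
    small at [p] and not small on the circle, against [min_principle]. *)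
Lemma open_at f p r : 0 < r ->
  (forall z, modulus (z - p) <= r -> exists a, cdiff f z a) ->
  (forall z, modulus (z - p) = r -> f z != f p) ->
  exists2 d : R, 0 < d & forall w, modulus (w - f p) < d ->
    exists2 z, modulus (z - p) < r & f z = w.
Proof.
move=> r0 hf fp.
have dfw w z : modulus (z - p) <= r -> exists a, cdiff (fun v => f v - w) z a.
  by move=> /hf[a fa]; exists (a - 0); exact: cdiffB fa (cdiff_cst z w).
have [|z zr|m m0 Hm] := @circle_min (fun z => f z - f p) p r r0.
- move=> z zr; have [|a /cdiff_continuous //] := dfw (f p) z; by rewrite zr.
- by rewrite subr_eq0 fp.
exists (m / 2) => [|w wm]; first by rewrite divr_gt0.
have [//|nex] := pselect (exists2 z, modulus (z - p) < r & f z = w); exfalso.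
have far z : modulus (z - p) = r -> m / 2 <= modulus (f z - w).
  move=> zr; have := Hm z zr; have := modulusD (f z - w) (w - f p).
  rewrite addrA subrK; lra.
have nz z : modulus (z - p) <= r -> f z - w != 0.
  rewrite le_eqVlt => /predU1P[/far|zr]; first by rewrite -modulus_gt0; lra.
  by apply/eqP => /eqP; rewrite subr_eq0 => /eqP E; apply: nex; exists z.
have := min_principle r0 (dfw w) nz (divr_gt0 m0 (ltr0Sn R 1)) far.
by rewrite modulusB; lra.
Qed.

Definition inj_ball f p r := forall z w, modulus (z - p) < r ->
  modulus (w - p) < r -> f z = f w -> z = w.

Lemma derive0_const f p r : 0 < r -> hol_ball f p r ->
  (forall z, modulus (z - p) < r -> derive1 f z = 0) ->
  exists2 s, 0 < s & forall z, modulus (z - p) < s -> f z = f p.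
Proof.
move=> r0 hf f0; have [s [s0 sr bf]] := local_bound r0 hf.
exists (s / 2) => [|z zs]; first by rewrite divr_gt0.
apply/eqP; rewrite -subr_eq0 -modulus_eq0 eq_le modulus_ge0 andbT.
rewrite -(mul0r (modulus (z - p))).
apply: (@mean_value_ineq _ _ _ (s / 2) (modulus (f p) + 1)) => //.
- by rewrite divr_gt0.
- by rewrite mulrC divfK// => w ws; apply: hf; exact: lt_le_trans sr.
- by rewrite mulrC divfK.
- by move=> w wz; rewrite f0 ?modulus0//; lra.
Qed.

(** Where [f'] vanishes but does not vanish identically, the difference
    quotients at nearby points have no zero, and tend to one that has: this is
    what Hurwitz's theorem forbids. *)
Lemma inj_derive_neq0 f p r : 0 < r -> hol_ball f p r -> inj_ball f p r ->
  derive1 f p != 0.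
Proof.
move=> r0 hf injf; apply/eqP => fp0.
have pp : modulus (p - p) < r by rewrite subrr modulus0.
have [s [s0 sr bf']] := local_bound r0 (hol_ball_derive1 hf).
have hf' : hol_ball (derive1 f) p s.
  by move=> z zs; apply: (hol_ball_derive1 hf); exact: lt_le_trans sr.
have [f'0|[s' s'0 f'0]] := isolated_zeros s0 hf' bf'.
  have hfs : hol_ball f p s by move=> z zs; apply: hf; exact: lt_le_trans sr.
  have [t t0 ft] := derive0_const s0 hfs f'0.
  pose k := Num.min t r / 2; have k0 : 0 < k by rewrite divr_gt0// lt_min t0.
  have D0 : 0 < Num.min t r by rewrite lt_min t0.
  have kt : k < Num.min t r by rewrite /k; lra.
  have kp : modulus (p + k%:C%C - p) = k.
    by rewrite addrC addKr modulus_real gtr0_norm.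
  move: kt; rewrite lt_min => /andP[kt kr].
  have := injf (p + k%:C%C) p; rewrite kp => /(_ kr pp (ft _ _)).
  rewrite kp => /(_ kt) E; move: kp; rewrite E subrr modulus0 => E0.
  by rewrite -E0 ltxx in k0.
pose rho := r / 2; have rho0 : 0 < rho by rewrite divr_gt0.
have rr : rho < r by rewrite /rho; lra.
have far z : modulus (z - p) = rho -> f z - f p != 0.
  move=> zr; rewrite subr_eq0; apply/eqP => E.
  have zp : z = p by apply: injf => //; rewrite zr.
  by move: rho0; rewrite -zr zp subrr modulus0 ltxx.
have cfar z : modulus (z - p) = rho -> {for z, continuous (fun z => f z - f p)}.
  move=> zr; have [|a fa] := hf z; first by rewrite zr.
  exact: cdiff_continuous (cdiffB fa (cdiff_cst z (f p))).
have [m m0 Hm] := circle_min rho0 cfar far.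
have [a fa] := hf _ pp; have := fa _ ltr01.
move: (cdiff_continuous fa) => /continuous_epsP/(_ (m / 2)).
have := continuous_dquot fa => /continuous_epsP/(_ (m / 2 / (2 * rho))).
have M0 : 0 < m / 2 / (2 * rho) by rewrite !divr_gt0// mulr_gt0.
move=> /(_ M0)[d1 d10 H1] /(_ (divr_gt0 m0 (ltr0Sn R 1)))[d2 d20 H2] _.
pose k := Num.min (Num.min d1 d2) (Num.min s' rho) / 2.
have D0 : 0 < Num.min (Num.min d1 d2) (Num.min s' rho).
  by rewrite !lt_min d10 d20 s'0.
have k0 : 0 < k by rewrite divr_gt0.
have : k < Num.min (Num.min d1 d2) (Num.min s' rho) by rewrite /k; lra.
rewrite !lt_min => /andP[/andP[kd1 kd2] /andP[ks krho]].
pose w := p + k%:C%C.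
have wp : modulus (w - p) = k by rewrite /w addrC addKr modulus_real gtr0_norm.
have wr : modulus (w - p) < r by rewrite wp; exact: lt_trans rr.
have wpn : w != p by rewrite -subr_eq0 -modulus_gt0 wp.
have hw : forall z, modulus (z - p) <= rho -> exists a, cdiff (dquot f w) z a.
  move=> z zr; have zr' : modulus (z - p) < r by exact: le_lt_trans rr.
  have [->|zw] := eqVneq z w.
    have [t t0 ht] := hol_ball_at hf wr; exact: dquot_cdiff t0 ht.
  by have [b fb] := hf _ zr'; eexists; exact: cdiff_dquot fb.
have nw z : modulus (z - p) <= rho -> dquot f w z != 0.
  move=> zr; have zr' : modulus (z - p) < r by exact: le_lt_trans rr.
  have [->|zw] := eqVneq z w.
    by rewrite dquotpp; apply/eqP; apply: f'0; rewrite wp k0.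
  rewrite dquotE// mulf_neq0 ?invr_eq0 ?subr_eq0//.
  by apply: contra zw => /eqP E; apply/eqP; exact: injf.
have fw : modulus (f w - f p) < m / 2 by apply: H2; rewrite wp.
have mw z : modulus (z - p) = rho -> m / 2 / (2 * rho) <= modulus (dquot f w z).
  move=> zr; have zw : z != w.
    by apply: contraTneq krho => E; rewrite -wp -E zr ltxx.
  rewrite dquotE// modulusM modulusV.
  have A1 : modulus (z - w) <= 2 * rho.
    have := modulusD (z - p) (p - w); rewrite addrA subrK [modulus (p - w)]modulusB.
    rewrite wp zr; lra.
  have A2 : m / 2 <= modulus (f z - f w).
    have := Hm z zr; have := modulusD (f z - f w) (f w - f p).
    rewrite addrA subrK; lra.
  apply: ler_pM => //; first by rewrite divr_ge0// ltW.
    by rewrite invr_ge0 mulr_ge0// ltW.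
  rewrite lef_pV2 ?posrE//; first by rewrite mulr_gt0.
  by rewrite modulus_gt0 subr_eq0.
have := min_principle rho0 hw nw M0 mw.
have -> : dquot f w p = dquot f p w.
  rewrite !dquotE//; last by rewrite eq_sym.
  by rewrite -opprB -[p - w]opprB invrN mulrNN.
have := H1 w; rewrite dquotpp fp0 subr0 wp => /(_ kd1); lra.
Qed.

Lemma inj_open f p r s : 0 < s -> s <= r -> hol_ball f p r -> inj_ball f p r ->
  exists2 d : R, 0 < d & forall w, modulus (w - f p) < d ->
    exists2 z, modulus (z - p) < s & f z = w.
Proof.
move=> s0 sr hf injf; have s2 : 0 < s / 2 by rewrite divr_gt0.
have [z zs|z zs|d d0 Hd] := @open_at f p (s / 2) s2.
- by apply: hf; lra.
- apply/eqP => /injf E; have : z = p by apply: E; rewrite ?zs ?subrr ?modulus0; lra.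
  by move=> zp; move: s2; rewrite -zs zp subrr modulus0 ltxx.
exists d => // w /Hd[z zs fz]; exists z => //; lra.
Qed.

(** Near [p] the increment of [f] is at least half of [modulus b] times that of its
    argument, so a small increment of [f] comes from a small one of the argument
    and the error for [f] is an error for [g]. *)
Lemma inverse_cdiff f g p r : 0 < r -> hol_ball f p r -> inj_ball f p r ->
  (forall z, modulus (z - p) < r -> g (f z) = z) ->
  cdiff g (f p) (derive1 f p)^-1.
Proof.
move=> r0 hf injf gf; have f'0 := inj_derive_neq0 r0 hf injf.
have pp : modulus (p - p) < r by rewrite subrr modulus0.
have fp := hol_ball_derive hf pp.
set b := derive1 f p in f'0 fp *; have b0 : 0 < modulus b by rewrite modulus_gt0.
move=> e e0; pose k := Num.min (modulus b / 2) (e * modulus b * modulus b / 2).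
have k0 : 0 < k by rewrite lt_min !divr_gt0// !mulr_gt0.
have kb : k <= modulus b / 2 by rewrite /k ge_min lexx.
have ke : k <= e * modulus b * modulus b / 2 by rewrite /k ge_min lexx orbT.
have [d d0 Hd] := fp _ k0.
pose s := Num.min d r.
have s0 : 0 < s by rewrite lt_min d0.
have sr : s <= r by rewrite ge_min lexx orbT.
have [d' d'0 Hd'] := inj_open s0 sr hf injf.
exists d' => // w /Hd'[z]; rewrite lt_min => /andP[zd zr] <-.
rewrite !gf//; have := Hd z zd; set h := z - p; set v := f z - f p => H.
have vb : modulus b / 2 * modulus h <= modulus v.
  have := modulusD (b * h - v) v; rewrite subrK modulusM [modulus (_ - v)]modulusB.
  have : k * modulus h <= modulus b / 2 * modulus h.
    by rewrite ler_wpM2r ?modulus_ge0.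
  lra.
have -> : h - b^-1 * v = - b^-1 * (v - b * h) by field.
rewrite modulusM modulusN modulusV mulrC ler_pdivrMr//.
apply: le_trans H _.
apply: le_trans (ler_wpM2r (modulus_ge0 h) ke) _.
have : e * modulus b * (modulus b / 2 * modulus h) <= e * modulus b * modulus v.
  by rewrite ler_wpM2l// mulr_ge0// ltW.
lra.
Qed.

End open_mapping.

(** * Moebius maps and the Schwarz-Pick lemma *)

Section schwarz_pick.
Context {R : realType}.
Local Notation C := (cplx R).
Local Notation re := (@complex.Re R).
Local Notation im := (@complex.Im R).
Implicit Types (z w c p h u a b : C) (r s x y t M L e : R) (f g : C -> C).

(** Complex conjugation. *)
Definition cj z : C := pt (re z) (- im z).

Lemma cjD z w : cj (z + w) = cj z + cj w.
Proof. by case: z => a b; case: w => c d; rewrite /cj /= opprD. Qed.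
Lemma cjN z : cj (- z) = - cj z. Proof. by case: z. Qed.
Lemma cjM z w : cj (z * w) = cj z * cj w.
Proof. by case: z => a b; case: w => c d; rewrite /cj /pt; congr (_ +i* _)%C; rewrite /=; ring. Qed.
Lemma cjK z : cj (cj z) = z.
Proof. by case: z => a b; rewrite /cj /= opprK. Qed.
Lemma modulus_cj z : modulus (cj z) = modulus z.
Proof. by case: z => a b; rewrite /modulus /= sqrrN. Qed.
Lemma cj1 : cj 1 = 1. Proof. by rewrite /cj /= oppr0. Qed.
Lemma cj0 : cj 0 = 0. Proof. by rewrite /cj /= oppr0. Qed.
Lemma mul_cj z : cj z * z = ((modulus z ^+ 2)%:C)%C.
Proof.
rewrite sqr_modulus; case: z => a b; rewrite /cj /pt; congr (_ +i* _)%C => /=; ring.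
Qed.

Definition mobius a z := (z - a) / (1 - cj a * z).
(** The pseudo-hyperbolic distance, that is [tanh] of the hyperbolic distance of
    the disk by [tanh_hyp_dist_disk]. *)
Definition pdist z w : R := modulus (z - w) / modulus (1 - cj w * z).

Lemma modulus_mobius a z : modulus (mobius a z) = pdist z a.
Proof. by rewrite /mobius modulusM modulusV. Qed.

Lemma pdist_ge0 z w : 0 <= pdist z w.
Proof. by rewrite divr_ge0 ?modulus_ge0. Qed.

Lemma pdist_id a z : modulus (1 - cj a * z) ^+ 2 - modulus (z - a) ^+ 2 =
  (1 - modulus a ^+ 2) * (1 - modulus z ^+ 2).
Proof. rewrite !sqr_modulus; case: a => a b; case: z => x y /=; ring. Qed.

Lemma mobius_den a z : modulus a <= 1 -> modulus z < 1 -> 1 - cj a * z != 0.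
Proof.
move=> a1 z1; rewrite subr_eq0; apply: contraTneq z1 => E.
rewrite -leNgt.
have := congr1 (@modulus R) E; rewrite modulus1 modulusM modulus_cj => {}E.
have : modulus a * modulus z <= 1 * modulus z by rewrite ler_wpM2r ?modulus_ge0.
lra.
Qed.

Lemma sqr_lt1 z : disk z -> 0 < 1 - modulus z ^+ 2.
Proof. by move=> z1; rewrite subr_gt0 expr_lt1// modulus_ge0. Qed.

Lemma pdist_lt1 a z : disk a -> disk z -> pdist z a < 1.
Proof.
move=> a1 z1; have den := mobius_den (ltW a1) z1.
rewrite /pdist ltr_pdivrMr ?modulus_gt0// mul1r -ltr_sqr ?nnegrE ?modulus_ge0//.
by rewrite -subr_gt0 pdist_id mulr_gt0 ?sqr_lt1.
Qed.

Lemma mobius_disk a z : disk a -> disk z -> disk (mobius a z).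
Proof. by move=> a1 z1; rewrite /disk/= modulus_mobius; exact: pdist_lt1. Qed.

Lemma mobiusK a z : disk a -> disk z -> mobius (- a) (mobius a z) = z.
Proof.
move=> a1 z1; have den := mobius_den (ltW a1) z1.
have den2 : 1 - cj a * a != 0 by apply: mobius_den => //; exact: ltW.
rewrite /mobius cjN.
have -> : (z - a) / (1 - cj a * z) - - a = z * (1 - cj a * a) / (1 - cj a * z).
  by field.
have -> : 1 - - cj a * ((z - a) / (1 - cj a * z)) = (1 - cj a * a) / (1 - cj a * z).
  by field.
by field; rewrite ?den ?den2.
Qed.

Lemma diskN a : disk a -> disk (- a).
Proof. by rewrite /disk /= modulusN. Qed.

Lemma mobiusNK a z : disk a -> disk z -> mobius a (mobius (- a) z) = z.
Proof. by move=> a1 z1; rewrite -{1}(opprK a) mobiusK//; exact: diskN. Qed.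

Lemma mobius_id a : mobius a a = 0.
Proof. by rewrite /mobius subrr mul0r. Qed.

Lemma mobius0 a : mobius a 0 = - a.
Proof. by rewrite /mobius mulr0 subr0 divr1 sub0r. Qed.

Lemma cdiff_mobius a z : modulus a <= 1 -> disk z ->
  cdiff (mobius a) z ((1 - cj a * a) / (1 - cj a * z) ^+ 2).
Proof.
move=> a1 z1; have den := mobius_den a1 z1.
have N := cdiffB (cdiff_id z) (cdiff_cst z a).
have D := cdiffB (cdiff_cst z 1) (cdiffZ (cj a) (cdiff_id z)).
apply: cdiff_eq (cdiff_div (g := fun w => 1 - cj a * w) den N D) _.
by congr (_ / _); ring.
Qed.

Lemma disk0 : disk (0 : C). Proof. by rewrite /disk /mkset modulus0. Qed.

Lemma disk_ball0 z : disk z = (modulus (z - 0) < 1) :> Prop.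
Proof. by rewrite subr0. Qed.

Lemma hol_disk_ball f : holomorphic_on disk f -> hol_ball f 0 1.
Proof. by move=> /holomorphicP H z; rewrite -disk_ball0 => /H. Qed.

Section maps.
Variable (f : C -> C).
Hypothesis hf : holomorphic_on disk f.
Hypothesis df : forall z, disk z -> disk (f z).

Let F a z := mobius (f a) (f (mobius (- a) z)).

Let hF a : disk a -> hol_ball (F a) 0 1.
Proof.
move=> a1 z; rewrite -disk_ball0 => z1; have Na := diskN a1.
have m1 := mobius_disk Na z1.
eexists; apply: cdiff_comp (cdiff_comp (cdiff_mobius (ltW Na) z1) (holomorphic_cdiff hf m1)) _.
exact: cdiff_mobius (ltW (df a1)) (df m1).
Qed.

Let F0 a : disk a -> F a 0 = 0.
Proof. by move=> a1; rewrite /F mobius0 opprK mobius_id. Qed.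

Let F1 a z : disk a -> disk z -> modulus (F a z - F a 0) <= 1.
Proof.
move=> a1 z1; rewrite F0// subr0; apply: ltW; apply: mobius_disk; first exact: df.
by apply: df; apply: mobius_disk => //; exact: diskN.
Qed.

(** Schwarz's lemma for [f] conjugated by the Moebius maps that move [a] and [f a]
    to the origin. *)
Lemma schwarz_pick_dist a z : disk a -> disk z -> pdist (f z) (f a) <= pdist z a.
Proof.
move=> a1 z1; have m1 := mobius_disk a1 z1.
have H : modulus (F a (mobius a z) - F a 0) <= 1 / 1 * modulus (mobius a z - 0).
  apply: (schwarz ltr01 (hF a1)); last by rewrite -disk_ball0.
  by move=> w; rewrite -disk_ball0; exact: F1.
by move: H; rewrite F0// !subr0 divr1 mul1r /F mobiusK// !modulus_mobius.
Qed.

Lemma schwarz_pick_derive a : disk a ->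
  modulus (derive1 f a) * (1 - modulus a ^+ 2) <= 1 - modulus (f a) ^+ 2.
Proof.
move=> a1; have Na := diskN a1; have b1 := df a1.
have D : cdiff (F a) 0 ((1 - cj (f a) * f a) / (1 - cj (f a) * f a) ^+ 2 *
    (derive1 f a * ((1 - cj (- a) * - a) / (1 - cj (- a) * 0) ^+ 2))).
  have c1 := cdiff_mobius (ltW Na) disk0.
  have c2 : cdiff f (mobius (- a) 0) (derive1 f a).
    by rewrite mobius0 opprK; exact: (holomorphic_cdiff hf a1).
  have c3 : cdiff (mobius (f a)) (f (mobius (- a) 0))
      ((1 - cj (f a) * f a) / (1 - cj (f a) * f a) ^+ 2).
    by rewrite mobius0 opprK; exact: cdiff_mobius (ltW b1) b1.
  exact: cdiff_comp (cdiff_comp c1 c2) c3.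
have : modulus (dquot (F a) 0 0) * 1 <= 1.
  apply: (dquot_bound ltr01 (hF a1)); last by rewrite subrr modulus0.
  by move=> w; rewrite -disk_ball0; exact: F1.
rewrite mulr1 dquotpp (cdiff_derive1 D) mulr0 subr0 expr1n divr1 cjN mulrNN !mul_cj.
have nb := sqr_lt1 b1; have na := sqr_lt1 a1.
have E x : 1 - x%:C%C = (1 - x)%:C%C :> C by rewrite rmorphB rmorph1.
rewrite !E.
have -> x : x%:C%C / x%:C%C ^+ 2 = (x^-1)%:C%C :> C.
  have [->|x0] := eqVneq x 0; first by rewrite invr0 mul0r.
  by rewrite expr2 invfM mulrA divff ?mul1r ?fmorphV// fmorph_eq0.
rewrite !modulusM !modulus_real normfV !gtr0_norm// mulrC ler_pdivrMr//.
by rewrite mul1r.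
Qed.

End maps.

Lemma disk_density_gt0 z : disk z -> 0 < disk_density z.
Proof. by move=> /sqr_lt1 z1; rewrite invr_gt0. Qed.

Lemma schwarz_pick_density f a : holomorphic_on disk f ->
  (forall z, disk z -> disk (f z)) -> disk a ->
  disk_density (f a) * modulus (derive1 f a) <= disk_density a.
Proof.
move=> hf df a1; have := schwarz_pick_derive hf df a1.
have na := sqr_lt1 a1; have nb := sqr_lt1 (df _ a1).
by rewrite /disk_density ler_pdivrMl// ler_pdivlMr.
Qed.

Lemma pdistC z w : pdist z w = pdist w z.
Proof.
rewrite /pdist modulusB; congr (_ / _).
by rewrite -modulus_cj cjD cjN cjM cjK cj1 mulrC.
Qed.

Lemma lim_along_cj T (F : set_system T) (UF : UltraFilter F) (u : T -> C) l :
  lim_along F u l -> lim_along F (fun i => cj (u i)) (cj l).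
Proof.
move=> ul e /ul; apply: filterS => i H.
by rewrite /mkset -cjN -cjD modulus_cj.
Qed.

End schwarz_pick.

(** * Conformal maps of plane domains *)

Section plane_domains.
Context {R : realType}.
Local Notation C := (cplx R).
Implicit Types (z w c p : C) (r s t M e : R) (f g h : C -> C) (U V : set C).

Lemma modulus_seg p z t : 0 <= t <= 1 ->
  modulus (p + t%:C%C * (z - p) - p) <= modulus (z - p).
Proof.
move=> /andP[t0 t1]; rewrite addrC addKr modulusM modulus_real ger0_norm//.
by apply: ler_piMl => //; exact: modulus_ge0.
Qed.

Lemma continuous_seg p z : continuous (fun t : R => p + t%:C%C * (z - p)).
Proof.
move=> t A /nbhs_cballP[e e0 He]; apply/nbhs_ballP.
have m0 : 0 < modulus (z - p) + 1 by have := modulus_ge0 (z - p); lra.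
exists (e / (modulus (z - p) + 1)) => [|s]; first by rewrite /= divr_gt0.
rewrite /ball/= ltr_pdivlMr// => st; apply: He; rewrite /cball/=.
have -> : p + s%:C%C * (z - p) - (p + t%:C%C * (z - p)) = (s - t)%:C%C * (z - p).
  by rewrite rmorphB; ring.
rewrite modulusM modulus_real distrC; apply: le_lt_trans st.
by rewrite ler_wpM2l//; lra.
Qed.

(** A union of segments from the centre. *)
Lemma connected_cball p r : 0 < r -> connected (cball p r).
Proof.
move=> r0.
have -> : cball p r = \bigcup_(z in cball p r)
    [set p + t%:C%C * (z - p) | t in `[0, 1]%classic].
  apply/seteqP; split => [z zr|w [z zr [t]]].
    exists z => //; exists 1; first by rewrite /= in_itv/= ler01 lexx.
    by rewrite mul1r addrC subrK.
  rewrite /= in_itv/= => tI <-; rewrite /cball/=.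
  exact: le_lt_trans (modulus_seg _ _ tI) zr.
apply: bigcup_connected.
  exists p => z zr; exists 0; first by rewrite /= in_itv/= ler01 lexx.
  by rewrite mul0r addr0.
move=> z zr; apply: connected_continuous_connected; first exact: segment_connected.
exact/continuous_subspaceT/continuous_seg.
Qed.

Lemma disk_cball : disk = cball 0 1 :> set C.
Proof. by apply/funext => z; rewrite disk_ball0. Qed.

Lemma connected_disk : connected (disk : set C).
Proof. by rewrite disk_cball; exact: connected_cball. Qed.

Lemma open_disk : open (disk : set C).
Proof. by rewrite disk_cball; exact: open_cball. Qed.

Lemma open_component U z : open U -> open (connected_component U z).
Proof.
move=> /openP oU; apply/openP => w Uw.
have [r r0 rU] := oU _ (connected_component_sub Uw).
exists r => // v vr; apply: connected_component_trans Uw _.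
apply: (connected_component_max _ rU (connected_cball r0)) => //.
by rewrite /cball/= subrr modulus0.
Qed.

Lemma hol_on_ball U f p : open U -> holomorphic_on U f -> U p ->
  exists r, [/\ 0 < r, cball p r `<=` U & hol_ball f p r].
Proof.
move=> /openP oU /holomorphicP hf /oU[r r0 rU]; exists r; split => //.
by move=> z /rU /hf.
Qed.

Lemma holomorphic_comp U V f g : (forall z, U z -> V (f z)) ->
  holomorphic_on U f -> holomorphic_on V g ->
  holomorphic_on U (fun z => g (f z)).
Proof.
move=> UV /holomorphicP hf /holomorphicP hg; apply/holomorphicP => z Uz.
have [a fa] := hf _ Uz; have [b gb] := hg _ (UV _ Uz).
by exists (b * a); exact: cdiff_comp fa gb.
Qed.

Lemma derive1_comp_cdiff U V f g z : (forall z, U z -> V (f z)) ->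
  holomorphic_on U f -> holomorphic_on V g -> U z ->
  derive1 (fun z => g (f z)) z = derive1 g (f z) * derive1 f z.
Proof.
move=> UV hf hg Uz; apply: cdiff_derive1.
apply: cdiff_comp; first exact: holomorphic_cdiff hf Uz.
exact: holomorphic_cdiff hg (UV _ Uz).
Qed.

Lemma derive1_eq_on U f g z : open U -> U z -> (forall z, U z -> f z = g z) ->
  holomorphic_on U f -> derive1 f z = derive1 g z.
Proof.
move=> oU Uz fg hf; apply/esym/cdiff_derive1.
have [r [r0 rU _]] := hol_on_ball oU hf Uz.
apply: cdiff_near (holomorphic_cdiff hf Uz); exists r => // w /rU; exact: fg.
Qed.

Lemma set_bij_inv U V f : set_bij U V f -> [/\ forall z, U z -> V (f z),
  forall w, V w -> U (pinv U f w), forall z, U z -> pinv U f (f z) = z &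
  forall w, V w -> f (pinv U f w) = w].
Proof.
move=> bf; have [fUV injf surjf] := bf.
have [h1 _ _] : set_bij V U (pinv U f) := bijpinv_bij _ bf.
split => //.
- by move=> z Uz; apply: pinvKV; rewrite ?inE.
- by move=> w Vw; rewrite pinvK// inE; exact: surjf.
Qed.

Lemma holomorphic_inverse U V f g : open U -> holomorphic_on U f ->
  (forall w, V w -> U (g w)) -> (forall z, U z -> g (f z) = z) ->
  (forall w, V w -> f (g w) = w) -> holomorphic_on V g.
Proof.
move=> oU hf VU gf fg; apply/holomorphicP => w Vw.
have [r [r0 rU hr]] := hol_on_ball oU hf (VU _ Vw).
exists (derive1 f (g w))^-1; rewrite -{1}(fg _ Vw).
apply: (inverse_cdiff r0 hr) => [z v zr vr E|z zr]; last exact/gf/rU.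
by rewrite -(gf z (rU _ zr)) E gf//; exact: rU.
Qed.

Lemma conformal_pinv U V f : open U -> conformal_map U V f ->
  conformal_map V U (pinv U f).
Proof.
move=> oU [hf bf]; split; last exact: bijpinv_bij _ bf.
have [_ h2 h3 h4] := set_bij_inv bf.
exact: holomorphic_inverse oU hf h2 h3 h4.
Qed.

Lemma inverse_derive U V f g z : open U -> holomorphic_on U f ->
  holomorphic_on V g -> (forall z, U z -> V (f z)) ->
  (forall z, U z -> g (f z) = z) -> U z -> derive1 g (f z) * derive1 f z = 1.
Proof.
move=> oU hf hg UV gf Uz; rewrite -(derive1_comp_cdiff UV hf hg Uz).
have hgf := holomorphic_comp UV hf hg.
have -> := derive1_eq_on oU Uz gf hgf; exact: (cdiff_derive1 (cdiff_id z)).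
Qed.

(** Both [f] and [g] contract the hyperbolic metric. *)
Lemma disk_isometry f g z : holomorphic_on disk f -> holomorphic_on disk g ->
  (forall z, disk z -> disk (f z)) -> (forall z, disk z -> disk (g z)) ->
  (forall z, disk z -> g (f z) = z) -> disk z ->
  disk_density (f z) * modulus (derive1 f z) = disk_density z.
Proof.
move=> hf hg df dg gf z1; apply/eqP; rewrite eq_le schwarz_pick_density//=.
have := schwarz_pick_density hg dg (df _ z1); rewrite gf// => H.
have E := inverse_derive open_disk hf hg df gf z1.
rewrite -[leLHS]mulr1 -(@modulus1 R) -E modulusM mulrA.
by rewrite ler_wpM2r ?modulus_ge0.
Qed.

Lemma disk_isometry_dist f g z w : holomorphic_on disk f -> holomorphic_on disk g ->
  (forall z, disk z -> disk (f z)) -> (forall z, disk z -> disk (g z)) ->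
  (forall z, disk z -> g (f z) = z) -> disk z -> disk w ->
  pdist (f z) (f w) = pdist z w.
Proof.
move=> hf hg df dg gf z1 w1; apply/eqP; rewrite eq_le schwarz_pick_dist//=.
have := schwarz_pick_dist hg dg (df _ w1) (df _ z1); by rewrite !gf.
Qed.

Lemma holomorphic_mobius a : disk a -> holomorphic_on disk (@mobius R a).
Proof.
move=> a1; apply/holomorphicP => z z1; eexists.
exact: cdiff_mobius (ltW a1) z1.
Qed.

Lemma mobius_isometry a z : disk a -> disk z ->
  disk_density (mobius a z) * modulus (derive1 (mobius a) z) = disk_density z.
Proof.
move=> a1; have Na := diskN a1; apply: (disk_isometry (g := mobius (- a))).
- exact: holomorphic_mobius.
- exact: holomorphic_mobius.
- by move=> w; exact: mobius_disk.
- by move=> w; exact: mobius_disk.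
- by move=> w; exact: mobiusK.
Qed.

Lemma mobius_isometry_dist a z w : disk a -> disk z -> disk w ->
  pdist (mobius a z) (mobius a w) = pdist z w.
Proof.
move=> a1; have Na := diskN a1; apply: (disk_isometry_dist (g := mobius (- a))).
- exact: holomorphic_mobius.
- exact: holomorphic_mobius.
- by move=> v; exact: mobius_disk.
- by move=> v; exact: mobius_disk.
- by move=> v; exact: mobiusK.
Qed.

(** If [f] takes the value [f w0] on a set accumulating at [w0], it is constant;
    otherwise [f] avoids this value on a small circle and [open_at] applies. The
    Moebius map moves [w0] to the origin, where the disk is a single ball. *)
Lemma disk_image_open f : holomorphic_on disk f ->
  (forall z, disk z -> modulus (f z) <= 1) ->
  (exists z w, [/\ disk z, disk w & f z != f w]) -> open (f @` disk).
Proof.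
move=> hf fb [z1 [z2 [d1 d2 ne]]]; apply/openP => _ [w0 w0d <-].
have Nw := diskN w0d.
pose G z := f (mobius (- w0) z).
have hG : holomorphic_on disk G.
  apply: holomorphic_comp hf; last exact: holomorphic_mobius.
  by move=> z; exact: mobius_disk.
have G0 : G 0 = f w0 by rewrite /G mobius0 opprK.
have hG' : hol_ball (fun z => G z - G 0) 0 1.
  move=> z; rewrite -disk_ball0 => zd; eexists.
  exact: cdiffB (holomorphic_cdiff hG zd) (cdiff_cst z (G 0)).
have bG' : bnd_ball (fun z => G z - G 0) 0 1 2.
  move=> z; rewrite -disk_ball0 => zd.
  have := modulusD (G z) (- G 0); rewrite modulusN.
  have := fb _ (mobius_disk Nw zd); have := fb _ (mobius_disk Nw disk0).
  rewrite -/(G z) -/(G 0); lra.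
have [Gc|[s s0 Gs]] := isolated_zeros ltr01 hG' bG'.
  have fc z : disk z -> f z = f w0.
    move=> zd; have -> : f z = G (mobius w0 z) by rewrite /G mobiusK.
    apply/eqP; rewrite -G0 -subr_eq0; apply/eqP.
    by apply: Gc; rewrite -disk_ball0; exact: mobius_disk.
  by move: ne; rewrite (fc _ d1) (fc _ d2) eqxx.
pose r := Num.min s 1 / 2.
have m0 : 0 < Num.min s 1 by rewrite lt_min s0 ltr01.
have r0 : 0 < r by rewrite divr_gt0.
have : r < Num.min s 1 by rewrite /r; lra.
rewrite lt_min => /andP[rs r1].
have [z zr|z zr|d d0 Hd] := @open_at _ G 0 r r0.
- have zd : disk z by rewrite disk_ball0; exact: le_lt_trans r1.
  by exists (derive1 G z); exact: holomorphic_cdiff hG zd.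
- by rewrite -subr_eq0; apply/eqP; apply: Gs; rewrite zr r0.
exists d => // w; rewrite /cball/= -G0 => /Hd[z zr <-].
exists (mobius (- w0) z) => //; apply: mobius_disk => //.
by rewrite disk_ball0; exact: lt_trans r1.
Qed.

(** If [k z = z * q z] with [q 0 = 1], then [q] attains its maximal modulus inside. *)
Lemma schwarz_equality k : holomorphic_on disk k ->
  (forall z, disk z -> disk (k z)) -> k 0 = 0 -> derive1 k 0 = 1 ->
  forall z, disk z -> k z = z.
Proof.
move=> hk dk k0 k'0.
have hb := hol_disk_ball hk.
have hq := dquot_hol ltr01 hb.
have qb z : modulus (z - 0) < 1 -> modulus (dquot k 0 z) <= 1.
  move=> z1; rewrite -[leLHS]mulr1; apply: (dquot_bound ltr01 hb) => // w.
  by rewrite -disk_ball0 => /dk /ltW; rewrite k0 subr0.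
have q0 : dquot k 0 0 = 1 by rewrite dquotpp.
have circ r : 0 < r < 1 -> dquot k 0 (circle_pt 0 r pi) = 1.
  move=> r1; rewrite -q0; apply/esym; apply: (circle_max (rho := 1)) => //.
  - by move=> z /hq[a /cdiff_continuous].
  - by move=> z /andP[_ /hq].
  - by have p0 := pi_gt0 R; rewrite p0 mulr2n ltrDl.
  - by move=> z z1; rewrite q0 modulus1; exact: qb.
have hq1 : hol_ball (fun z => dquot k 0 z - 1) 0 1.
  move=> z /hq[a qa]; exists (a - 0); exact: cdiffB qa (cdiff_cst z 1).
have bq1 : bnd_ball (fun z => dquot k 0 z - 1) 0 1 2.
  move=> z /qb q1; have := modulusD (dquot k 0 z) (- 1).
  by rewrite modulusN modulus1; lra.
have [H|[s s0 Hs]] := isolated_zeros ltr01 hq1 bq1.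
  move=> z; rewrite disk_ball0 => /H /eqP; rewrite subr_eq0 => /eqP E.
  by have := dquotM k 0 z; rewrite E mul1r !subr0 k0 subr0.
exfalso; pose r := Num.min s 1 / 2.
have m0 : 0 < Num.min s 1 by rewrite lt_min s0 ltr01.
have r0 : 0 < r by rewrite divr_gt0.
have : r < Num.min s 1 by rewrite /r; lra.
rewrite lt_min => /andP[rs r1].
apply: (Hs (circle_pt 0 r pi)); first by rewrite circle_pt_dist// r0.
by rewrite circ ?r0// subrr.
Qed.

End plane_domains.

(** * The Riemann map of a petal as a limit along backward orbits *)

Section backward_limit.
Context {R : realType}.
Local Notation C := (cplx R).
Implicit Types (z w v : C) (t s : R).

Variables (phi psi : R -> C -> C) (D : set C) (z0 : C).
Hypothesis phi_hol : forall t, 0 <= t -> holomorphic_on disk (phi t).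
Hypothesis phi_disk : forall t z, 0 <= t -> disk z -> disk (phi t z).
Hypothesis psi_hol : forall t, 0 <= t -> holomorphic_on D (psi t).
Hypothesis psi_D : forall t z, 0 <= t -> D z -> D (psi t z).
Hypothesis phi_psi : forall s t z, 0 <= s -> 0 <= t -> D z ->
  phi s (psi (t + s) z) = psi t z.
Hypothesis phi_add : forall s t z, 0 <= s -> 0 <= t -> disk z ->
  phi (t + s) z = phi s (phi t z).
Hypothesis psi0 : forall z, D z -> psi 0 z = z.
Hypothesis D_disk : D `<=` disk.
Hypothesis D_open : open D.
Hypothesis D_connected : connected D.
Hypothesis Dz0 : D z0.
Hypothesis D_max : forall B : set C, open B -> connected B -> B z0 ->
  (forall t w, 0 <= t -> B w -> exists2 z, disk z & phi t z = w) -> B `<=` D.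

Context {F : set_system R} {UF : UltraFilter F}.
Hypothesis F_oo : (+oo : set_system R) `<=` F.

Let F_ge s : F [set t | s <= t].
Proof. by apply: F_oo; apply: nbhs_pinfty_ge; exact: num_real. Qed.

Let a t := psi t z0.
(** Normalization at the base point: [gt t z0 = 0] and [ft t 0 = z0]. Both families
    take their values in the disk, so that they have limits, and [ft t] undoes
    [gt t]. *)
Let gt t z := mobius (a t) (psi t z).
Let ft t w := phi t (mobius (- a t) w).

Let a_disk t : 0 <= t -> disk (a t).
Proof. by move=> t0; apply/D_disk/psi_D. Qed.

Let psi_disk t z : 0 <= t -> D z -> disk (psi t z).
Proof. by move=> t0 Dz; apply/D_disk/psi_D. Qed.

Let phi_psiK t z : 0 <= t -> D z -> phi t (psi t z) = z.
Proof. by move=> t0 Dz; have := phi_psi t0 (lexx 0) Dz; rewrite add0r psi0. Qed.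

Let gt_disk t z : 0 <= t -> D z -> disk (gt t z).
Proof. by move=> t0 Dz; apply: mobius_disk; [exact: a_disk|exact: psi_disk]. Qed.

Let gt_hol t : 0 <= t -> holomorphic_on D (gt t).
Proof.
move=> t0; apply: (holomorphic_comp (V := disk)) (psi_hol t0) _.
  by move=> z; exact: psi_disk.
exact/holomorphic_mobius/a_disk.
Qed.

Let ft_disk t w : 0 <= t -> disk w -> disk (ft t w).
Proof.
by move=> t0 w1; apply: phi_disk => //; apply: mobius_disk => //; exact/diskN/a_disk.
Qed.

Let ft_hol t : 0 <= t -> holomorphic_on disk (ft t).
Proof.
move=> t0; apply: (holomorphic_comp (V := disk)) (phi_hol t0).
  by move=> z; apply: mobius_disk; exact/diskN/a_disk.
exact/holomorphic_mobius/diskN/a_disk.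
Qed.

Let ft_gt t z : 0 <= t -> D z -> ft t (gt t z) = z.
Proof.
move=> t0 Dz; rewrite /ft /gt mobiusK ?phi_psiK//; last exact: psi_disk.
exact: a_disk.
Qed.

Let lim_fun (h : R -> C -> C) z : C := xget 0 [set l | lim_along F (h^~ z) l].

Let lim_funP (h : R -> C -> C) z : (forall t, 0 <= t -> disk (h t z)) ->
  lim_along F (h^~ z) (lim_fun h z).
Proof.
move=> hd; rewrite /lim_fun; case: xgetP => [l _ //|].
have [|l hl] := @lim_along_ex _ _ F UF (h^~ z) 1; last by move=> /(_ l).
by apply: filterS (F_ge 0) => t /= /hd /ltW.
Qed.

Let lim_le2 (u v : R -> C) l m (k : R) : lim_along F u l -> lim_along F v m ->
  0 <= k -> F [set t | modulus (u t) <= k * modulus (v t)] ->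
  modulus l <= k * modulus m.
Proof.
move=> ul vm k0 uv; apply/ler_addgt0Pr => e e0.
have e1 : 0 < e / (1 + k) by rewrite divr_gt0//; lra.
have [t [/= [h1 h2] h3]] := filter_ex (filterI (filterI (ul _ e1) (vm _ e1)) uv).
have := modulusD (l - u t) (u t); rewrite subrK [modulus (l - u t)]modulusB.
have := modulusD (v t - m) m; rewrite subrK => h4 h5.
have := ler_wpM2l k0 h4.
have : k * modulus (v t - m) <= k * (e / (1 + k)) by rewrite ler_wpM2l// ltW.
have : e / (1 + k) + k * (e / (1 + k)) = e by field; rewrite gt_eqF//; lra.
lra.
Qed.

(** All [h t w] are within pseudo-hyperbolic distance [modulus w < 1] of the fixed
    point [b], which keeps their limit away from the unit circle. *)
Let lim_disk (h : R -> C -> C) (l : C -> C) s b : disk b ->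
  (forall t, s <= t -> holomorphic_on disk (h t)) ->
  (forall t z, s <= t -> disk z -> disk (h t z)) ->
  (forall t, s <= t -> h t 0 = b) ->
  forall w, disk w -> lim_along F (h^~ w) (l w) -> disk (l w).
Proof.
move=> b1 hh hd h0 w w1 hl.
have l1 : modulus (l w) <= 1.
  apply: (lim_along_le hl); apply: filterS (F_ge s) => t /= st.
  by apply/ltW; exact: hd.
rewrite /disk/= lt_neqAle l1 andbT; apply/negP => /eqP E.
have L1 : lim_along F (fun t => h t w - b) (l w - b).
  exact: lim_alongB hl (lim_along_cst b).
have L2 : lim_along F (fun t => 1 - cj b * h t w) (1 - cj b * l w).
  exact: lim_alongB (lim_along_cst 1) (lim_alongZ (cj b) hl).
have den : 1 - cj b * l w != 0.
  have := mobius_den l1 b1; rewrite -!modulus_gt0 -(modulus_cj (1 - cj b * _)).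
  by rewrite cjD cjN cjM cjK cj1 mulrC.
have := lim_le2 L1 L2 (modulus_ge0 w).
have -> : modulus (l w - b) = modulus (1 - cj b * l w).
  apply/eqP; rewrite -(@eqrXn2 _ 2)// ?modulus_ge0// eq_sym -subr_eq0 pdist_id E.
  by rewrite expr1n subrr mulr0.
move=> H; have : modulus (1 - cj b * l w) <= modulus w * modulus (1 - cj b * l w).
  apply: H; apply: filterS (F_ge s) => t /= st.
  have := schwarz_pick_dist (hh _ st) (fun z => @hd t z st) disk0 w1.
  rewrite h0// /pdist cj0 mul0r !subr0 modulus1 divr1 ler_pdivrMr//.
  by rewrite modulus_gt0 mobius_den// ?ltW//; exact: hd.
by rewrite -[X in X <= _]mul1r ler_pM2r ?modulus_gt0// leNgt; move/negP; apply.
Qed.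

Let g := lim_fun gt.
Let f := lim_fun ft.

Let g_lim z : D z -> lim_along F (gt^~ z) (g z).
Proof. by move=> Dz; apply: lim_funP => t t0; exact: gt_disk. Qed.

Let f_lim w : disk w -> lim_along F (ft^~ w) (f w).
Proof. by move=> w1; apply: lim_funP => t t0; exact: ft_disk. Qed.

Let g_cdiff z : D z ->
  lim_along F (fun t => derive1 (gt t) z) (derive1 g z) /\ cdiff g z (derive1 g z).
Proof.
move=> Dz; have /openP/(_ _ Dz)[r r0 rD] := D_open.
apply: (@lim_along_derive _ _ F UF gt g z r 1) => //.
- apply: filterS (F_ge 0) => t /= t0 w /rD Dw.
  by exists (derive1 (gt t) w); exact: holomorphic_cdiff (gt_hol t0) Dw.
- by apply: filterS (F_ge 0) => t /= t0 w /rD Dw; exact/ltW/gt_disk.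
- by move=> w /rD; exact: g_lim.
Qed.

Let f_cdiff w : disk w -> cdiff f w (derive1 f w).
Proof.
move=> w1; have /openP/(_ _ w1)[r r0 rD] := @open_disk R.
apply: (@lim_along_derive _ _ F UF ft f w r 1 r0 _ _ _).2.
- apply: filterS (F_ge 0) => t /= t0 v /rD v1.
  by exists (derive1 (ft t) v); exact: holomorphic_cdiff (ft_hol t0) v1.
- by apply: filterS (F_ge 0) => t /= t0 v /rD v1; exact/ltW/ft_disk.
- by move=> v /rD; exact: f_lim.
Qed.

Let g_hol : holomorphic_on D g.
Proof. by apply/holomorphicP => z /g_cdiff[_ ?]; eexists; eassumption. Qed.

Let f_hol : holomorphic_on disk f.
Proof. by apply/holomorphicP => z /f_cdiff ?; eexists; eassumption. Qed.

Let g_z0 : g z0 = 0.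
Proof.
apply: (lim_along_unique (g_lim Dz0)).
by under eq_fun do rewrite /gt mobius_id; exact: lim_along_cst.
Qed.

Let f0 : f 0 = z0.
Proof.
apply: (lim_along_unique (f_lim disk0)) => e e0.
apply: filterS (F_ge 0) => t /= t0.
by rewrite /ft mobius0 opprK phi_psiK// subrr modulus0.
Qed.

(** The points of [f @` disk] are images under every [phi s]: split [phi t] as
    [phi s] after [phi (t - s)] and take the limit of the latter. *)
Let f_image s w : 0 <= s -> disk w -> exists2 z, disk z & phi s z = f w.
Proof.
move=> s0 w1; pose h t v := phi (t - s) (mobius (- a t) v).
have hh t : s <= t -> holomorphic_on disk (h t).
  move=> st; have t0 : 0 <= t by lra.
  apply: (holomorphic_comp (V := disk)).
  - by move=> z; apply: mobius_disk; exact/diskN/a_disk.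
  - exact/holomorphic_mobius/diskN/a_disk.
  - by apply: phi_hol; lra.
have hd t z : s <= t -> disk z -> disk (h t z).
  move=> st z1; have t0 : 0 <= t by lra.
  apply: phi_disk; first lra.
  by apply: mobius_disk => //; exact/diskN/a_disk.
have h0 t : s <= t -> h t 0 = psi s z0.
  move=> st; rewrite /h mobius0 opprK /a.
  have -> : psi t z0 = psi (s + (t - s)) z0 by congr psi; ring.
  by apply: phi_psi => //; lra.
have [l hl] : exists l, lim_along F (h^~ w) l.
  apply: (@lim_along_ex _ _ F UF _ 1).
  by apply: filterS (F_ge s) => t /= st; apply/ltW; exact: hd.
have l1 : disk l.
  by apply: (@lim_disk h (fun=> l) s (psi s z0)) w1 hl => //; exact: psi_disk.
exists l => //; apply: (lim_along_unique _ (f_lim w1)).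
have cl : {for l, continuous (phi s)}.
  exact: cdiff_continuous (holomorphic_cdiff (phi_hol s0) l1).
move=> e e0.
have H : F [set t | modulus (phi s (h t w) - phi s l) < e].
  exact: lim_along_comp hl cl e e0.
apply: filterS (filterI H (F_ge s)) => t /= [+ st].
rewrite /ft; suff -> : phi t (mobius (- a t) w) = phi s (h t w) by [].
rewrite /h -phi_add//; last first.
  by apply: mobius_disk => //; apply/diskN/a_disk; lra.
- lra.
- by rewrite subrK.
Qed.

Let f_disk w : disk w -> disk (f w).
Proof.
move=> w1; have [z z1 <-] := f_image (lexx 0) w1; exact: phi_disk.
Qed.

(** By the Schwarz-Pick lemma on a disk contained in [D], the values at [z] and [p]
    are at pseudo-hyperbolic distance bounded by some [k < 1] for every [t]. In
    the limit, when [g p] is on the unit circle, this forces [g z = g p]. *)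
Let g_unimodular p : D p -> modulus (g p) = 1 ->
  exists2 r : R, 0 < r & forall z, modulus (z - p) < r -> g z = g p.
Proof.
move=> Dp gp; have /openP/(_ _ Dp)[r r0 rD] := D_open.
exists r => // z zr; have Dz : D z by exact: rD.
have k1 : modulus (z - p) / r < 1 by rewrite ltr_pdivrMr// mul1r.
have k0 : 0 <= modulus (z - p) / r by rewrite divr_ge0 ?modulus_ge0// ltW.
have L1 : lim_along F (fun t => gt t z - gt t p) (g z - g p).
  exact: lim_alongB (g_lim Dz) (g_lim Dp).
suff H : modulus (g z - g p) <= modulus (z - p) / r * modulus (g z - g p).
  apply/eqP; rewrite -subr_eq0 -modulus_eq0 eq_le modulus_ge0 andbT.
  by have := modulus_ge0 (g z - g p); nra.
have E : modulus (g z - g p) = modulus (1 - cj (g p) * g z).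
  have -> : 1 - cj (g p) * g z = - (cj (g p) * (g z - g p)).
    rewrite mulrBr mul_cj gp expr1n; ring.
  by rewrite modulusN modulusM modulus_cj gp mul1r.
rewrite {2}E.
have L2 : lim_along F (fun t => 1 - cj (gt t p) * gt t z) (1 - cj (g p) * g z).
  apply: lim_alongB; first exact: lim_along_cst.
  by apply: lim_alongM (g_lim Dz); apply: lim_along_cj; exact: g_lim.
apply: (lim_le2 L1 L2 k0).
apply: filterS (F_ge 0) => t /= t0.
pose e w := p + r%:C%C * w.
have eD w : disk w -> D (e w).
  move=> w1; apply: rD; rewrite /cball/= /e addrC addKr modulusM modulus_real.
  by rewrite gtr0_norm// gtr_pMr.
have he : holomorphic_on disk e.
  apply/holomorphicP => w _; exists (0 + r%:C%C * 1).
  exact: cdiffD (cdiff_cst w p) (cdiffZ _ (cdiff_id w)).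
have rC : (r%:C%C : C) != 0 by rewrite -modulus_gt0 modulus_real normr_gt0 gt_eqF.
have zw1 : disk ((z - p) / r%:C%C).
  by rewrite /disk/= modulusM modulusV modulus_real gtr0_norm.
have := schwarz_pick_dist (holomorphic_comp eD he (gt_hol t0))
  (fun w Hw => gt_disk t0 (eD w Hw)) disk0 zw1.
rewrite /e mulr0 addr0 [_ * (_ / _)]mulrC divfK// [p + _]addrC subrK.
rewrite {2}/pdist cj0 mul0r !subr0 modulus1 divr1 modulusM modulusV modulus_real.
rewrite gtr0_norm// {1}/pdist ler_pdivrMr//.
by rewrite modulus_gt0 mobius_den// ?ltW//; exact: gt_disk.
Qed.

(** The points with [modulus (g z) < 1] and those with [modulus (g z) = 1] both form
    open sets, and [z0] belongs to the first one. *)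
Let g_disk z : D z -> disk (g z).
Proof.
have gle w : D w -> modulus (g w) <= 1.
  move=> Dw; apply: (lim_along_le (g_lim Dw)).
  by apply: filterS (F_ge 0) => t /= t0; apply/ltW/gt_disk.
pose A := [set z | D z /\ modulus (g z) < 1].
suff -> : D = A by case.
apply/esym/D_connected.
- by exists z0; split; rewrite // g_z0 modulus0.
- exists A; last by apply/seteqP; split => [w [? ?]|w []].
  apply/openP => w [Dw w1].
  have /openP/(_ _ Dw)[r r0 rD] := D_open.
  have [_ /cdiff_continuous/continuous_epsP] := g_cdiff Dw.
  have e0 : 0 < 1 - modulus (g w) by rewrite subr_gt0.
  move=> /(_ _ e0)[d d0 Hd]; exists (Num.min r d); first by rewrite lt_min r0.
  move=> v; rewrite /cball/= lt_min => /andP[vr vd]; split; first exact: rD.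
  have := modulusD (g v - g w) (g w); rewrite subrK; have := Hd _ vd; lra.
- exists (~` [set z | D z /\ modulus (g z) = 1]).
    rewrite closedC; apply/openP => w [Dw w1].
    have /openP/(_ _ Dw)[r r0 rD] := D_open.
    have [d d0 Hd] := g_unimodular Dw w1.
    exists (Num.min r d); first by rewrite lt_min r0.
    move=> v; rewrite /cball/= lt_min => /andP[vr vd]; split; first exact: rD.
    by rewrite Hd.
  apply/seteqP; split => [w [Dw w1]|w [Dw nw]].
    by split => // -[_ E]; rewrite E ltxx in w1.
  split => //; rewrite lt_neqAle gle// andbT; apply/negP => /eqP E.
  exact: nw.
Qed.

(** The functions [ft t] are Lipschitz near [g z] with a common constant, so
    [ft t (gt t z) = z] passes to the limit although both factors vary. *)
Let f_g z : D z -> f (g z) = z.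
Proof.
move=> Dz; have gz := g_disk Dz; pose r := 1 - modulus (g z).
have r0 : 0 < r by rewrite subr_gt0.
have rd w : modulus (w - g z) < r -> disk w.
  rewrite /r /disk/=; have := modulusD (w - g z) (g z); rewrite subrK; lra.
apply: (lim_along_unique (f_lim gz)) => e e0.
pose k := Num.min r (e * r / 2).
have k0 : 0 < k by rewrite lt_min r0 divr_gt0// mulr_gt0.
apply: filterS (filterI (F_ge 0) (g_lim Dz k0)) => t /= [t0].
rewrite lt_min => /andP[gr ge].
rewrite -[X in _ - X](ft_gt t0 Dz) modulusB.
have hb : hol_ball (ft t) (g z) r.
  move=> w /rd w1; exists (derive1 (ft t) w).
  exact: holomorphic_cdiff (ft_hol t0) w1.
have bb : bnd_ball (ft t) (g z) r 1 by move=> w /rd w1; exact/ltW/ft_disk.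
apply: le_lt_trans (lipschitz_ball r0 hb bb gr) _.
by rewrite mulr1 mulrAC ltr_pdivrMr//; lra.
Qed.

(** The image of [f] is open, connected, contains [z0] and lies in every
    [phi s @` disk]; [D] is maximal with these properties. *)
Let f_D w : disk w -> D (f w).
Proof.
suff H : f @` disk `<=` D by move=> w1; apply: H; exists w.
clear w.
apply: D_max.
- apply: disk_image_open f_hol _ _; first by move=> z /f_disk /ltW.
  have /openP/(_ _ Dz0)[r r0 rD] := D_open.
  pose z1 : C := z0 + (r / 2)%:C%C.
  have z1r : modulus (z1 - z0) = r / 2.
    by rewrite /z1 addrC addKr modulus_real gtr0_norm// divr_gt0.
  have Dz1 : D z1 by apply: rD; rewrite /cball/= z1r; lra.
  exists (g z1), (g z0); rewrite !f_g//; split; [exact: g_disk|exact: g_disk|].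
  by rewrite -subr_eq0 -modulus_gt0 z1r divr_gt0.
- apply: connected_continuous_connected; first exact: connected_disk.
  apply: continuous_in_subspaceT => z; rewrite inE => z1.
  exact: cdiff_continuous (f_cdiff z1).
- by exists 0; [exact: disk0|exact: f0].
- by move=> t _ t0 [z z1 <-]; exact: f_image.
Qed.

(** The self-map [g \o f] of the disk fixes the origin, with derivative [1] since
    [f \o g] is the identity: this is the case of equality in Schwarz's lemma. *)
Let g_f w : disk w -> g (f w) = w.
Proof.
apply: (schwarz_equality (k := fun w => g (f w))).
- exact: holomorphic_comp f_D f_hol g_hol.
- by move=> z /f_D /g_disk.
- by rewrite f0 g_z0.
rewrite (derive1_comp_cdiff f_D f_hol g_hol disk0) f0 mulrC -g_z0.
exact: inverse_derive D_open g_hol f_hol g_disk f_g Dz0.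
Qed.

Let gt_density t z : 0 <= t -> D z -> disk_density (gt t z) * modulus (derive1 (gt t) z) =
  disk_density (psi t z) * modulus (derive1 (psi t) z).
Proof.
move=> t0 Dz.
have -> : derive1 (gt t) z = derive1 (mobius (a t)) (psi t z) * derive1 (psi t) z.
  apply: (derive1_comp_cdiff (V := disk)) (psi_hol t0) _ Dz.
    by move=> w; exact: psi_disk.
  exact/holomorphic_mobius/a_disk.
rewrite modulusM mulrA mobius_isometry//; [exact: a_disk|exact: psi_disk].
Qed.

Let gt_pdist t z w : 0 <= t -> D z -> D w ->
  pdist (gt t z) (gt t w) = pdist (psi t z) (psi t w).
Proof.
move=> t0 Dz Dw; apply: mobius_isometry_dist; [exact: a_disk|exact: psi_disk..].
Qed.

Let lim_real (u : R -> C) (l : C) (v : R -> R) (m : R) : lim_along F u l ->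
  (forall t, 0 <= t -> modulus (u t) = v t) -> modulus l = m ->
  forall T e : R, 0 < e -> exists2 t, T <= t & `|v t - m| < e.
Proof.
move=> ul uv <- T e e0.
have [t [/= [t0 tT] H]] := filter_ex (filterI (filterI (F_ge 0) (F_ge T))
  (lim_along_modulus ul e0)).
by exists t => //; rewrite -uv.
Qed.

Let lim_den z w : D z -> D w ->
  lim_along F (fun t => 1 - cj (gt t w) * gt t z) (1 - cj (g w) * g z).
Proof.
move=> Dz Dw; apply: lim_alongB; first exact: lim_along_cst.
by apply: lim_alongM (g_lim Dz); apply: lim_along_cj; exact: g_lim.
Qed.

Let den_real z : disk z -> modulus (1 - cj z * z) = 1 - modulus z ^+ 2.
Proof.
move=> /sqr_lt1 z1; rewrite mul_cj -(rmorph1 (real_complex R)) -rmorphB.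
by rewrite modulus_real gtr0_norm.
Qed.

(** Moebius maps are isometries, so the normalization of [gt] changes neither the
    pulled back density nor the pseudo-hyperbolic distances, and both converge
    along the ultrafilter to the same quantities for [g]. The statement records
    that the limits are approached for arbitrarily large [t]; monotonicity in [t]
    turns this into convergence in [petal_uniformization]. *)
Lemma backward_uniformization : exists f g : C -> C,
  [/\ holomorphic_on disk f /\ holomorphic_on D g,
      (forall w, disk w -> D (f w)) /\ (forall z, D z -> disk (g z)),
      (forall z, D z -> f (g z) = z) /\ (forall w, disk w -> g (f w) = w),
      (forall z, D z -> forall T e : R, 0 < e -> exists2 t, T <= t &
        `|disk_density (psi t z) * modulus (derive1 (psi t) z) -
          disk_density (g z) * modulus (derive1 g z)| < e) &
      (forall z w, D z -> D w -> forall T e : R, 0 < e -> exists2 t, T <= t &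
        `|pdist (psi t z) (psi t w) - pdist (g z) (g w)| < e)].
Proof.
exists f, g; split; [by split|by split|by split| |].
- move=> z Dz; have gz := g_disk Dz; have [dl _] := g_cdiff Dz.
  have den := mobius_den (ltW gz) gz.
  apply: (lim_real (lim_alongM (lim_alongV den (lim_den Dz Dz)) dl)) => [t t0|].
    rewrite modulusM modulusV den_real ?gt_density//; exact: gt_disk.
  by rewrite modulusM modulusV den_real.
- move=> z w Dz Dw; have gz := g_disk Dz; have gw := g_disk Dw.
  have den := mobius_den (ltW gw) gz.
  apply: (lim_real (lim_alongM (lim_alongB (g_lim Dz) (g_lim Dw))
    (lim_alongV den (lim_den Dz Dw)))) => [t t0|].
    by rewrite modulusM modulusV -gt_pdist.
  by rewrite modulusM modulusV.
Qed.

End backward_limit.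

(** * Hyperbolic density and petals *)

Section hyperbolic_density.
Context {R : realType}.
Local Notation C := (cplx R).
Implicit Types (z w : C) (U : set C) (f g h : C -> C).

(** Two conformal maps of [U] onto the disk differ by an automorphism of the disk,
    which is an isometry. *)
Lemma hyp_densityE U g z : open U -> conformal_map U disk g -> U z ->
  hyp_density U z = disk_density (g z) * modulus (derive1 g z).
Proof.
move=> oU cg Uz; have [hg bg] := cg; have [hf bf] := conformal_pinv oU cg.
have [gU fU fg gf] := set_bij_inv bg; set f := pinv U g in hf bf fU fg gf.
rewrite /hyp_density; case: xgetP => [l _ [h ch ->]|/(_ (disk_density (g z) *
    modulus (derive1 g z)))]; last by move=> H; exfalso; apply: H; exists g.
have [hh bh] := ch; have [hk _] := conformal_pinv oU ch.
have [hU kU kh hk'] := set_bij_inv bh; set k := pinv U h in hk kU kh hk'.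
have hhf : holomorphic_on disk (fun w => h (f w)) by exact: holomorphic_comp hf hh.
have hgk : holomorphic_on disk (fun w => g (k w)) by exact: holomorphic_comp hk hg.
have gkhf w : disk w -> g (k (h (f w))) = w.
  by move=> w1; rewrite kh ?gf//; exact: fU.
have I := disk_isometry hhf hgk (fun w Hw => hU _ (fU _ Hw))
  (fun w Hw => gU _ (kU _ Hw)) gkhf (gU _ Uz).
have -> : derive1 h z = derive1 (fun w => h (f w)) (g z) * derive1 g z.
  rewrite -(derive1_comp_cdiff gU hg hhf Uz).
  apply: (derive1_eq_on oU Uz) => [w Uw|//]; by rewrite fg.
by rewrite -I fg// modulusM mulrA.
Qed.

Lemma conformal_id : conformal_map disk disk (@id C).
Proof.
split; first by apply/holomorphicP => z _; exists 1; exact: cdiff_id.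
split => // w w1; by exists w.
Qed.

Lemma hyp_density_disk z : disk z -> hyp_density disk z = disk_density z.
Proof.
move=> z1; rewrite (hyp_densityE open_disk conformal_id z1).
by rewrite (cdiff_derive1 (cdiff_id z)) modulus1 mulr1.
Qed.

End hyperbolic_density.

Section petals.
Context {R : realType}.
Local Notation C := (cplx R).
Implicit Types (z w : C) (t s : R).
Variables (phi : R -> C -> C) (tau : C) (D : set C).
Hypothesis sg : semigroup phi.
Hypothesis petD : petal phi tau D.

Let psi t := pinv D (phi t).
Let W := backward_invariant_set phi.

Let W_disk : W `<=` disk.
Proof.
move=> z /(_ 0 (lexx 0)) [w w1 <-]; by rewrite (semigroup_id sg).
Qed.

Lemma petal_open : open D.
Proof.
have [z _ ->] := petal_component petD; exact/open_component/open_interior.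
Qed.

Lemma petal_connected : connected D.
Proof. have [z _ ->] := petal_component petD; exact: component_connected. Qed.

Lemma petal_nonempty : exists z, D z.
Proof.
have [z Wz ->] := petal_component petD; exists z; exact: connected_component_refl.
Qed.

Lemma petal_disk : D `<=` disk.
Proof.
have [z _ ->] := petal_component petD => w /connected_component_sub /interior_subset.
exact: W_disk.
Qed.

Let petal_max z0 : D z0 -> forall B : set C, open B -> connected B -> B z0 ->
  (forall t w, 0 <= t -> B w -> exists2 z, disk z & phi t z = w) -> B `<=` D.
Proof.
have [z _ ->] := petal_component petD => Dz0 B oB cB Bz0 BW.
have BWo : B `<=` W°.
  by rewrite -open_subsetE// => w Bw t /= t0; have [v ? <-] := BW t w t0 Bw; exists v.
move=> w Bw; apply: connected_component_trans Dz0 _.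
exact: (connected_component_max Bz0 BWo cB).
Qed.

Let bij t : 0 <= t -> set_bij D D (phi t).
Proof. by move=> t0; have [] := petal_automorphism petD t0. Qed.

Lemma petal_backward_conformal t : 0 <= t -> conformal_map D D (psi t).
Proof.
move=> t0; exact: conformal_pinv petal_open (petal_automorphism petD t0).
Qed.

Let psi_D t z : 0 <= t -> D z -> D (psi t z).
Proof. by move=> t0 Dz; have [_ H _ _] := set_bij_inv (bij t0); exact: H. Qed.

Let phi_psi s t z : 0 <= s -> 0 <= t -> D z -> phi s (psi (t + s) z) = psi t z.
Proof.
move=> s0 t0 Dz; have ts0 : 0 <= t + s by rewrite addr_ge0.
have [_ _ _ h1] := set_bij_inv (bij ts0).
have [phiD h2 h3 h4] := set_bij_inv (bij t0).
have [phisD _ _ _] := set_bij_inv (bij s0).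
have E : phi t (phi s (psi (t + s) z)) = z.
  by rewrite -(semigroup_add sg)//; [exact: h1|exact/petal_disk/psi_D].
by rewrite -[LHS]h3 ?E//; apply/phisD/psi_D.
Qed.

Let psi0 z : D z -> psi 0 z = z.
Proof.
move=> Dz; have [_ h2 h3 h4] := set_bij_inv (bij (lexx 0)).
by rewrite -[LHS](semigroup_id sg) ?h4//; apply/petal_disk/psi_D.
Qed.

Let density t z := disk_density (psi t z) * modulus (derive1 (psi t) z).

Let psi_hol t : 0 <= t -> holomorphic_on D (psi t).
Proof. by move=> /petal_backward_conformal[]. Qed.

(** [psi s] is [psi t] followed by the contraction [phi (t - s)]. *)
Lemma backward_density_homo s t z : 0 <= s -> s <= t -> D z ->
  density s z <= density t z.
Proof.
move=> s0 st Dz; have t0 := le_trans s0 st.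
have ts0 : 0 <= t - s by rewrite subr_ge0.
have E w : D w -> psi s w = phi (t - s) (psi t w).
  by move=> Dw; have := phi_psi ts0 s0 Dw; rewrite [s + _]addrC subrK.
have DD v : D v -> disk (psi t v) by move=> Dv; apply/petal_disk/psi_D.
have hp := semigroup_holomorphic sg ts0.
have E1 : derive1 (psi s) z = derive1 (phi (t - s)) (psi t z) * derive1 (psi t) z.
  rewrite -(derive1_comp_cdiff DD (psi_hol t0) hp Dz).
  exact: derive1_eq_on petal_open Dz E (psi_hol s0).
rewrite /density E1 (E z Dz) modulusM mulrA.
rewrite ler_wpM2r ?modulus_ge0//; apply: schwarz_pick_density => //.
  by move=> v; exact: semigroup_disk sg _ _ ts0.
exact: DD.
Qed.

Lemma backward_pdist_homo s t z w : 0 <= s -> s <= t -> D z -> D w ->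
  pdist (psi s z) (psi s w) <= pdist (psi t z) (psi t w).
Proof.
move=> s0 st Dz Dw; have t0 := le_trans s0 st.
have ts0 : 0 <= t - s by rewrite subr_ge0.
have E v : D v -> psi s v = phi (t - s) (psi t v).
  by move=> Dv; have := phi_psi ts0 s0 Dv; rewrite [s + _]addrC subrK.
rewrite !E//; apply: schwarz_pick_dist.
- exact: semigroup_holomorphic sg _ ts0.
- by move=> v; exact: semigroup_disk sg _ _ ts0.
- exact/petal_disk/psi_D.
- exact/petal_disk/psi_D.
Qed.

Let monotone_limit (u : R -> R) (l : R) :
  (forall s t, 0 <= s -> s <= t -> u s <= u t) ->
  (forall T e, 0 < e -> exists2 t, T <= t & `|u t - l| < e) ->
  (forall t, 0 <= t -> u t <= l) /\
  (forall e, 0 < e -> exists2 T, 0 <= T & forall t, T <= t -> `|u t - l| < e).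
Proof.
move=> um ul.
have ule t : 0 <= t -> u t <= l.
  move=> t0; apply/ler_addgt0Pr => e /(ul t)[s ts]; rewrite ltr_norml.
  move=> /andP[_]; have := um _ _ t0 ts; lra.
split => // e /(ul 0)[T T0]; rewrite ltr_norml => /andP[uT _].
exists T => // t Tt; have := um _ _ T0 Tt; have := ule t (le_trans T0 Tt).
rewrite ltr_norml; lra.
Qed.

(** The limits of [backward_uniformization] are reached for arbitrarily large [t];
    being limits of monotone quantities they are limits for [t] tending to
    infinity and upper bounds. *)
Lemma petal_uniformization : exists2 g : C -> C, conformal_map D disk g &
  (forall z, D z -> (forall t, 0 <= t -> density t z <= hyp_density D z) /\
    forall e, 0 < e -> exists2 T, 0 <= T &
      forall t, T <= t -> `|density t z - hyp_density D z| < e) /\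
  (forall z w, D z -> D w ->
    (forall t, 0 <= t -> pdist (psi t z) (psi t w) <= pdist (g z) (g w)) /\
    forall e, 0 < e -> exists2 T, 0 <= T &
      forall t, T <= t -> `|pdist (psi t z) (psi t w) - pdist (g z) (g w)| < e).
Proof.
have [z0 Dz0] := petal_nonempty.
have [F [UF ooF]] := ultraFilterLemma (@proper_pinfty_nbhs R).
have padd s t z : 0 <= s -> 0 <= t -> disk z -> phi (t + s) z = phi s (phi t z).
  by move=> s0 t0 z1; rewrite addrC (semigroup_add sg).
have [f [g [[hf hg] [fD gd] [fg gf] H1 H2]]] := backward_uniformization
  (semigroup_holomorphic sg) (semigroup_disk sg) psi_hol psi_D phi_psi
  padd psi0 petal_disk petal_open petal_connected Dz0 (petal_max Dz0) ooF.
have cg : conformal_map D disk g.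
  split => //; split => [z|z w|w w1].
  - exact: gd.
  - by rewrite !inE => Dz Dw E; rewrite -(fg z Dz) E fg.
  - by exists (f w); [exact: fD|exact: gf].
exists g => //; split => [z Dz|z w Dz Dw].
  apply: monotone_limit => [s t s0 st|T e e0]; first exact: backward_density_homo.
  by rewrite (hyp_densityE petal_open cg Dz); exact: H1.
apply: monotone_limit => [s t s0 st|T e e0]; first exact: backward_pdist_homo.
exact: H2.
Qed.

End petals.

(** * Curves, partitions and uniformity on compact sets *)

Section partitions.
Context {R : realType}.
Local Notation C := (cplx R).
Implicit Types (p : seq R) (k n : nat) (c : R -> C) (e d l : R).

Lemma node_ge0_le1 p k : itv_partition 0 1 p -> (k <= size p)%N ->
  0 <= node p k <= 1.
Proof.
move=> pp ks; rewrite /node (set_nth_default 1)//.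
by rewrite (itv_partition_nth_ge _ pp)//= (itv_partition_nth_le _ pp).
Qed.

Lemma node_le p k : itv_partition 0 1 p -> (k < size p)%N ->
  node p k <= node p k.+1.
Proof. by move=> [/(pathP 0) H _] ks; exact/ltW/H. Qed.

Lemma node_size p : itv_partition 0 1 p -> node p (size p) = 1.
Proof. exact: itv_partition_nth_size. Qed.

Definition uniform_partition n : seq R := mkseq (fun k => k.+1%:R / n%:R) n.

Lemma node_uniform n k : (k <= n)%N -> node (uniform_partition n) k = k%:R / n%:R.
Proof.
by case: k => [|k] kn; rewrite /node/= ?mul0r// nth_mkseq.
Qed.

Lemma uniform_partitionP n : (0 < n)%N -> itv_partition 0 1 (uniform_partition n).
Proof.
move=> n0; have n0' : (0 : R) < n%:R by rewrite ltr0n.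
split.
  apply/(pathP 0) => i; rewrite size_mkseq => iN.
  rewrite -[nth 0 (0 :: _) i]/(node _ i) node_uniform; last exact: ltnW.
  by rewrite nth_mkseq// ltr_pM2r ?invr_gt0// ltr_nat.
rewrite (last_nth 0) size_mkseq -[nth 0 (0 :: _) n]/(node _ n) node_uniform//.
by rewrite divff// gt_eqF.
Qed.

Lemma fine_partition d : 0 < d -> exists2 p, itv_partition 0 1 p &
  forall k, (k < size p)%N -> node p k.+1 - node p k < d.
Proof.
move=> d0; pose n := (Num.bound d^-1).+1.
exists (uniform_partition n); first exact: uniform_partitionP.
rewrite size_mkseq => k kn; rewrite !node_uniform ?(ltnW kn)//.
rewrite -mulrBl -natrB ?leqnSn// subSnn mul1r invf_plt ?posrE ?ltr0n//.
have d1 : 0 <= d^-1 by rewrite invr_ge0 ltW.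
by apply: lt_le_trans (archi_boundP d1) _; rewrite ler_nat.
Qed.

Lemma chord_ge0 c p k : 0 <= chord c p k.
Proof. exact: modulus_ge0. Qed.

(** The tagged sums for the two curves differ by at most [e] times the length of
    the first one. *)
Lemma arclength_transport (rho1 rho2 : C -> R) (c1 c2 : R -> C) l :
  rectifiable c1 ->
  (forall e, 0 < e -> exists2 d, 0 < d & forall x s y, 0 <= x -> x <= s ->
     s <= y -> y <= 1 -> y - x < d ->
     `|rho2 (c2 s) * modulus (c2 y - c2 x) - rho1 (c1 s) * modulus (c1 y - c1 x)| <=
       e * modulus (c1 y - c1 x)) ->
  is_arclength_integral rho1 c1 l -> is_arclength_integral rho2 c2 l.
Proof.
move=> [M HM] Hc I e e0.
have M0 : 0 <= M.
  have pp := itv_partition1 (@ltr01 R).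
  by apply: le_trans (HM _ pp); apply: sumr_ge0 => k _; exact: chord_ge0.
have e2 : 0 < e / 2 by rewrite divr_gt0.
have e' : 0 < e / 2 / (M + 1) by rewrite divr_gt0//; lra.
have [d1 d10 H1] := Hc _ e'; have [d2 d20 H2] := I _ e2.
exists (Num.min d1 d2); first by rewrite lt_min d10.
move=> p x pp tag.
have {}H2 := H2 p x pp; have {H2} : `|\sum_(k < size p)
    rho1 (c1 (x k)) * chord c1 p k - l| < e / 2.
  apply: H2 => k ks; have [h1] := tag k ks.
  by rewrite lt_min => /andP[_ h2].
have : `|\sum_(k < size p) rho2 (c2 (x k)) * chord c2 p k -
         \sum_(k < size p) rho1 (c1 (x k)) * chord c1 p k| <= e / 2.
  rewrite -sumrB; apply: le_trans (ler_norm_sum _ _ _) _.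
  apply: (@le_trans _ _ (\sum_(k < size p) e / 2 / (M + 1) * chord c1 p k)).
    apply: ler_sum => k _; have [/andP[h1 h2]] := tag k (ltn_ord k).
    rewrite lt_min => /andP[h3 _].
    have /andP[n0 _] := node_ge0_le1 pp (ltnW (ltn_ord k)).
    have /andP[_ n1] := node_ge0_le1 pp (ltn_ord k).
    exact: H1.
  rewrite -mulr_sumr; apply: le_trans (ler_wpM2l (ltW e') (HM _ pp)) _.
  by rewrite mulrAC ler_pdivrMr; [rewrite ler_pM2l//; lra | lra].
set S1 := \sum_(_ < _) _ => A; set S2 := \sum_(_ < _) _ in A * => B.
have := ler_normD (S1 - S2) (S2 - l); rewrite addrA subrK; lra.
Qed.

Lemma rectifiable_lipschitz c1 c2 (L : R) : 0 <= L ->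
  (forall x y, 0 <= x <= 1 -> 0 <= y <= 1 ->
    modulus (c2 y - c2 x) <= L * modulus (c1 y - c1 x)) ->
  rectifiable c1 -> rectifiable c2.
Proof.
move=> L0 H [M HM]; exists (L * M) => p pp.
apply: le_trans (ler_wpM2l L0 (HM p pp)); rewrite mulr_sumr; apply: ler_sum => k _.
apply: H; first exact: node_ge0_le1 (ltnW _).
exact: node_ge0_le1.
Qed.

End partitions.

Section compact_uniformity.
Context {R : realType}.
Local Notation C := (cplx R).
Implicit Types (p z w q : C) (f g : C -> C) (c : R -> C) (e d r s x y : R).

(** [P d q] stands for an estimate around [q] at scale [d]; a scale that works near
    each point of a compact set can be chosen once for all. *)
Lemma compact_uniform (K : set C) (P : R -> C -> Prop) : compact K ->
  (forall z, K z -> exists2 r, 0 < r & forall d q, 0 < d -> d < r ->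
     modulus (q - z) < r -> P d q) ->
  exists2 d, 0 < d & forall q, K q -> P d q.
Proof.
move=> /compact_near_coveringP cK HP.
have H := cK R (0^'+) P _.
have : \forall d \near 0^'+, K `<=` P d.
  apply: H => z /HP[r r0 Hr].
  exists (cball z r, [set d | 0 < d < r]); last first.
    by move=> [q d] /= [qx /andP[d0 dr]]; exact: Hr.
  split => /=; first exact: nbhs_cball.
  exists r => // d /=; rewrite sub0r normrN => dr d0.
  by rewrite d0 (le_lt_trans (ler_norm _) dr).
move=> /(filterI (nbhs_right_gt 0)) /filter_ex[d [d0 Hd]]; exists d => //.
Qed.

Lemma curve_unif_continuous c : {within `[0, 1], continuous c} ->
  forall e, 0 < e -> exists2 d, 0 < d & forall x y, 0 <= x <= 1 -> 0 <= y <= 1 ->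
    `|x - y| < d -> modulus (c x - c y) < e.
Proof.
move=> /subspace_continuousP cc e e0; have e2 : 0 < e / 2 by rewrite divr_gt0.
have /compact_near_coveringP := @segment_compact R 0 1.
pose P d (x : R) := 0 <= x <= 1 -> forall y, 0 <= y <= 1 -> `|x - y| < d ->
  modulus (c x - c y) < e.
move=> /(_ R (0^'+) P _) H.
have : \forall d \near 0^'+, `[0, 1]%classic `<=` P d.
  apply: H => x x1; have := cc x x1 _ (nbhs_cball (c x) e2).
  rewrite /within /= => /nbhs_ballP[r /= r0 Hr].
  exists (ball x (r / 2), [set d | 0 < d < r / 2]); last first.
    move=> [z d] /= [zx /andP[d0 dr]] z1 y y1 zy.
    rewrite /ball/= in zx.
    have h1 : modulus (c z - c x) < e / 2.
      by apply: Hr; rewrite /ball/= ?in_itv//=; lra.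
    have h2 : modulus (c y - c x) < e / 2.
      apply: Hr; rewrite /ball/= ?in_itv//=.
      have := ler_normD (x - z) (z - y); rewrite addrA subrK; lra.
    have := modulusD (c z - c x) (c x - c y); rewrite addrA subrK.
    rewrite [modulus (c x - c y)]modulusB; lra.
  have r2 : 0 < r / 2 by rewrite divr_gt0.
  split => /=; first by apply/nbhs_ballP; exists (r / 2).
  exists (r / 2) => // d /=; rewrite sub0r normrN => dr d0.
  by rewrite d0 (le_lt_trans (ler_norm _) dr).
move=> /(filterI (nbhs_right_gt 0)) /filter_ex[d [d0 Hd]]; exists d => // x y x1.
by apply: Hd => //=; rewrite in_itv.
Qed.

(** [f] minus a linear function has a small derivative near [p], because the
    derivative of [f] is continuous; conclude by the mean value inequality. *)
Lemma strict_diff f p r e : 0 < r -> hol_ball f p r -> 0 < e ->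
  exists2 s, 0 < s & forall q z w, modulus (q - p) < s -> modulus (z - p) < s ->
    modulus (w - p) < s ->
    modulus (f w - f z - derive1 f q * (w - z)) <= e * modulus (w - z).
Proof.
move=> r0 hf e0; have [t [t0 tr bf]] := local_bound r0 hf; set M := _ + 1 in bf.
have pp : modulus (p - p) < r by rewrite subrr modulus0.
have [b fb] := hol_ball_derive1 hf pp; set a := derive1 f p.
have e2 : 0 < e / 2 by rewrite divr_gt0.
have /continuous_epsP/(_ _ e2)[u u0 Hu] := cdiff_continuous fb.
pose G v := f v - a * v.
have dG v : modulus (v - p) < t -> cdiff G v (derive1 f v - a).
  move=> vt; rewrite -[X in _ - X]mulr1.
  apply: cdiffB (cdiffZ _ (cdiff_id v)); apply: hol_ball_derive hf _.
  exact: lt_le_trans vt tr.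
pose s := Num.min t u / 8.
have [s0 st su] : [/\ 0 < s, 8 * s <= t & 8 * s <= u].
  have s8 : 8 * s = Num.min t u by rewrite /s [8 * _]mulrC divfK.
  by rewrite s8 !ge_min !lexx orbT divr_gt0// lt_min t0.
have ball v z : modulus (z - p) < s -> modulus (v - z) < 2 * (2 * s) ->
    modulus (v - p) < 8 * s.
  have := modulusD (v - z) (z - p); rewrite addrA subrK; lra.
exists s => // q z w qs zs ws.
have hG : hol_ball G z (2 * (2 * s)).
  by move=> v /(ball _ _ zs) vs; eexists; apply: dG; exact: lt_le_trans vs st.
have bG : bnd_ball G z (2 * (2 * s)) (M + modulus a * (modulus p + t)).
  move=> v /(ball _ _ zs) vs; have vt := lt_le_trans vs st.
  apply: le_trans (modulusD _ _) _; rewrite modulusN modulusM.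
  apply: lerD; first exact: bf.
  rewrite ler_wpM2l ?modulus_ge0//.
  have := modulusD p (v - p); rewrite addrC subrK; lra.
have wz : modulus (w - z) < 2 * s.
  have := modulusD (w - p) (p - z); rewrite addrA subrK [modulus (p - z)]modulusB; lra.
have Du v : modulus (v - p) < 8 * s -> modulus (derive1 f v - a) <= e / 2.
  by move=> vs; apply/ltW/Hu; exact: lt_le_trans vs su.
have s20 : 0 < 2 * s by rewrite mulr_gt0.
have GL : modulus (G w - G z) <= e / 2 * modulus (w - z).
  apply: (mean_value_ineq s20 hG bG wz) => v vz.
  have vs : modulus (v - p) < 8 * s by apply: (ball _ _ zs); lra.
  by rewrite (cdiff_derive1 (dG _ (lt_le_trans vs st))); exact: Du.
have -> : f w - f z - derive1 f q * (w - z) =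
  (G w - G z) - (derive1 f q - a) * (w - z) by rewrite /G; ring.
apply: le_trans (modulusD _ _) _; rewrite modulusN modulusM.
have : modulus (derive1 f q - a) * modulus (w - z) <= e / 2 * modulus (w - z).
  by rewrite ler_wpM2r ?modulus_ge0// Du//; lra.
lra.
Qed.

End compact_uniformity.

(** * Conformal invariance of the hyperbolic distance *)

Section compact_differentiability.
Context {R : realType}.
Local Notation C := (cplx R).
Implicit Types (z w p q : C) (e d : R).

Lemma compact_strict_diff (U K : set C) (h : C -> C) e : open U ->
  holomorphic_on U h -> compact K -> K `<=` U -> 0 < e ->
  exists2 d, 0 < d & forall q, K q -> forall z w,
  modulus (z - q) < d -> modulus (w - q) < d ->
  modulus (h w - h z - derive1 h q * (w - z)) <= e * modulus (w - z).
Proof.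
move=> oU hh cK KU e0; apply: (compact_uniform (P := fun d q => forall z w,
  modulus (z - q) < d -> modulus (w - q) < d ->
  modulus (h w - h z - derive1 h q * (w - z)) <= e * modulus (w - z)) cK).
move=> p Kp; have [r [r0 rU hr]] := hol_on_ball oU hh (KU _ Kp).
have [t t0 Ht] := strict_diff r0 hr e0; exists (t / 2) => [|d q d0 dt qt z w zq wq].
  by rewrite divr_gt0.
apply: Ht.
- lra.
- have := modulusD (z - q) (q - p); rewrite addrA subrK; lra.
- have := modulusD (w - q) (q - p); rewrite addrA subrK; lra.
Qed.

End compact_differentiability.

Section conformal_curves.
Context {R : realType}.
Local Notation C := (cplx R).
Implicit Types (p z w q : C) (c : R -> C) (e d r s x y l : R).

Variables (U V : set C) (h : C -> C) (rhoU rhoV : C -> R).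
Hypothesis U_open : open U.
Hypothesis h_hol : holomorphic_on U h.
Hypothesis h_UV : forall z, U z -> V (h z).
Hypothesis rho_h : forall z, U z -> rhoU z = rhoV (h z) * modulus (derive1 h z).
Hypothesis rho_cont : forall z, U z -> {for z, continuous (fun z => rhoV (h z))}.
Hypothesis rho_ge0 : forall z, U z -> 0 <= rhoV (h z).

Variable c : R -> C.
Hypothesis c_cont : {within `[0, 1], continuous c}.
Hypothesis c_U : forall x, 0 <= x <= 1 -> U (c x).

Let K := c @` `[0, 1].

Let K_compact : compact K.
Proof. exact: continuous_compact c_cont (@segment_compact _ _ _). Qed.

Let c_K x : 0 <= x <= 1 -> K (c x).
Proof. by move=> x1; exists x => //=; rewrite in_itv. Qed.

Let K_U z : K z -> U z.
Proof. by move=> [x /=]; rewrite in_itv/= => /c_U + <-. Qed.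

(** Upper bounds are expressed as [d^-1] so that all of them get better as the
    scale [d] decreases, as [compact_uniform] requires. *)
Let uniform_bounds : exists2 d, 0 < d & forall q, K q ->
  [/\ modulus (h q) <= d^-1, rhoV (h q) <= d^-1 &
   forall w, modulus (w - q) < d -> modulus (h w - h q) <= d^-1 * modulus (w - q)].
Proof.
apply: (compact_uniform (P := fun d q => [/\ modulus (h q) <= d^-1,
  rhoV (h q) <= d^-1 & forall w, modulus (w - q) < d ->
    modulus (h w - h q) <= d^-1 * modulus (w - q)]) K_compact) => p Kp.
have [r [r0 rU hr]] := hol_on_ball U_open h_hol (K_U Kp).
have pp : modulus (p - p) < r by rewrite subrr modulus0.
have [s [s0 sr bs]] := local_bound r0 hr.
have [t t0 Ht] := strict_diff r0 hr (@ltr01 R).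
have [b fb] := hol_ball_derive1 hr pp.
have /continuous_epsP/(_ _ ltr01)[u u0 Hu] := cdiff_continuous fb.
have := rho_cont (K_U Kp) => /cvgrPdist_lt/(_ _ ltr01)/nbhs_cballP[v v0 Hv].
set A := modulus (h p) + 1 in bs; pose B := modulus (derive1 h p) + 2.
pose D : R := `|rhoV (h p)| + 1.
have A0 : 0 < A by rewrite /A; have := modulus_ge0 (h p); lra.
have B0 : 0 < B by rewrite /B; have := modulus_ge0 (derive1 h p); lra.
have D0 : 0 < D by rewrite /D; have := normr_ge0 (rhoV (h p)); lra.
pose m1 := Num.min (Num.min s (t / 2)) (Num.min u v).
pose m2 := Num.min A^-1 (Num.min B^-1 D^-1).
have m10 : 0 < m1 by rewrite /m1 !lt_min s0 u0 v0 divr_gt0.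
have m20 : 0 < m2 by rewrite /m2 !lt_min !invr_gt0 A0 B0 D0.
exists (Num.min m1 m2) => [|d q d0]; first by rewrite lt_min m10.
rewrite !lt_min -!andbA => /and5P[ds dt du dv /and3P[dA dB dD]].
move=> /and5P[qs qt qu qv _].
have inv_le (k : R) : 0 < k -> d < k^-1 -> k <= d^-1.
  by move=> k0 dk; rewrite -[k]invrK lef_pV2 ?posrE ?invr_gt0// ltW.
split.
- exact: le_trans (bs _ qs) (inv_le _ A0 dA).
- apply: le_trans (inv_le _ D0 dD).
  have := Hv q qv; rewrite /= => H; have := ler_normD (rhoV (h q) - rhoV (h p)) (rhoV (h p)).
  rewrite subrK distrC; have := ler_norm (rhoV (h q)); rewrite /D; lra.
- move=> w wq.
  have wt : modulus (w - p) < t.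
    have := modulusD (w - q) (q - p); rewrite addrA subrK; lra.
  have qt' : modulus (q - p) < t by lra.
  apply: (@le_trans _ _ (B * modulus (w - q))); last first.
    by rewrite ler_wpM2r ?modulus_ge0// inv_le.
  have -> : h w - h q = (h w - h q - derive1 h q * (w - q)) + derive1 h q * (w - q).
    by ring.
  apply: le_trans (modulusD _ _) _; rewrite modulusM.
  have : modulus (derive1 h q) * modulus (w - q) <=
      (modulus (derive1 h p) + 1) * modulus (w - q).
    rewrite ler_wpM2r ?modulus_ge0//.
    have := modulusD (derive1 h q - derive1 h p) (derive1 h p).
    rewrite subrK => H; apply: le_trans H _.
    by rewrite [leRHS]addrC lerD2r; apply: ltW; exact: Hu.
  move=> H1; apply: le_trans (lerD (Ht q q w qt' qt' wt) H1) _.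
  rewrite -mulrDl; apply: ler_wpM2r; first exact: modulus_ge0.
  by rewrite addrCA -mulr2n.
Qed.

Let unif_strict e : 0 < e -> exists2 d, 0 < d & forall q, K q -> forall z w,
  modulus (z - q) < d -> modulus (w - q) < d ->
  modulus (h w - h z - derive1 h q * (w - z)) <= e * modulus (w - z).
Proof. exact: compact_strict_diff U_open h_hol K_compact K_U. Qed.

(** Points of the curve at distance at least [d] are dealt with by the bound on [h]. *)
Let h_lipschitz : exists2 L : R, 0 <= L & forall x y, 0 <= x <= 1 -> 0 <= y <= 1 ->
  modulus (h (c y) - h (c x)) <= L * modulus (c y - c x).
Proof.
have [d d0 Hd] := uniform_bounds.
have i0 : 0 < d^-1 by rewrite invr_gt0.
exists (d^-1 + 2 * d^-1 * d^-1); first by rewrite addr_ge0 ?mulr_ge0 ?ltW.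
move=> x y x1 y1; have m0 := modulus_ge0 (c y - c x).
have [_ _ near] := Hd _ (c_K x1); have [bx _ _] := Hd _ (c_K x1).
have [by_ _ _] := Hd _ (c_K y1).
have [/near H|far] := ltP (modulus (c y - c x)) d.
  apply: le_trans H _; rewrite mulrDl lerDl mulr_ge0// ltW// !mulr_gt0//.
have : 2 * d^-1 <= 2 * d^-1 * d^-1 * modulus (c y - c x).
  rewrite -[X in _ <= X]mulrA ler_peMr ?mulr_ge0 ?(ltW i0)//.
  by rewrite mulrC ler_pdivlMr// mul1r.
have : 0 <= d^-1 * modulus (c y - c x) by rewrite mulr_ge0// ltW.
have := modulusD (h (c y)) (- h (c x)); rewrite modulusN mulrDl; lra.
Qed.

Lemma conformal_continuous : {within `[0, 1], continuous (fun x => h (c x))}.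
Proof.
have /subspace_continuousP H := c_cont.
apply/subspace_continuousP => x xI; have x1 : 0 <= x <= 1 by move: xI; rewrite /= in_itv.
apply: (@cvg_comp _ _ _ c h); first exact: H.
exact: cdiff_continuous (holomorphic_cdiff h_hol (c_U x1)).
Qed.

Lemma conformal_rectifiable : rectifiable c -> rectifiable (fun x => h (c x)).
Proof. by have [L L0 HL] := h_lipschitz; exact: rectifiable_lipschitz L0 HL. Qed.

(** On short arcs chords are multiplied by the modulus of the derivative, up to a
    small relative error, and the densities are divided by it. *)
Lemma conformal_integral l : rectifiable c -> is_arclength_integral rhoU c l ->
  is_arclength_integral rhoV (fun x => h (c x)) l.
Proof.
move=> rc; apply: arclength_transport rc _ => e e0.
have [d d0 Hd] := uniform_bounds.
have [d' d'0 Hd'] := unif_strict (mulr_gt0 e0 d0).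
have [u u0 Hu] := curve_unif_continuous c_cont d'0.
exists u => // x s y x0 xs sy y1 xy.
have x1 : 0 <= x <= 1 by rewrite x0 (le_trans xs (le_trans sy y1)).
have s1 : 0 <= s <= 1 by rewrite (le_trans x0 xs) (le_trans sy y1).
have y1' : 0 <= y <= 1 by rewrite y1 (le_trans x0 (le_trans xs sy)).
have xs' : modulus (c x - c s) < d' by apply: Hu => //; rewrite ltr_norml; lra.
have ys' : modulus (c y - c s) < d' by apply: Hu => //; rewrite ltr_norml; lra.
rewrite (rho_h (c_U s1)) -mulrA -mulrBr normrM (ger0_norm (rho_ge0 (c_U s1))).
have [_ rb _] := Hd _ (c_K s1); have H := Hd' _ (c_K s1) _ _ xs' ys'.
rewrite -modulusM; set X := h (c y) - h (c x) in H *; set Y := _ * (c y - c x) in H *.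
have XY : `|modulus X - modulus Y| <= e * d * modulus (c y - c x).
  exact: le_trans (modulus_sub_le X Y) H.
apply: le_trans (ler_pM (rho_ge0 (c_U s1)) (normr_ge0 _) rb XY) _.
by rewrite mulrA [d^-1 * _]mulrC mulfK// gt_eqF.
Qed.

End conformal_curves.

Section conformal_invariance.
Context {R : realType}.
Local Notation C := (cplx R).
Implicit Types (z w : C) (U : set C) (f g : C -> C).

Lemma disk_density_continuous z : disk z ->
  {for z, continuous (@disk_density R)}.
Proof.
move=> z1; have c1 : {for z, continuous (fun w : C => modulus w)}.
  exact: continuous_modulus (cdiff_continuous (cdiff_id z)).
have nz : 1 - modulus z ^+ 2 != 0 by rewrite gt_eqF// sqr_lt1.
apply: (@continuousV _ _ (fun w : C => 1 - modulus w ^+ 2)) => //.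
apply: continuousB; first exact: cst_continuous.
have -> : (fun w : C => modulus w ^+ 2) = (fun w : C => modulus w * modulus w).
  by apply/funext => w; rewrite expr2.
exact: continuousM.
Qed.

Lemma near_continuous (a b : C -> R) z : (\near z, a z = b z) ->
  {for z, continuous a} -> {for z, continuous b}.
Proof.
move=> ab ca; have E := nbhs_singleton ab.
by apply: (@cvg_trans _ (a @ z)); [exact: (near_eq_cvg ab)|rewrite -E].
Qed.

Lemma derive1_modulus_continuous U f z : open U -> holomorphic_on U f -> U z ->
  {for z, continuous (fun w => modulus (derive1 f w))}.
Proof.
move=> oU hf Uz; have [r [r0 rU hr]] := hol_on_ball oU hf Uz.
have [a /cdiff_continuous] := derive_cdiff r0 hr; exact: continuous_modulus.
Qed.

(** [g] and its inverse transport the curves joining two points together with their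
    lengths, so the same set of lengths appears on both sides. *)
Lemma hyp_dist_conformal U g z w : open U -> conformal_map U disk g -> U z -> U w ->
  hyp_dist U z w = hyp_dist disk (g z) (g w).
Proof.
move=> oU cg Uz Uw; have [hg bg] := cg; have [hf bf] := conformal_pinv oU cg.
have [gU fU fg gf] := set_bij_inv bg; set f := pinv U g in hf bf fU fg gf.
rewrite /hyp_dist; congr inf; apply/seteqP; split => l [c [[cc cU c0 c1] rc ic]].
- have rho z' : U z' -> hyp_density U z' =
      hyp_density disk (g z') * modulus (derive1 g z').
    by move=> Uz'; rewrite (hyp_densityE oU cg Uz') hyp_density_disk//; exact: gU.
  have rho0 z' : U z' -> 0 <= hyp_density disk (g z').
    by move=> Uz'; rewrite hyp_density_disk ?ltW ?disk_density_gt0//; exact: gU.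
  have rhoc z' : U z' -> {for z', continuous (fun v => hyp_density disk (g v))}.
    move=> Uz'; have cgz := cdiff_continuous (holomorphic_cdiff hg Uz').
    have cd := disk_density_continuous (gU _ Uz').
    have near : \near z', disk_density (g z') = hyp_density disk (g z').
      have [r [r0 rU _]] := hol_on_ball oU hg Uz'.
      by apply/nbhs_cballP; exists r => // v /rU Uv; rewrite hyp_density_disk//; exact: gU.
    apply: near_continuous near _.
    exact: (@continuous_comp _ _ _ g (@disk_density R)).
  exists (fun x => g (c x)); split.
  + split; [exact: (conformal_continuous hg cc cU)|by move=> x /cU /gU| |];
      by rewrite ?c0 ?c1.
  + exact: (conformal_rectifiable (rhoV := hyp_density disk) oU hg rhoc cc cU rc).
  + exact: (conformal_integral (rhoV := hyp_density disk) oU hg rho rhoc rho0 cc cU rc ic).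
- have df1 v : disk v -> modulus (derive1 g (f v)) * modulus (derive1 f v) = 1.
    move=> v1; rewrite -modulusM mulrC.
    have := inverse_derive oU hg hf gU fg (fU _ v1); rewrite gf// mulrC => ->.
    exact: modulus1.
  have rho v : disk v -> hyp_density disk v =
      hyp_density U (f v) * modulus (derive1 f v).
    move=> v1; rewrite (hyp_densityE oU cg (fU _ v1)) gf// -mulrA df1// mulr1.
    exact: hyp_density_disk.
  have rho0 v : disk v -> 0 <= hyp_density U (f v).
    move=> v1; rewrite (hyp_densityE oU cg (fU _ v1)) gf//.
    by rewrite mulr_ge0 ?modulus_ge0// ltW// disk_density_gt0.
  have rhoc v : disk v -> {for v, continuous (fun v => hyp_density U (f v))}.
    move=> v1; have cfv := cdiff_continuous (holomorphic_cdiff hf v1).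
    have near : \near v, disk_density v * modulus (derive1 g (f v)) =
        hyp_density U (f v).
      have [r [r0 rU _]] := hol_on_ball open_disk hf v1.
      apply/nbhs_cballP; exists r => // v' /rU Uv.
      by rewrite (hyp_densityE oU cg (fU _ Uv)) gf.
    apply: near_continuous near _.
    apply: continuousM; first exact: disk_density_continuous.
    apply: (@continuous_comp _ _ _ f (fun w => modulus (derive1 g w))) => //.
    exact: derive1_modulus_continuous oU hg (fU _ v1).
  exists (fun x => f (c x)); split.
  + split; [exact: (conformal_continuous hf cc cU)|by move=> x /cU /fU| |];
      by rewrite ?c0 ?c1 fg.
  + exact: (conformal_rectifiable (rhoV := hyp_density U) open_disk hf rhoc cc cU rc).
  + exact: (conformal_integral (rhoV := hyp_density U) open_disk hf rho rhoc rho0 cc cU rc ic).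
Qed.

End conformal_invariance.

(** * The hyperbolic distance of the disk *)

Section disk_distance.
Context {R : realType}.
Local Notation C := (cplx R).
Implicit Types (z w a : C) (c : R -> C) (p : seq R) (r s t e : R).

Definition artanh r : R := (ln (1 + r) - ln (1 - r)) / 2.

Lemma artanh0 : artanh 0 = 0.
Proof. by rewrite /artanh addr0 subr0 subrr mul0r. Qed.

Lemma is_derive_artanh r : -1 < r < 1 -> is_derive r 1 artanh (1 - r ^+ 2)^-1.
Proof.
move=> /andP[r0 r1]; have p0 : 0 < 1 + r by lra.
have m0 : 0 < 1 - r by lra.
have d1 : is_derive r 1 (fun s : R => 1 + s) (1 : R).
  by apply: (is_derive_eq (is_deriveD _ _)); rewrite add0r.
have d2 : is_derive r 1 (fun s : R => 1 - s) (-1 : R).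
  by apply: (is_derive_eq (is_deriveB _ _)); rewrite sub0r.
have l1 := is_derive1_comp (is_derive1_ln p0) d1.
have l2 : is_derive r 1 (@ln R \o (fun s : R => 1 - s)) ((1 - r)^-1 * -1).
  by apply: is_derive1_comp; exact: is_derive1_ln.
have H := is_deriveZ 2^-1 (is_deriveB l1 l2).
have -> : artanh = 2^-1 \*: ((@ln R \o (fun s : R => 1 + s)) \- (@ln R \o (fun s : R => 1 - s))).
  by apply/funext => s /=; rewrite /artanh mulrC.
apply: (is_derive_eq H); rewrite /GRing.scale /=.
by field; rewrite !gt_eqF//; have : r * r < 1; nra.
Qed.

(** The mean value theorem; the derivative is increasing. *)
Lemma artanh_bounds r s : 0 <= r -> r <= s -> s < 1 ->
  (1 - r ^+ 2)^-1 * (s - r) <= artanh s - artanh r <= (1 - s ^+ 2)^-1 * (s - r).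
Proof.
move=> r0 rs s1.
have [||t] := @MVT_segment R artanh (fun t => (1 - t ^+ 2)^-1) r s rs.
- move=> x; rewrite in_itv/= => /andP[rx xs]; apply: is_derive_artanh; lra.
- apply: derivable_within_continuous => x; rewrite in_itv/= => /andP[rx xs].
  have xI : -1 < x < 1 by lra.
  by have [] := is_derive_artanh xI.
move=> tI ->; have /andP[rt ts] : r <= t <= s by move: tI; rewrite in_itv.
have H (x y : R) : 0 <= x -> x <= y -> y < 1 -> (1 - x ^+ 2)^-1 <= (1 - y ^+ 2)^-1.
  move=> x0 xy y1; rewrite lef_pV2 ?posrE ?subr_gt0 ?expr_lt1 ?(le_trans x0)//.
    by rewrite lerD2l lerN2 lerXn2r ?nnegrE ?(le_trans x0).
  exact: le_lt_trans y1.
by rewrite !ler_wpM2r ?subr_ge0// H//; lra.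
Qed.

Lemma tanh_artanh r : 0 <= r -> r < 1 -> tanh (artanh r) = r.
Proof.
move=> r0 r1; have p0 : 0 < 1 + r by lra.
have m0 : 0 < 1 - r by lra.
rewrite /tanh expRN; set E := expR _; have E0 : 0 < E := expR_gt0 _.
have E2 : E * E = (1 + r) / (1 - r).
  rewrite -expRD /artanh -mulrDr -mulr2n.
  rewrite -[2^-1 *+ 2]mulr_natr mulVf ?pnatr_eq0// mulr1.
  by rewrite expRD expRN !lnK.
have -> : (E - E^-1) / (E + E^-1) = (E * E - 1) / (E * E + 1).
  by field; rewrite ?gt_eqF ?addr_gt0 ?mulr_gt0.
by rewrite E2; field; rewrite ?gt_eqF; lra.
Qed.

(** Moving the tag of each interval to the end point of larger modulus makes the
    tagged sum dominate the increments of [artanh] of the modulus, which telescope. *)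
Lemma artanh_le_integral c w l : joins disk 0 w c ->
  is_arclength_integral (hyp_density disk) c l -> artanh (modulus w) <= l.
Proof.
move=> [_ cD c0 c1] ic; apply/ler_addgt0Pl => e e0.
have [d d0 Hd] := ic e e0; have [p pp pd] := fine_partition d0.
pose u k := modulus (c (node p k)).
pose x k := if u k <= u k.+1 then node p k.+1 else node p k.
have nk k : (k <= size p)%N -> 0 <= node p k <= 1 by exact: node_ge0_le1.
have uk k : (k <= size p)%N -> 0 <= u k < 1.
  by move=> ks; rewrite modulus_ge0; apply: cD; exact: nk.
have Hx k : (k < size p)%N -> node p k <= x k <= node p k.+1 /\ node p k.+1 - node p k < d.
  move=> ks; split; last exact: pd.
  by rewrite /x; case: ifP => _; rewrite lexx (node_le pp ks).
have := Hd p x pp Hx; rewrite ltr_norml => /andP[_ H].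
suff : artanh (modulus w) <= \sum_(k < size p) hyp_density disk (c (x k)) * chord c p k.
  by lra.
have -> : artanh (modulus w) = \sum_(k < size p) (artanh (u k.+1) - artanh (u k)).
  rewrite -(big_mkord xpredT (fun k => artanh (u k.+1) - artanh (u k))).
  rewrite (telescope_sumr (fun k => artanh (u k)))// /u node_size// c1 /node/= c0.
  by rewrite modulus0 artanh0 subr0.
apply: ler_sum => -[k ks] _ /=; have /andP[a0 a1] := uk _ (ltnW ks).
have /andP[b0 b1] := uk _ ks.
have xD : disk (c (x k)).
  by apply: cD; rewrite /x; case: ifP => _; apply: nk => //; exact: ltnW.
rewrite hyp_density_disk// /chord /disk_density.
have ch : `|u k.+1 - u k| <= modulus (c (node p k.+1) - c (node p k)).
  exact: modulus_sub_le.
have i0 : 0 <= (1 - modulus (c (x k)) ^+ 2)^-1 by rewrite invr_ge0 ltW// sqr_lt1.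
apply: le_trans (ler_wpM2l i0 ch).
rewrite /x; case: ifP => [uu|/negbT].
  by have /andP[_] := artanh_bounds a0 uu b1; rewrite ger0_norm// subr_ge0.
rewrite -ltNge => /ltW uu; have /andP[H1 _] := artanh_bounds b0 uu a1.
apply: (@le_trans _ _ 0); last by rewrite mulr_ge0// invr_ge0 ltW// sqr_lt1.
rewrite subr_le0 -subr_ge0; apply: le_trans H1.
by rewrite mulr_ge0 ?subr_ge0// invr_ge0 subr_ge0 expr_le1// ltW.
Qed.

Let ray w : R -> C := fun t => (t%:C)%C * w.

Let chord_ray w s t : s <= t -> modulus (ray w t - ray w s) = (t - s) * modulus w.
Proof.
move=> st; rewrite /ray -mulrBl modulusM.
have -> : (t%:C)%C - (s%:C)%C = ((t - s)%:C)%C :> C by rewrite rmorphB.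
by rewrite modulus_real ger0_norm// subr_ge0.
Qed.

Let modulus_ray w t : 0 <= t -> modulus (ray w t) = t * modulus w.
Proof. by move=> t0; rewrite /ray modulusM modulus_real ger0_norm. Qed.

Lemma joins_ray w : disk w -> joins disk 0 w (ray w).
Proof.
move=> w1; split.
- have -> : ray w = (fun t : R => 0 + t%:C%C * (w - 0)).
    by apply/funext => t; rewrite add0r subr0.
  exact/continuous_subspaceT/continuous_seg.
- move=> t /andP[t0 t1]; rewrite /disk /= modulus_ray//.
  by apply: le_lt_trans w1; rewrite ler_piMl ?modulus_ge0.
- by rewrite /ray mul0r.
- by rewrite /ray mul1r.
Qed.

Lemma rectifiable_ray w : rectifiable (ray w).
Proof.
exists (modulus w) => p pp.
have E : \sum_(k < size p) chord (ray w) p k =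
    \sum_(k < size p) (node p k.+1 * modulus w - node p k * modulus w).
  by apply: eq_bigr => -[k ks] _; rewrite /chord chord_ray ?node_le// mulrBl.
rewrite E -(big_mkord xpredT (fun k => node p k.+1 * modulus w - node p k * modulus w)).
rewrite (telescope_sumr (fun k => node p k * modulus w))// node_size// /node/=.
by rewrite mul0r subr0 mul1r.
Qed.

(** On each interval both the tagged term and the increment of [artanh] lie between
    the values of the density at the two ends times the chord; the gaps between
    these bounds telescope. *)
Lemma ray_integral w : disk w ->
  is_arclength_integral (hyp_density disk) (ray w) (artanh (modulus w)).
Proof.
move=> w1 e e0; set m := modulus w; have m0 : 0 <= m := modulus_ge0 w.
have [_ rD _ _] := joins_ray w1.
pose lam t := (1 - (t * m) ^+ 2)^-1.
have tm t : 0 <= t -> t <= 1 -> 0 <= t * m /\ t * m < 1.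
  move=> t0 t1; split; first exact: mulr_ge0.
  by apply: le_lt_trans w1; rewrite ler_piMl.
have L0 : 0 < lam 1 + 1.
  by rewrite ltr_pwDr// invr_ge0 mul1r ltW// sqr_lt1.
exists (e / (lam 1 + 1)); first by rewrite divr_gt0.
move=> p x pp Hx.
pose A k := artanh (node p k * m).
have -> : artanh m = \sum_(k < size p) (A k.+1 - A k).
  rewrite -(big_mkord xpredT (fun k => A k.+1 - A k)) (telescope_sumr A)//.
  by rewrite /A node_size// mul1r /node/= mul0r artanh0 subr0.
rewrite -sumrB; apply: le_lt_trans (ler_norm_sum _ _ _) _.
pose q k := lam (node p k) * (e / (lam 1 + 1)).
have Hk k : (k < size p)%N ->
   `|hyp_density disk (ray w (x k)) * chord (ray w) p k - (A k.+1 - A k)| <= q k.+1 - q k.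
  move=> ks; have [/andP[x1 x2] nd] := Hx k ks.
  have /andP[n0 _] := node_ge0_le1 pp (ltnW ks).
  have /andP[_ n1] := node_ge0_le1 pp ks.
  have xx0 := le_trans n0 x1; have xx1 := le_trans x2 n1.
  rewrite hyp_density_disk; last by apply: rD; rewrite xx0.
  rewrite /chord (chord_ray _ (node_le pp ks)) /disk_density modulus_ray// -/m -/(lam _).
  have mon s t : 0 <= s -> s <= t -> t <= 1 -> lam s <= lam t.
    move=> s0 st t1; have [a0 a1] := tm _ s0 (le_trans st t1).
    have [b0 b1] := tm _ (le_trans s0 st) t1.
    rewrite /lam lef_pV2 ?posrE ?subr_gt0 ?expr_lt1//.
    by rewrite lerD2l lerN2 lerXn2r ?nnegrE// ler_wpM2r.
  have [a0 a1] := tm _ n0 (le_trans x1 xx1); have [b0 b1] := tm _ (le_trans xx0 x2) n1.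
  have ab : node p k * m <= node p k.+1 * m by rewrite ler_wpM2r// node_le.
  have /andP[U V] := artanh_bounds a0 ab b1.
  rewrite -/(lam _) -/(lam _) -mulrBl in U V.
  have h0 : 0 <= (node p k.+1 - node p k) * m by rewrite mulr_ge0// subr_ge0 node_le.
  have U' := ler_wpM2r h0 (mon _ _ n0 x1 xx1).
  have V' := ler_wpM2r h0 (mon _ _ xx0 x2 n1).
  have hd : (node p k.+1 - node p k) * m <= e / (lam 1 + 1).
    by apply: le_trans (ltW nd); rewrite ler_piMr ?subr_ge0 ?node_le// ltW.
  have D0 : 0 <= lam (node p k.+1) - lam (node p k).
    by rewrite subr_ge0 mon// (le_trans x1).
  have W := ler_wpM2l D0 hd; rewrite [(_ - lam _) * (_ * m)]mulrBl in W.
  have B (l0 l1 l2 dA k1 : R) : l0 <= dA -> dA <= l2 -> l0 <= l1 -> l1 <= l2 ->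
      l2 - l0 <= k1 -> `|l1 - dA| <= k1.
    by move=> *; rewrite ler_norml; apply/andP; split; lra.
  by rewrite /q -[X in _ <= X]mulrBl; exact: (B _ _ _ _ _ U V U' V' W).
apply: (@le_lt_trans _ _ (\sum_(k < size p) (q k.+1 - q k))).
  by apply: ler_sum => -[k ks] _; exact: Hk.
rewrite -(big_mkord xpredT (fun k => q k.+1 - q k)) (telescope_sumr q)//.
rewrite /q node_size// -mulrBl mulrA ltr_pdivrMr// mulrC ltr_pM2l//.
have : 0 <= lam (node p 0) by rewrite /lam /node/= mul0r expr0n subr0 invr1.
lra.
Qed.

Lemma hyp_dist_disk0 w : disk w -> hyp_dist disk 0 w = artanh (modulus w).
Proof.
move=> w1; rewrite /hyp_dist; set S := [set l | _].
have SA : S (artanh (modulus w)).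
  exists (ray w); split; [exact: joins_ray|exact: rectifiable_ray|exact: ray_integral].
have lb : lbound S (artanh (modulus w)).
  by move=> l [c [jc _ ic]]; exact: artanh_le_integral jc ic.
apply/eqP; rewrite eq_le; apply/andP; split.
- by apply: ge_inf => //; exists (artanh (modulus w)).
- by apply: lb_le_inf => //; exists (artanh (modulus w)).
Qed.

Lemma conformal_mobius a : disk a -> conformal_map disk disk (mobius a).
Proof.
move=> a1; split; first exact: holomorphic_mobius.
have Na := diskN a1; split => [z|z w|w w1].
- exact: mobius_disk.
- by rewrite !inE => z1 w1 E; rewrite -(mobiusK a1 z1) E mobiusK.
- by exists (mobius (- a) w); [exact: mobius_disk|rewrite mobiusNK].
Qed.

(** A Moebius map moves [g z] to the origin, from where distances are known. *)
Lemma tanh_hyp_dist U g z w : open U -> conformal_map U disk g -> U z -> U w ->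
  tanh (hyp_dist U z w) = pdist (g z) (g w).
Proof.
move=> oU cg Uz Uw; rewrite (hyp_dist_conformal oU cg Uz Uw).
have [gU _ _ _] := set_bij_inv cg.2; have a1 := gU _ Uz; have b1 := gU _ Uw.
rewrite (hyp_dist_conformal open_disk (conformal_mobius a1) a1 b1) mobius_id.
rewrite hyp_dist_disk0; last exact: mobius_disk.
rewrite modulus_mobius tanh_artanh ?pdist_ge0 ?pdist_lt1//; exact: pdistC.
Qed.

Lemma tanh_hyp_dist_disk z w : disk z -> disk w ->
  tanh (hyp_dist disk z w) = pdist z w.
Proof. by move=> z1 w1; rewrite (tanh_hyp_dist open_disk conformal_id). Qed.

End disk_distance.

(** * Convergence of the hyperbolic diameters *)

Section hyperbolic_diameter.
Context {R : realType}.
Local Notation C := (cplx R).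
Implicit Types (z w : C) (t s e : R).

Lemma cvg_pinfty_eps (u : R -> R) l :
  (forall e, 0 < e -> exists2 T, 0 <= T & forall t, T <= t -> `|u t - l| < e) ->
  u t @[t --> +oo] --> l.
Proof.
move=> H; apply/cvgrPdist_lt => e /H[T _ HT].
by near=> t; rewrite distrC; apply: HT; near: t; apply: nbhs_pinfty_ge; rewrite num_real.
Unshelve. all: by end_near. Qed.

(** At [l = 0] the hypothesis [u t <= l] makes [u] vanish. *)
Lemma cvg_powR (u : R -> R) l a : 0 < a -> (\forall t \near +oo, 0 <= u t <= l) ->
  u t @[t --> +oo] --> l -> (u t `^ a) @[t --> +oo] --> l `^ a.
Proof.
move=> a0 ul cu; have l0 : 0 <= l.
  have [T [_ HT]] := ul; have /HT/andP[h1 h2] : T < T + 1 by rewrite ltrDl.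
  exact: le_trans h2.
have [l_eq|l_ne] := eqVneq l 0.
  have E : \forall t \near +oo, l `^ a = u t `^ a.
    apply: filterS ul => t /andP[u0 ut]; congr (_ `^ _); apply/eqP.
    by rewrite eq_le ut l_eq u0.
  by apply: cvg_trans (near_eq_cvg E) _; exact: cvg_cst.
have lp : 0 < l by rewrite lt_def l_ne.
have near_eq : \forall t \near +oo, expR (a * ln (u t)) = u t `^ a.
  have /cvgrPdist_lt/(_ _ lp) := cu; apply: filterS => t.
  by rewrite /powR; case: eqP => // ->; rewrite subr0 ger0_norm ?ltxx.
rewrite {2}/powR (negbTE l_ne); apply: cvg_trans (near_eq_cvg near_eq) _.
apply: continuous_cvg; first exact: continuous_expR.
by apply: cvgMl_tmp; apply: continuous_cvg => //; exact: continuous_ln.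
Qed.

Definition diam_product n (d : C -> C -> R) (w : 'I_n -> C) : R :=
  \prod_(i < n) \prod_(j < n | (i < j)%N) (d (w i) (w j) `^ (2 / (n * n.-1)%:R)).

Definition tuples n (K : set C) : set ('I_n -> C) := [set w | forall i, K (w i)].

(** The hyperbolic [n]-th diameter only depends on the values of the kernel
    [tanh d_U] on the set, so it can be computed from any parametrization. *)
Lemma hyp_diam_image (n : nat) (U K : set C) (f : C -> C) (d : C -> C -> R) :
  (forall z w, K z -> K w -> tanh (hyp_dist U (f z) (f w)) = d z w) ->
  hyp_diam n U (f @` K) = sup [set diam_product d w | w in @tuples n K].
Proof.
move=> Hd; pose dU z w := tanh (hyp_dist U z w).
have E (v : 'I_n -> C) : (forall i, K (v i)) ->
    diam_product dU (fun i => f (v i)) = diam_product d v.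
  move=> Kv; apply: eq_bigr => i _; apply: eq_bigr => j _.
  by rewrite /dU (Hd _ _ (Kv i) (Kv j)).
have -> : hyp_diam n U (f @` K) = sup [set diam_product dU w | w in @tuples n (f @` K)].
  by [].
congr (sup _); apply/seteqP; split.
  move=> x [w Hw <-]; have /choice[v Hv] : forall i, exists v, K v /\ f v = w i.
    by move=> i; have [v Kv vw] := Hw i; exists v.
  have Kv i : K (v i) by have [] := Hv i.
  have -> : w = (fun i => f (v i)) by apply/funext => i; have [_ ->] := Hv i.
  by rewrite (E v Kv); exists v; first exact: Kv.
move=> x [v Kv <-]; exists (fun i => f (v i)); first by move=> i; exists (v i); first exact: Kv.
exact: E.
Qed.

(** A point where [G] nearly attains its supremum gives a large value of [F t] as
    soon as [t] is large; the bound by [G] gives the other inequality. *)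
Lemma cvg_sup_below T (A : set T) (F : R -> T -> R) (G : T -> R) (M : R) :
  A !=set0 -> (forall x, A x -> G x <= M) ->
  (forall x, A x -> F t x @[t --> +oo] --> G x) ->
  (\forall t \near +oo, forall x, A x -> F t x <= G x) ->
  sup [set F t x | x in A] @[t --> +oo] --> sup [set G x | x in A].
Proof.
move=> [x0 Ax0] GM cF FG; set S := [set G x | x in A].
have supS : has_sup S by split; [exists (G x0); exists x0|exists M => _ [x Ax <-]; exact: GM].
apply/cvgrPdist_lt => e e0; have [_ [x Ax <-] xe] := sup_adherent e0 supS.
have Fx : \forall t \near +oo, sup S - e < F t x by apply: (cvgr_gt (G x)) => //; exact: cF.
apply: filterS2 Fx FG => t Fx FG.
have ubF : ubound [set F t x | x in A] (sup S).
  by move=> _ [y Ay <-]; apply: le_trans (FG y Ay) _; apply: (ub_le_sup supS.2); exists y.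
have h1 : sup [set F t x | x in A] <= sup S.
  by apply: ge_sup => //; exists (F t x0); exists x0.
have h2 : F t x <= sup [set F t x | x in A].
  by apply: ub_le_sup; [exists (sup S)|exists x].
rewrite ger0_norm ?subr_ge0//; lra.
Qed.

Variables (phi : R -> C -> C) (tau : C) (D : set C).
Hypothesis sg : semigroup phi.
Hypothesis petD : petal phi tau D.

(** In terms of [pdist], the products for the points [psi t z_i] increase to those
    for the points [g z_i]. *)
Lemma hyp_diam_petal (n : nat) (K : set C) : (2 <= n)%N -> K `<=` D ->
  hyp_diam n disk (flow phi D t @` K) @[t --> -oo] --> hyp_diam n D K.
Proof.
move=> n2 KD; have a0 : 0 < (2 / (n * n.-1)%:R : R).
  by rewrite divr_gt0// ltr0n muln_gt0; case: n n2 => [|[]].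
set a := _ / _ in a0.
have [g cg [_ Hg]] := petal_uniformization sg petD.
have oD := petal_open petD.
pose psi t : C -> C := pinv D (phi t).
have psiD t z : 0 <= t -> D z -> disk (psi t z).
  move=> t0 Dz; have [_ bt] := petal_backward_conformal petD t0.
  have [h _ _ _] := set_bij_inv bt.
  exact/(petal_disk sg petD)/h.
pose F t := @diam_product n (fun z w => pdist (psi t z) (psi t w)).
pose G := @diam_product n (fun z w => pdist (g z) (g w)).
pose A := @tuples n K.
have EG : hyp_diam n D K = sup [set G w | w in A].
  rewrite -[K in hyp_diam _ _ K]image_id; apply: hyp_diam_image => z w Kz Kw.
  by rewrite (tanh_hyp_dist oD cg)//; exact: KD.
have EF t : 0 <= t -> hyp_diam n disk (psi t @` K) = sup [set F t w | w in A].
  move=> t0; apply: hyp_diam_image => z w Kz Kw.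
  by apply: tanh_hyp_dist_disk; apply: psiD t0 _; exact: KD.
apply/cvgNy_compNP.
have near_eq : \forall t \near +oo, sup [set F t w | w in A] =
    ((fun t => hyp_diam n disk (flow phi D t @` K)) \o -%R) t.
  near=> t; have t0 : 0 < t by near: t; exact: nbhs_pinfty_gt.
  by rewrite /= /flow oppr_ge0 leNgt t0 /= opprK EF// ltW.
apply: cvg_trans (near_eq_cvg near_eq) _; rewrite EG.
have [K0|/set0P[z0 Kz0]] := eqVneq K set0.
  have -> : A = set0.
    apply/seteqP; split => // w Aw; have n0 : (0 < n)%N by exact: ltnW.
    by have := Aw (Ordinal n0); rewrite K0.
  rewrite image_set0; under eq_cvg do rewrite image_set0; exact: cvg_cst.
have FG t (w : 'I_n -> C) : 0 <= t -> A w -> F t w <= G w.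
  move=> t0 Aw; apply: ler_prod => i _; rewrite prodr_ge0 => [|j _]; last exact: powR_ge0.
  apply: ler_prod => j _; rewrite powR_ge0/=.
  have [h _] := Hg _ _ (KD _ (Aw i)) (KD _ (Aw j)).
  by apply: ge0_ler_powR; [exact: ltW|rewrite nnegrE pdist_ge0..|exact: h].
apply: (cvg_sup_below (M := 1)).
- by exists (fun=> z0).
- move=> w Aw; apply: Num.Theory.prodr_ile1 => i _; rewrite prodr_ge0 => [|j _]; last exact: powR_ge0.
  apply: Num.Theory.prodr_ile1 => j _; rewrite powR_ge0/=.
  rewrite -[leRHS](_ : 1 `^ a = 1); last by rewrite powR1.
   apply: ge0_ler_powR; rewrite ?nnegrE ?pdist_ge0 ?(ltW a0)//.
  apply: ltW; have [gD _ _ _] := set_bij_inv cg.2.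
  by apply: pdist_lt1; apply: gD; exact/KD.
- move=> w Aw; apply: (cvg_big (@mul_continuous R)) => i _.
  apply: (cvg_big (@mul_continuous R)) => j _.
  have [h1 h2] := Hg _ _ (KD _ (Aw i)) (KD _ (Aw j)).
  apply: (cvg_powR a0); last exact: cvg_pinfty_eps.
  near=> t; rewrite pdist_ge0; apply: h1; near: t; exact: nbhs_pinfty_ge.
- near=> t => w Aw; apply: FG => //; near: t; exact: nbhs_pinfty_ge.
Unshelve. all: by end_near. Qed.

End hyperbolic_diameter.

(** * Plane measure and similarities *)

Section planar_measure.
Context {R : realType}.
Local Notation C := (cplx R).
Local Notation mR := (measurableTypeR R).
Local Notation leb := (@lebesgue_measure R).
Local Notation plane := (mR * mR)%type.
Implicit Types (z w : C) (E U K : set C) (a b r s u v x y : R).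

(** Plane measure lives on pairs of real numbers, sets of complex numbers do not. *)
Definition pull E : set plane := [set p | E (pt p.1 p.2)].

(** An open set is the union of the squares with rational centre and side [2 / n]
    that it contains. *)
Lemma measurable_pull_open U : open U -> measurable (pull U).
Proof.
move=> oU; pose r n : R := n.+1%:R^-1.
pose box n (a b : rat) : set plane :=
  `]ratr a - r n, ratr a + r n[%classic `*` `]ratr b - r n, ratr b + r n[%classic.
pose A n (a b : rat) : set plane := if `[< box n a b `<=` pull U >] then box n a b else set0.
have -> : pull U = \bigcup_n \bigcup_a \bigcup_b A n a b.
  apply/seteqP; split => [[x y] Uxy|p [n _ [a _ [b _]]]]; last first.
    by rewrite /A; case: asboolP => // H /H.
  have /openP/(_ _ Uxy)[e e0 He] := oU.
  have [n ne] : exists n, r n < e / 4.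
    exists (Num.bound (e / 4)^-1); rewrite /r invf_plt ?posrE ?divr_gt0 ?ltr0n//.
    apply: lt_trans (archi_boundP _) _; last by rewrite ltr_nat.
    by rewrite invr_ge0 divr_ge0// ltW.
  have rn0 : 0 < r n by rewrite invr_gt0.
  have rat_near t : exists q : rat, `|t - ratr q| < r n.
    have /rat_in_itvoo[q] : t - r n < t + r n by lra.
    rewrite in_itv/= => qt; exists q; rewrite ltr_norml; lra.
  have [a xa] := rat_near x; have [b yb] := rat_near y.
  exists n => //; exists a => //; exists b => //; rewrite /A asboolT.
    split; rewrite /= in_itv/=.
      by move: xa; rewrite ltr_norml; lra.
    by move: yb; rewrite ltr_norml; lra.
  move=> [x' y'] []; rewrite /= !in_itv/= => x'a y'b; apply: He => /=.
  rewrite /cball/mkset ptB; apply: le_lt_trans (modulus_le_ReIm _) _; rewrite /=.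
  have h1 : `|x' - x| < 2 * r n by rewrite ltr_norml; move: xa; rewrite ltr_norml; lra.
  have h2 : `|y' - y| < 2 * r n by rewrite ltr_norml; move: yb; rewrite ltr_norml; lra.
  lra.
apply: bigcupT_measurable => n; apply: bigcupT_measurable_rat => a.
apply: bigcupT_measurable_rat => b; rewrite /A; case: ifP => _; last exact: measurable0.
by apply: measurableX; exact: measurable_itv.
Qed.

Lemma measurable_pull_closed E : closed E -> measurable (pull E).
Proof.
move=> /closed_openC/measurable_pull_open/measurableC.
by rewrite [X in measurable X -> _](_ : _ = pull (~` ~` E))// setCK.
Qed.

Lemma measurable_pull_compact K : compact K -> measurable (pull K).
Proof. by move=> cK; apply: measurable_pull_closed; exact: (compact_closed _ cK). Qed.

Lemma measurable_pull_continuous E (f : C -> R) : measurable (pull E) ->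
  (forall z, E z -> {for z, continuous f}) ->
  measurable_fun (pull E) (fun p : plane => f (pt p.1 p.2)).
Proof.
move=> mE cf; apply: (measurability _ (RGenOInfty.measurableE R)).
move=> _ [_ [x ->] <-].
pose U := [set z | x < f z]°.
rewrite [X in measurable X](_ : _ = pull E `&` pull U).
  by apply: measurableI => //; apply: measurable_pull_open; exact: open_interior.
apply/seteqP; split => -[a b] [Eab]; rewrite /= ?in_itv/= ?andbT => H; split => //.
  have cfa : f w @[w --> nbhs (pt a b)] --> f (pt a b) := cf _ Eab.
  exact: (cvgr_gt _ cfa _ H).
exact: (interior_subset H).
Qed.

Local Open Scope ereal_scope.

(** Lebesgue measure is determined by its values on intervals, and on these it
    agrees with [`|u|] times its image under the affine map. *)
Lemma integral_affine (f : mR -> \bar R) (u b : R) : u != 0%R ->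
  measurable_fun [set: mR] f -> (forall x, 0 <= f x) ->
  \int[leb]_x f x = `|u|%:E * \int[leb]_x f (u * x + b)%R.
Proof.
move=> u0 mf f0.
pose phi : mR -> mR := fun x : mR => (u * x + b)%R.
have mphi : measurable_fun [set: mR] phi.
  by apply: measurable_funD => //; exact: measurable_funM.
have [pm pmE] : exists pm : {measure set mR -> \bar R},
    (pm : set mR -> \bar R) = pushforward leb phi.
  by exists (measure_function_pushforward__canonical__measure_function_Measure leb mphi).
pose k : {nonneg R} := NngNum (normr_ge0 u).
pose m := mscale k pm.
have E (A : set mR) : measurable A -> leb A = m A.
  apply: lebesgue_measure_unique => _ [[x y] _ <-].
  change (leb `]x, y] = `|u|%:E * pm `]x, y]%classic); rewrite pmE /pushforward.
  have [un|up] := ltP u 0%R.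
    have -> : phi @^-1` `]x, y] = `[((y - b) / u)%R, ((x - b) / u)%R[%classic.
      apply/seteqP; split => t; rewrite /= !in_itv/= /phi ler_ndivrMr// ltr_ndivlMr//;
        rewrite (mulrC t); lra.
    rewrite !lebesgue_measure_itv/= !lte_fin ltr_nM2r ?invr_lt0// ltrD2r.
    case: ifP => _; last by rewrite mule0.
    by rewrite -!EFinB -EFinM ltr0_norm//; congr EFin; field; rewrite lt_eqF.
  have {}up : (0 < u)%R by rewrite lt_def u0.
  have -> : phi @^-1` `]x, y] = `]((x - b) / u)%R, ((y - b) / u)%R]%classic.
    apply/seteqP; split => t; rewrite /= !in_itv/= /phi ler_pdivlMr// ltr_pdivrMr//;
      rewrite (mulrC t); lra.
  rewrite !lebesgue_measure_itv/= !lte_fin ltr_pM2r ?invr_gt0// ltrD2r.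
  case: ifP => _; last by rewrite mule0.
  by rewrite -!EFinB -EFinM gtr0_norm//; congr EFin; field; rewrite gt_eqF.
rewrite (eq_measure_integral m) => [|A mA _]; last exact: E.
rewrite ge0_integral_mscale//= pmE ge0_integral_pushforward//.
Qed.

Local Notation area := (leb \x leb).

Let measurable_lin (a b : R) : measurable_fun [set: plane] (fun p : plane => a * p.1 + b * p.2)%R.
Proof. by apply: measurable_funD; apply: measurable_funM. Qed.

Lemma integral_shear1 (F : plane -> \bar R) (c d : R) : c != 0%R ->
  measurable_fun [set: plane] F -> (forall p, 0 <= F p) ->
  \int[area]_p F p = `|c|%:E * \int[area]_p F (c * p.1 + d * p.2, p.2)%R.
Proof.
move=> c0 mF F0; pose G (p : plane) := F (c * p.1 + d * p.2, p.2)%R.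
have mG : measurable_fun [set: plane] G.
  by apply: measurableT_comp => //; apply: measurable_fun_pair.
have G0 p : 0 <= G p by exact: F0.
rewrite -/(G _) (fubini_tonelli2 F mF F0) (fubini_tonelli2 G mG G0).
rewrite -ge0_integralZl_EFin//; last 2 first.
- by move=> y _; apply: integral_ge0.
- exact: measurable_fun_fubini_tonelli_G.
apply: eq_integral => y _; rewrite /fubini_G /G/=.
apply: (@integral_affine (fun x => F (x, y)) c (d * y)%R) => //.
exact: measurable_fun_pair1.
Qed.

Lemma integral_shear2 (F : plane -> \bar R) (c d : R) : c != 0%R ->
  measurable_fun [set: plane] F -> (forall p, 0 <= F p) ->
  \int[area]_p F p = `|c|%:E * \int[area]_p F (p.1, d * p.1 + c * p.2)%R.
Proof.
move=> c0 mF F0; pose G (p : plane) := F (p.1, d * p.1 + c * p.2)%R.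
have mG : measurable_fun [set: plane] G.
  by apply: measurableT_comp => //; apply: measurable_fun_pair.
have G0 p : 0 <= G p by exact: F0.
rewrite -/(G _) (fubini_tonelli1 F mF F0) (fubini_tonelli1 G mG G0).
rewrite -ge0_integralZl_EFin//; last 2 first.
- by move=> y _; apply: integral_ge0.
- exact: measurable_fun_fubini_tonelli_F.
apply: eq_integral => x _; rewrite /fubini_F /G/=.
under [in RHS]eq_integral do rewrite addrC.
apply: (@integral_affine (fun y => F (x, y)) c (d * x)%R) => //.
exact: measurable_fun_pair2.
Qed.

Let rotation_neq0 (F : plane -> \bar R) (u v : R) : u != 0%R ->
  measurable_fun [set: plane] F -> (forall p, 0 <= F p) ->
  \int[area]_p F p = (u ^+ 2 + v ^+ 2)%:E *
    \int[area]_p F (u * p.1 + - v * p.2, v * p.1 + u * p.2)%R.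
Proof.
move=> u0 mF F0; have uv : (0 < u ^+ 2 + v ^+ 2)%R.
  by rewrite ltr_pwDl ?sqr_ge0// lt_def sqr_ge0 sqrf_eq0 u0.
have c0 : ((u ^+ 2 + v ^+ 2) / u != 0)%R by rewrite mulf_neq0 ?invr_neq0// gt_eqF.
rewrite (integral_shear1 (- v / u)%R c0 mF F0).
rewrite (integral_shear2 v u0); last 2 first.
- by apply: measurableT_comp => //; apply: measurable_fun_pair.
- by move=> p; exact: F0.
rewrite muleA -EFinM -normrM mulfVK// (gtr0_norm uv); congr (_ * _).
apply: eq_integral => p _ /=; congr (F (_, _)); by field.
Qed.

(** The similarity [w |-> (u + i v) w] is a composition of two affine changes of
    one real variable, so Tonelli's theorem computes its effect on area. For
    [u = 0] it is the composition of two similarities with non-zero real part,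
    as [i v = (v / 2) (1 + i) (1 + i)]. *)
Lemma integral_rotation (F : plane -> \bar R) (u v : R) : (u != 0 \/ v != 0)%R ->
  measurable_fun [set: plane] F -> (forall p, 0 <= F p) ->
  \int[area]_p F p = (u ^+ 2 + v ^+ 2)%:E *
    \int[area]_p F (u * p.1 + - v * p.2, v * p.1 + u * p.2)%R.
Proof.
move=> uv mF F0; have [u0|] := eqVneq u 0%R; last by move=> u0; exact: rotation_neq0.
have v0 : v != 0%R by case: uv => //; rewrite u0 eqxx.
have v2 : (v / 2)%R != 0%R by rewrite mulf_neq0.
rewrite (rotation_neq0 (v / 2)%R v2 mF F0) (rotation_neq0 1%R (oner_neq0 _)); last 2 first.
- by apply: measurableT_comp => //; apply: measurable_fun_pair.
- by move=> p; exact: F0.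
rewrite muleA -EFinM u0; congr (_%:E * _); first by field.
by apply: eq_integral => p _ /=; congr (F (_, _)); field.
Qed.

End planar_measure.

(** * Area of squares and of their images under similarities *)

Section grid.
Context {R : realType}.
Local Notation C := (cplx R).
Local Notation mR := (measurableTypeR R).
Local Notation leb := (@lebesgue_measure R).
Local Notation plane := (mR * mR)%type.
Local Notation area := (leb \x leb)%E.
Local Notation re := (@complex.Re R).
Local Notation im := (@complex.Im R).
Implicit Types (z w c a b : C) (E U K : set C) (r s u v x y e d : R) (p : plane).

Definition box x y s : set plane := `[x, x + s[%classic `*` `[y, y + s[%classic.

Lemma measurable_box x y s : measurable (box x y s).
Proof. by apply: measurableX; exact: measurable_itv. Qed.

Lemma area_box x y s : 0 <= s -> area (box x y s) = (s ^+ 2)%:E.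
Proof.
move=> s0; rewrite product_measure1E; try exact: measurable_itv.
rewrite /= !lebesgue_measure_itv/= !lte_fin !ltrDl.
have [s1|s1] := ltP 0 s; last first.
  have -> : s = 0 by apply/eqP; rewrite eq_le s0 s1.
  by rewrite expr0n mule0.
by rewrite -!EFinD -EFinM; congr (_%:E); ring.
Qed.

(** The preimage of a square under the similarity [w |-> b w + a]. *)
Definition similar_box (b a : C) x y s : set plane :=
  [set p | box x y s (re (b * pt p.1 p.2 + a), im (b * pt p.1 p.2 + a))].

Lemma similar_boxE b a x y s : similar_box b a x y s =
  [set p | box (x - re a) (y - im a) s
     (re b * p.1 + - im b * p.2, im b * p.1 + re b * p.2)].
Proof.
apply/seteqP; split => p; rewrite /similar_box /box /= !in_itv/= reD imD reM imM /=;
  move=> [/andP[h1 h2] /andP[h3 h4]]; split; apply/andP; split; lra.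
Qed.

Lemma measurable_similar_box b a x y s : measurable (similar_box b a x y s).
Proof.
rewrite similar_boxE -[X in measurable X]setTI.
have m : measurable_fun [set: plane] (fun p : plane =>
    (re b * p.1 + - im b * p.2, im b * p.1 + re b * p.2) : plane).
  by apply: measurable_fun_pair; apply: measurable_funD; apply: measurable_funM.
by apply: (m measurableT); exact: measurable_box.
Qed.

Lemma area_similar_box b a x y s : b != 0 -> 0 <= s ->
  area (similar_box b a x y s) = ((s / modulus b) ^+ 2)%:E.
Proof.
move=> b0 s0; have m0 : 0 < modulus b by rewrite modulus_gt0.
set B := box (x - re a) (y - im a) s.
have mB : measurable B by exact: measurable_box.
have uv : re b != 0 \/ im b != 0.
  apply/orP; rewrite -negb_and; apply: contra b0 => /andP[/eqP b1 /eqP b2].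
  by rewrite -modulus_eq0 -sqrf_eq0 sqr_modulus b1 b2 expr0n addr0.
have := @integral_rotation R (fun p => (\1_B p)%:E) (re b) (im b) uv.
rewrite -sqr_modulus => H.
have mS := measurable_similar_box b a x y s.
have -> : area (similar_box b a x y s) = (\int[area]_p (\1_(similar_box b a x y s) p)%:E)%E.
  by rewrite integral_indic// setIT.
have {}H : (s ^+ 2)%:E = ((modulus b ^+ 2)%:E *
    \int[area]_p (\1_(similar_box b a x y s) p)%:E)%E.
  rewrite -(area_box (x - re a) (y - im a) s0) -/B -[X in area X]setIT.
  rewrite -integral_indic// H; last 2 first.
  - by apply/measurable_EFinP; exact: measurable_indic.
  - by move=> p; rewrite lee_fin.
  by congr (_ * _)%E; apply: eq_integral => p _; rewrite similar_boxE !indicE.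
have m2 : modulus b ^+ 2 != 0 by rewrite expf_neq0// gt_eqF.
by rewrite exprMn exprVn mulrC EFinM H muleA -EFinM mulVf// mul1e.
Qed.

End grid.

(** * Area of the image of a compact set *)

Section compact_functions.
Context {R : realType}.
Local Notation C := (cplx R).
Implicit Types (z w : C) (K : set C) (u : C -> R) (e d P : R).

Lemma compact_unif_continuous K u : compact K ->
  (forall z, K z -> {for z, continuous u}) -> forall e, 0 < e ->
  exists2 d, 0 < d & forall z w, K z -> modulus (w - z) < d -> `|u w - u z| < e.
Proof.
move=> cK cu e e0.
have [|d d0 Hd] := @compact_uniform _ K (fun d q => forall w,
    modulus (w - q) < d -> `|u w - u q| < e) cK.
  move=> p Kp; have e2 : 0 < e / 2 by rewrite divr_gt0.
  have /cvgrPdist_lt/(_ _ e2)/nbhs_cballP[v v0 Hv] := cu _ Kp.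
  exists (v / 2) => [|d q d0 dv qv w wq]; first by rewrite divr_gt0.
  have wv : modulus (w - p) < v.
    have := modulusD (w - q) (q - p); rewrite addrA subrK; lra.
  have qv' : modulus (q - p) < v by lra.
  have := Hv _ wv; have := Hv _ qv'; rewrite /= !ltr_norml; lra.
by exists d => // z w Kz; exact: Hd.
Qed.

Lemma compact_bounded_fun K u : compact K ->
  (forall z, K z -> {for z, continuous u}) ->
  exists2 P, 0 <= P & forall z, K z -> `|u z| <= P.
Proof.
move=> cK cu; have [|d d0 Hd] := @compact_uniform _ K (fun d q => `|u q| <= d^-1) cK.
  move=> p Kp; have /cvgrPdist_lt/(_ _ ltr01)/nbhs_cballP[v v0 Hv] := cu _ Kp.
  have D0 : 0 < `|u p| + 1 by rewrite ltr_pwDr.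
  exists (Num.min v (`|u p| + 1)^-1) => [|d q d0]; first by rewrite lt_min v0 invr_gt0.
  rewrite !lt_min => /andP[dv dD] /andP[qv _].
  apply: (@le_trans _ _ (`|u p| + 1)).
    have := Hv _ qv; rewrite /= => H; have := ler_normD (u q - u p) (u p).
    by rewrite subrK distrC; move: H; set t := `|_ - _|; lra.
  by rewrite -[X in X <= _]invrK lef_pV2 ?posrE ?invr_gt0// ltW.
by exists d^-1 => [|z /Hd//]; rewrite invr_ge0 ltW.
Qed.

End compact_functions.

Section estimates.
Context {R : realType}.
Implicit Types (r t e P : R).

(** Together with [grid_error]: the constants of the comparison of the two sums of
    [area_step] depend on the bound [P] only. *)
Lemma grid_bound r t e P : 0 <= r -> 0 <= t -> r <= P -> t <= P -> 0 < e -> e <= 1 ->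
  (r + e) * (t + 4 * e) ^+ 2 <= (P + 1) * (P + 4) ^+ 2.
Proof.
move=> r0 t0 rP tP e0 e1; apply: ler_pM; rewrite ?sqr_ge0//; [lra|lra|].
by rewrite lerXn2r ?nnegrE; lra.
Qed.

Lemma grid_error r r' t t' e P : 0 <= t' -> 0 <= t -> 0 <= r -> 0 <= r' ->
  t <= P -> r' <= P -> t' - t < e -> r - r' < e -> 0 < e -> e <= 1 ->
  (r + e) * (t' + 4 * e) ^+ 2 <=
    r' * t ^+ 2 + (P * (10 * P + 25) + 2 * (P + 5) ^+ 2) * e.
Proof.
move=> t'0 t0 r0 r'0 tP rP tt rr e0 e1.
apply: (@le_trans _ _ ((r' + 2 * e) * (t + 5 * e) ^+ 2)).
  apply: ler_pM; rewrite ?sqr_ge0//; [lra|lra|].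
  by rewrite lerXn2r ?nnegrE; lra.
have -> : (r' + 2 * e) * (t + 5 * e) ^+ 2 = r' * t ^+ 2 +
    (r' * (10 * t + 25 * e) + 2 * (t + 5 * e) ^+ 2) * e by ring.
rewrite lerD2l ler_pM2r//; apply: lerD.
  by apply: ler_pM => //; lra.
by rewrite ler_pM2l// lerXn2r ?nnegrE; lra.
Qed.

End estimates.

Section mesh.
Context {R : realType}.
Implicit Types (x : R).
Variables (N dl : R) (m : nat).
Hypothesis dl0 : 0 < dl.
Hypothesis mdl : m%:R * dl = 2 * N.

Definition mesh_point (i : 'I_m) : R := - N + i%:R * dl.

Lemma mesh_cover x : `|x| < N -> exists i, mesh_point i <= x < mesh_point i + dl.
Proof.
rewrite ltr_norml => /andP[x1 x2].
have y0 : 0 <= (x + N) / dl by rewrite divr_ge0 ?ltW//; lra.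
have /andP[t1 t2] := truncn_itv y0; set t := Num.truncn _ in t1 t2.
have tm : (t < m)%N.
  rewrite -(ltr_nat R); apply: le_lt_trans t1 _.
  by rewrite ltr_pdivrMr// mdl; lra.
exists (Ordinal tm); rewrite /mesh_point/=.
move: t1 t2; rewrite ler_pdivlMr// ltr_pdivrMr// -addn1 natrD mulrDl mul1r; lra.
Qed.

Lemma mesh_unique x (i j : 'I_m) : mesh_point i <= x < mesh_point i + dl -> mesh_point j <= x < mesh_point j + dl -> i = j.
Proof.
move=> /andP[i1 i2] /andP[j1 j2]; apply/val_inj/eqP; rewrite eqn_leq.
have H (a b : 'I_m) : mesh_point a < mesh_point b + dl -> (a <= b)%N.
  rewrite /mesh_point => lt_ab; have : a%:R * dl < b.+1%:R * dl.
    by rewrite -addn1 natrD mulrDl mul1r; lra.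
  by rewrite ltr_pM2r// ltr_nat ltnS.
by rewrite !H//; lra.
Qed.

End mesh.

Section area_inequality.
Context {R : realType}.
Local Notation C := (cplx R).
Local Notation mR := (measurableTypeR R).
Local Notation leb := (@lebesgue_measure R).
Local Notation plane := (mR * mR)%type.
Local Notation area := (leb \x leb)%E.
Local Notation re := (@complex.Re R).
Local Notation im := (@complex.Im R).
Implicit Types (z w c : C) (s x y e d : R) (p : plane).

Variables (K : set C) (f J : C -> C) (rho : C -> R).
Hypothesis cK : compact K.
Hypothesis J_neq0 : forall z, K z -> J z != 0.
Hypothesis f_strict : forall e, 0 < e -> exists2 d, 0 < d & forall z c, K z -> K c ->
  modulus (z - c) < d -> modulus (f z - f c - J c * (z - c)) <= e * modulus (z - c).
Hypothesis J_cont : forall z, K z -> {for z, continuous (fun w => modulus (J w))}.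
Hypothesis rho_cont : forall z, K z -> {for z, continuous (fun w => rho (f w))}.
Hypothesis rho_ge0 : forall z, K z -> 0 <= rho (f z).
Hypothesis m_fK : measurable (pull (f @` K)).
Hypothesis m_rho : measurable_fun (pull (f @` K)) (fun p : plane => rho (pt p.1 p.2)).

Let h z := rho (f z) * modulus (J z) ^+ 2.
Let V s : set C := [set z | exists2 c, K c & modulus (z - c) < s].
Let Kp := pull K.

Let mK : measurable Kp. Proof. exact: measurable_pull_compact. Qed.

Lemma open_thickening s : open (V s).
Proof.
apply/openP => z [c Kc zc]; exists (s - modulus (z - c)); first by rewrite subr_gt0.
move=> w wz; exists c => //; move: wz; rewrite /cball/=.
have := modulusD (w - z) (z - c); rewrite addrA subrK; lra.
Qed.

(** The comparison on a grid of mesh [dl]. A square that meets [K] contains a point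
    [c q] of [K]. The image of its part in [K] is covered by [S q], the image of a
    slightly larger square under the affine map tangent to [f] at [c q], on which
    [rho] is close to [rho (f (c q))]. Comparing the total of the bounds with the
    integral over [K] costs a relative error of order [e], and the part of the
    squares outside [K], contained in a thickening of [K]. *)
Section step.
Variables (e d eta P N dl : R) (m : nat).
Hypotheses (e0 : 0 < e) (e1 : e <= 1) (P0 : 0 <= P) (dl0 : 0 < dl).
Hypothesis mdl : m%:R * dl = 2 * N.
Hypotheses (dl_d : 2 * dl <= d) (dl_eta : 2 * dl <= eta).
Hypothesis K_N : forall z, K z -> modulus z < N.
Hypothesis f_e : forall z c, K z -> K c -> modulus (z - c) < d ->
  modulus (f z - f c - J c * (z - c)) <= e * modulus (z - c).
Hypothesis J_e : forall z w, K z -> modulus (w - z) < d ->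
  `|modulus (J w) - modulus (J z)| < e.
Hypothesis rho_e : forall z w, K z -> modulus (w - z) < d ->
  `|rho (f w) - rho (f z)| < e.
Hypothesis J_P : forall z, K z -> `|modulus (J z)| <= P.
Hypothesis rho_P : forall z, K z -> `|rho (f z)| <= P.

Let I := ('I_m * 'I_m)%type.
Let X := @mesh_point R N dl m.
Let Q (q : I) : set plane := box (X q.1) (X q.2) dl.
Let meets (q : I) := exists2 z, K z & Q q (re z, im z).
Let c (q : I) : C := xget 0 [set z | K z /\ Q q (re z, im z)].
(* Squares that miss [K] must not contribute: hence the value [0]. *)
Let a (q : I) : R := if `[< meets q >] then rho (f (c q)) + e else 0.
Let j (q : I) : R := modulus (J (c q)).
(* Two points of a square are at distance less than [2 * dl], so the error in [f]
   is at most [2 * e * dl], which the inverse of the tangent map divides by [j q]. *)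
Let g (q : I) : R := 2 * e * dl / j q.
Let S (q : I) : set plane := similar_box (J (c q))^-1 (c q - (J (c q))^-1 * f (c q))
  (X q.1 - g q) (X q.2 - g q) (dl + 2 * g q).

Let cP q : meets q -> K (c q) /\ Q q (re (c q), im (c q)).
Proof. by move=> [z Kz Qz]; apply: (@xgetPex _ 0 [set z | K z /\ _]); exists z. Qed.

Let Q_cover z : modulus z < N -> exists q, Q q (re z, im z).
Proof.
move=> zN; have [i hi] := mesh_cover dl0 mdl (le_lt_trans (abs_Re_le z) zN).
have [k hk] := mesh_cover dl0 mdl (le_lt_trans (abs_Im_le z) zN).
by exists (i, k); split; rewrite /= in_itv.
Qed.

Let Q_unique p q q' : Q q p -> Q q' p -> q = q'.
Proof.
case: q q' => [i k] [i' k'] [/=]; rewrite !in_itv/= => h1 h2 [/=].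
rewrite !in_itv/= => h3 h4.
by rewrite (mesh_unique dl0 h1 h3) (mesh_unique dl0 h2 h4).
Qed.

Let Q_near z w q : Q q (re z, im z) -> Q q (re w, im w) -> modulus (z - w) < 2 * dl.
Proof.
move=> [/=]; rewrite !in_itv/= => h1 h2 [/=]; rewrite !in_itv/= => h3 h4.
apply: le_lt_trans (modulus_le_ReIm _) _; rewrite !(reD, imD, reN, imN).
have h5 : `|re z - re w| < dl by rewrite ltr_norml; lra.
have h6 : `|im z - im w| < dl by rewrite ltr_norml; lra.
lra.
Qed.

Let a_ge0 q : 0 <= a q.
Proof.
rewrite /a; case: asboolP => // /cP[Kc _].
by rewrite addr_ge0 ?rho_ge0// ltW.
Qed.

Let j_gt0 q : meets q -> 0 < j q.
Proof. by move=> /cP[Kc _]; rewrite /j modulus_gt0; exact: J_neq0. Qed.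

(** By strict differentiability [f] maps the part of [K] in a square of the grid
    into a slightly enlarged image of that square under a similarity. *)
Let image_S q z : K z -> Q q (re z, im z) -> S q (re (f z), im (f z)).
Proof.
move=> Kz Qz; have mq : meets q by exists z.
have [Kc Qc] := cP mq; have j0 := j_gt0 mq; have zc := Q_near Qz Qc.
have J0 : J (c q) != 0 by exact: J_neq0.
set b := (J (c q))^-1; pose err := b * (f z - f (c q) - J (c q) * (z - c q)).
have errE : b * f z + (c q - b * f (c q)) = z + err.
  by rewrite /err /b; field.
have err_le : modulus err <= g q.
  rewrite /err modulusM modulusV -/(j q) mulrC ler_pdivrMr//.
  have -> : g q * j q = 2 * e * dl by rewrite /g mulfVK// gt_eqF.
  apply: le_trans (f_e Kz Kc (lt_le_trans zc dl_d)) _.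
  by rewrite [2 * e]mulrC -mulrA ler_pM2l// ltW.
have ptE w : pt (re w) (im w) = w by case: w.
rewrite /S /similar_box /mkset /= ptE errE reD imD.
have := le_trans (abs_Re_le err) err_le; rewrite ler_norml => r1.
have := le_trans (abs_Im_le err) err_le; rewrite ler_norml => i1.
move: Qz => [/=]; rewrite !in_itv/= => h1 h2.
by split; rewrite /= in_itv/=; lra.
Qed.

Let area_S q : meets q -> area (S q) = ((dl * (j q + 4 * e)) ^+ 2)%:E.
Proof.
move=> mq; have j0 := j_gt0 mq; have g0 : 0 <= g q.
  by rewrite divr_ge0 ?mulr_ge0// ltW.
rewrite area_similar_box; last 2 first.
- by rewrite invr_neq0// J_neq0//; have [] := cP mq.
- by apply: addr_ge0; [exact: ltW|exact: mulr_ge0].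
rewrite modulusV -/(j q) invrK; congr ((_ ^+ 2)%:E).
by rewrite /g; field; rewrite gt_eqF.
Qed.

Let b (q : I) : R := a q * (j q + 4 * e) ^+ 2.

Let j_ge0 q : 0 <= j q. Proof. exact: modulus_ge0. Qed.

Let b_ge0 q : 0 <= b q.
Proof. by rewrite mulr_ge0 ?a_ge0// sqr_ge0. Qed.

Let M : R := (P + 1) * (P + 4) ^+ 2.
Let cst : R := P * (10 * P + 25) + 2 * (P + 5) ^+ 2.

Let b_le_M q : b q <= M.
Proof.
rewrite /b /a; case: asboolP => [mq|_]; last first.
  by rewrite mul0r mulr_ge0 ?sqr_ge0// addr_ge0.
have [Kc _] := cP mq; have r1 := rho_P Kc; have r2 := ler_norm (rho (f (c q))).
have j1 := J_P Kc; have j2 := ler_norm (modulus (J (c q))).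
by apply: grid_bound; rewrite ?rho_ge0 ?modulus_ge0 ?(le_trans r2) ?(le_trans j2).
Qed.

Let b_le_h q z : K z -> Q q (re z, im z) -> b q <= h z + cst * e.
Proof.
move=> Kz Qz; have mq : meets q by exists z.
have [Kc Qc] := cP mq; have cz := lt_le_trans (Q_near Qc Qz) dl_d.
rewrite /b /a asboolT// /h.
have := rho_e Kz cz; have := J_e Kz cz; rewrite !ltr_norml -/(j q).
have := rho_P Kz; have := J_P Kz; rewrite !ler_norml.
have := rho_ge0 Kz; have := rho_ge0 Kc; have := modulus_ge0 (J z); have := j_ge0 q.
move=> h1 h2 h3 h4 /andP[_ h5] /andP[_ h6] /andP[_ h7] /andP[_ h8].
exact: grid_error.
Qed.

Local Open Scope ereal_scope.

Let sum_indic (w : I -> R) (T : I -> set plane) : (forall q, 0 <= w q)%R ->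
  (forall q, measurable (T q)) ->
  [/\ measurable_fun [set: plane] (fun p => \sum_q (w q)%:E * (\1_(T q) p)%:E),
    forall p, 0 <= \sum_q (w q)%:E * (\1_(T q) p)%:E &
    \int[area]_p (\sum_q (w q)%:E * (\1_(T q) p)%:E) = \sum_q (w q)%:E * area (T q)].
Proof.
move=> w0 mT; have mI q : measurable_fun [set: plane] (fun p => (w q)%:E * (\1_(T q) p)%:E).
  by apply: measurable_funeM; apply/measurable_EFinP; exact: measurable_indic.
have I0 q p : 0 <= (w q)%:E * (\1_(T q) p)%:E by rewrite mule_ge0// lee_fin.
split; [exact: emeasurable_sum|by move=> p; exact: sume_ge0|].
rewrite ge0_integral_sum//; apply: eq_bigr => q _.
rewrite ge0_integralZl_EFin//; last first.
  by apply/measurable_EFinP; exact: measurable_indic.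
by rewrite integral_indic// setIT.
Qed.

Let sum_at (w : I -> R) (T : I -> set plane) p q : (forall q, 0 <= w q)%R -> T q p ->
  (w q)%:E <= \sum_q (w q)%:E * (\1_(T q) p)%:E.
Proof.
move=> w0 Tp; rewrite (bigD1 q)//= [in leRHS]indicE mem_set// mule1 leeDl//.
by apply: sume_ge0 => q' _; rewrite mule_ge0// lee_fin.
Qed.

Let mV : measurable (pull (V eta `\` K)).
Proof.
by apply: measurableD; [apply: measurable_pull_open; exact: open_thickening|exact: mK].
Qed.

(** Both integrands are compared pointwise with step functions carried by the
    similar squares [S q] and by the squares [Q q]; the integrals of these step
    functions agree up to the factor between [j q ^+ 2] and [(j q + 4 * e) ^+ 2]. *)
Lemma area_step : measurable_fun Kp (fun p : plane => h (pt p.1 p.2)) ->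
  \int[area]_(p in pull (f @` K)) (rho (pt p.1 p.2))%:E <=
  \int[area]_(p in Kp) (h (pt p.1 p.2))%:E + (cst * e)%:E * area Kp +
  M%:E * area (pull (V eta `\` K)).
Proof.
move=> mh; have mS q : measurable (S q) by exact: measurable_similar_box.
have mQ q : measurable (Q q) by exact: measurable_box.
have [mF1 F10 EF1] := sum_indic a_ge0 mS; have [mF2 F20 EF2] := sum_indic b_ge0 mQ.
have ptE z : pt (re z) (im z) = z by case: z.
have cst0 : (0 <= cst * e)%R.
  by rewrite mulr_ge0 ?(ltW e0)// addr_ge0 ?mulr_ge0 ?sqr_ge0// addr_ge0 ?mulr_ge0.
have M0 : (0 <= M)%R by rewrite mulr_ge0 ?sqr_ge0// addr_ge0.
have h0 z : K z -> (0 <= h z)%R by move=> Kz; rewrite mulr_ge0 ?sqr_ge0// rho_ge0.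
apply: (@le_trans _ _ (\sum_q (a q)%:E * area (S q))).
  rewrite -EF1.
  apply: (@le_trans _ _ (\int[area]_(p in pull (f @` K)) (\sum_q (a q)%:E * (\1_(S q) p)%:E))).
    apply: ge0_le_integral => //.
    - by move=> p [z Kz <-]; rewrite lee_fin rho_ge0.
    - exact/measurable_EFinP.
    - exact: measurable_funTS.
    - move=> [x y] [z Kz fz]; rewrite -fz.
      have [q Qq] := Q_cover (K_N Kz); have mq : meets q by exists z.
      have Sq : S q (x, y).
        by have := image_S Kz Qq; rewrite fz.
      apply: le_trans (sum_at a_ge0 Sq); rewrite lee_fin /a asboolT//.
      have [Kc Qc] := cP mq; have := rho_e Kc (lt_le_trans (Q_near Qq Qc) dl_d).
      by rewrite ltr_norml => /andP[_ H]; rewrite -lerBlDl ltW.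
  exact: ge0_subset_integral.
have -> : \sum_q (a q)%:E * area (S q) = \sum_q (b q)%:E * area (Q q).
  apply: eq_bigr => q _; rewrite (area_box _ _ (ltW dl0)) /b.
  have [mq|nq] := pselect (meets q); last by rewrite /a asboolF// mul0r !mul0e.
  by rewrite (area_S mq) -!EFinM; congr EFin; ring.
rewrite -EF2.
pose G1 := (fun p : plane => (h (pt p.1 p.2) + cst * e)%:E) \_ Kp.
pose G2 p := M%:E * (\1_(pull (V eta `\` K)) p)%:E.
have G10 p : 0 <= G1 p.
  rewrite /G1 patchE; case: ifPn => // /set_mem Kp'; rewrite lee_fin addr_ge0//.
  exact: h0.
have G20 p : 0 <= G2 p by rewrite mule_ge0// lee_fin.
have mG1 : measurable_fun [set: plane] G1.
  apply: (measurable_restrictT _ mK).1.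
  by apply/measurable_EFinP; apply: measurable_funD.
have mG2 : measurable_fun [set: plane] G2.
  by apply: measurable_funeM; apply/measurable_EFinP; exact: measurable_indic.
apply: (@le_trans _ _ (\int[area]_p (G1 p + G2 p))).
  apply: ge0_le_integral => //; first exact: emeasurable_funD.
  move=> p _; have [[q Qq]|nq] := pselect (exists q, Q q p); last first.
    rewrite big1 ?adde_ge0// => q _; rewrite indicE memNset ?mule0//.
    by move=> Qq; apply: nq; exists q.
  rewrite (bigD1 q)//= indicE mem_set// mule1 big1 ?adde0; last first.
    move=> q' q'q; rewrite indicE memNset ?mule0// => Qq'.
    by move: q'q; rewrite (Q_unique Qq' Qq) eqxx.
  have [Kp'|nK] := pselect (Kp p).
    apply: le_trans (leeDl _ (G20 p)); rewrite /G1 patchE mem_set// lee_fin.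
    by apply: b_le_h => //; case: p Qq {Kp'}.
  apply: le_trans (leeDr _ (G10 p)); rewrite /G2.
  have [mq|nm] := pselect (meets q).
    have [Kc Qc] := cP mq; rewrite indicE mem_set ?mule1 ?lee_fin//.
    split => //; exists (c q) => //; apply: lt_le_trans dl_eta.
    by apply: (@Q_near _ _ q) => //; case: p Qq {nK}.
  by rewrite /b /a asboolF// mul0r mule_ge0// lee_fin.
rewrite ge0_integralD// leeD//.
  rewrite -integral_mkcond.
  rewrite (eq_integral (fun p => (h (pt p.1 p.2))%:E + (cst * e)%:E)) => [|p _ //].
  rewrite ge0_integralD//; last 2 first.
  - by move=> p Kp'; rewrite lee_fin h0.
  - exact/measurable_EFinP.
  by rewrite integral_cst.
rewrite ge0_integralZl_EFin//; last first.
  by apply/measurable_EFinP; exact: measurable_indic.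
by rewrite integral_indic// setIT.
Qed.

End step.

Local Open Scope ereal_scope.

Let F n : set plane := pull (V n.+1%:R^-1 `\` K).

Let mF n : measurable (F n).
Proof.
by apply: measurableD; [apply: measurable_pull_open; exact: open_thickening|exact: mK].
Qed.

Let area_bounded (A : set plane) N : (0 <= N)%R -> measurable A ->
  (forall p, A p -> `|p.1| < N /\ `|p.2| < N)%R -> area A < +oo.
Proof.
move=> N0 mA AN; apply: (@le_lt_trans _ _ (area (box (- N) (- N) (2 * N)))).
  apply: le_measure; rewrite ?inE//; first exact: measurable_box.
  move=> p /AN[]; rewrite !ltr_norml => h1 h2; split; rewrite /= in_itv/=; lra.
by rewrite area_box ?ltry// mulr_ge0.
Qed.

(** [K] is the intersection of its thickenings. *)
Let area_F : area (F n) @[n --> \oo] --> 0.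
Proof.
have cu z : K z -> {for z, continuous (fun w : C => modulus w)}.
  by move=> _; exact: continuous_modulus (cdiff_continuous (cdiff_id z)).
have [N N0 KN] := compact_bounded_fun cK cu.
have F0 : \bigcap_n F n = set0.
  apply/seteqP; split => // p Fp; have [_ nK] := Fp 0%N I.
  have /closed_epsP/(_ _ nK)[r r0 Hr] := compact_closed (@norm_hausdorff _ _) cK.
  pose n := Num.bound r^-1; have [[c Kc pc] _] := Fp n I.
  apply: (Hr c) => //; rewrite modulusB; apply: lt_trans pc _.
  rewrite invf_plt ?posrE ?ltr0n//; apply: lt_trans (archi_boundP _) _.
    by rewrite invr_ge0 ltW.
  by rewrite ltr_nat.
have := @nonincreasing_cvg_mu _ _ _ area F; rewrite F0 measure0; apply => //.
- apply: (@area_bounded _ (N + 1 + 1)%R); rewrite ?addr_ge0// => p [[c Kc pc] _].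
  have H : (modulus (pt p.1 p.2) < N + 1 + 1)%R.
    have := modulusD (pt p.1 p.2 - c) c; rewrite subrK.
    have := KN _ Kc; rewrite ger0_norm ?modulus_ge0//; move: pc; rewrite invr1; lra.
  split; apply: le_lt_trans H; [exact: (abs_Re_le (pt p.1 p.2))|].
  exact: (abs_Im_le (pt p.1 p.2)).
- apply/nonincreasing_seqP => n; apply/subsetPset => p [[c Kc pc] nK]; split => //.
  by exists c => //; apply: lt_trans pc _; rewrite ltf_pV2 ?posrE// ltr_nat.
Qed.

(** In [area_step], first choose [e] for the error on [K], then a thickening with
    little area outside [K], and last the mesh. *)
Lemma area_transport_le :
  \int[area]_(p in pull (f @` K)) (rho (pt p.1 p.2))%:E <=
  \int[area]_(p in pull K) (h (pt p.1 p.2))%:E.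
Proof.
have mh : measurable_fun Kp (fun p : plane => h (pt p.1 p.2)).
  apply: measurable_pull_continuous => // z Kz.
  apply: continuousM; first exact: rho_cont.
  have -> : (fun w => modulus (J w) ^+ 2)%R = (fun w => modulus (J w) * modulus (J w))%R.
    by apply/funext => w; rewrite expr2.
  by apply: continuousM; exact: J_cont.
have cu z : K z -> {for z, continuous (fun w : C => modulus w)}.
  by move=> _; exact: continuous_modulus (cdiff_continuous (cdiff_id z)).
have [N N0 KN] := compact_bounded_fun cK cu.
have [P1 P10 J_P] := compact_bounded_fun cK J_cont.
have [P2 P20 rho_P] := compact_bounded_fun cK rho_cont.
pose P := (P1 + P2)%R; have P0 : (0 <= P)%R by rewrite addr_ge0.
pose cst : R := (P * (10 * P + 25) + 2 * (P + 5) ^+ 2)%R.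
pose M : R := ((P + 1) * (P + 4) ^+ 2)%R.
have cst0 : (0 <= cst)%R by rewrite addr_ge0 ?mulr_ge0 ?sqr_ge0// addr_ge0 ?mulr_ge0.
have M0 : (0 <= M)%R by rewrite mulr_ge0 ?sqr_ge0// addr_ge0.
have N1 z : K z -> (modulus z < N + 1)%R.
  by move=> /KN; rewrite ger0_norm ?modulus_ge0// => H; lra.
have aK : area Kp < +oo.
  apply: (@area_bounded _ (N + 1)%R) => //; first by rewrite addr_ge0.
  move=> p /N1 H; split; apply: le_lt_trans H; [exact: (abs_Re_le (pt p.1 p.2))|].
  exact: (abs_Im_le (pt p.1 p.2)).
have [A A0 EA] : exists2 A : R, (0 <= A)%R & area Kp = A%:E.
  by exists (fine (area Kp)); [exact: fine_ge0|rewrite fineK// ge0_fin_numE].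
apply/lee_addgt0Pr => t t0; have t2 : (0 < t / 2)%R by rewrite divr_gt0.
pose e := Num.min 1%R (t / 2 / (cst * A + 1))%R.
have cA : (0 < cst * A + 1)%R by rewrite ltr_wpDl// mulr_ge0.
have e0 : (0 < e)%R by rewrite lt_min ltr01 divr_gt0.
have e1 : (e <= 1)%R by rewrite ge_min lexx.
have ecA : (cst * e * A <= t / 2)%R.
  have : (e <= t / 2 / (cst * A + 1))%R by rewrite ge_min lexx orbT.
  rewrite ler_pdivlMr// => H; apply: le_trans H.
  by rewrite mulrDr mulr1 mulrAC [(cst * A * e)%R]mulrC lerDl ltW.
have tM : (0 < t / 2 / (M + 1))%R by rewrite divr_gt0// ltr_wpDl.
have [n Fn] : exists n, area (F n) < (t / 2 / (M + 1))%:E.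
  have : \forall n \near \oo, area (F n) < (t / 2 / (M + 1))%:E.
    have nb : nbhs (0 : \bar R) [set u | u < (t / 2 / (M + 1))%:E].
      by apply: open_ereal_lt'; rewrite lte_fin.
    exact: (area_F nb).
  by move=> [n _ Hn]; exists n; apply: Hn; rewrite /=.
have [d1 d10 f_e] := f_strict e0.
have [d2 d20 J_e] := compact_unif_continuous cK J_cont e0.
have [d3 d30 rho_e] := compact_unif_continuous cK rho_cont e0.
pose d := Num.min d1 (Num.min d2 d3); pose eta : R := (n.+1%:R^-1)%R.
have d0 : (0 < d)%R by rewrite !lt_min d10 d20.
have eta0 : (0 < eta)%R by rewrite invr_gt0.
pose s := Num.min d eta; have s0 : (0 < s)%R by rewrite lt_min d0.
pose m := (Num.bound (4 * (N + 1) / s)%R).+1.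
pose dl := (2 * (N + 1) / m%:R)%R.
have N10 : (0 < N + 1)%R by rewrite ltr_wpDl.
have dl0 : (0 < dl)%R by rewrite divr_gt0 ?mulr_gt0// ltr0n.
have mdl : (m%:R * dl = 2 * (N + 1))%R by rewrite mulrC mulfVK ?pnatr_eq0.
have dls : (2 * dl <= s)%R.
  rewrite /dl mulrA ler_pdivrMr ?ltr0n// [leRHS]mulrC -ler_pdivrMr//.
  have -> : (2 * (2 * (N + 1)) = 4 * (N + 1))%R by ring.
  apply: ltW; apply: lt_le_trans (archi_boundP _) _.
    by rewrite divr_ge0 ?mulr_ge0// ltW.
  by rewrite ler_nat.
have [dld dle] : (2 * dl <= d /\ 2 * dl <= eta)%R.
  by split; apply: le_trans dls _; rewrite ge_min lexx ?orbT.
have dd1 : (d <= d1)%R by rewrite ge_min lexx.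
have dd2 : (d <= d2)%R by rewrite !ge_min lexx orbT.
have dd3 : (d <= d3)%R by rewrite !ge_min lexx !orbT.
have H := @area_step e d eta P (N + 1)%R dl m e0 e1 P0 dl0 mdl dld dle N1.
apply: (le_trans (H _ _ _ _ _ mh)).
- by move=> z c Kz Kc zc; apply: f_e => //; exact: lt_le_trans zc dd1.
- by move=> z w Kz zw; apply: J_e => //; exact: lt_le_trans zw dd2.
- by move=> z w Kz zw; apply: rho_e => //; exact: lt_le_trans zw dd3.
- by move=> z /J_P Pz; apply: le_trans Pz _; rewrite lerDl.
- by move=> z /rho_P Pz; apply: le_trans Pz _; rewrite lerDr.
rewrite -addeA leeD2l// EA -EFinM -/cst -/M.
have FM : M%:E * area (F n) <= (t / 2)%:E.
  apply: (@le_trans _ _ (M%:E * (t / 2 / (M + 1))%:E)).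
    by rewrite lee_wpmul2l ?lee_fin// ltW.
  rewrite -EFinM lee_fin mulrA ler_pdivrMr ?ltr_wpDl// mulrC ler_pM2l//; lra.
have B : (cst * e * A)%:E <= (t / 2)%:E by rewrite lee_fin.
by rewrite [in leRHS](splitr t) EFinD; exact: leeD B FM.
Qed.

End area_inequality.

(** * Convergence of the hyperbolic areas *)

Section conformal_area.
Context {R : realType}.
Local Notation C := (cplx R).
Local Notation mR := (measurableTypeR R).
Local Notation leb := (@lebesgue_measure R).
Local Notation plane := (mR * mR)%type.
Local Notation area := (leb \x leb)%E.
Implicit Types (z w c : C) (U V K E : set C) (f : C -> C) (rho : C -> R).

Lemma conformal_derive_neq0 U V f z : open U -> conformal_map U V f -> U z ->
  derive1 f z != 0.
Proof.
move=> oU cf Uz; have [hf bf] := cf; have [hg _] := conformal_pinv oU cf.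
have [fV gU gf fg] := set_bij_inv bf; have := inverse_derive oU hf hg fV gf Uz.
by apply: contra_eqN => /eqP ->; rewrite mulr0 eq_sym oner_eq0.
Qed.

Lemma conformal_image_compact U V f K : open U -> conformal_map U V f -> compact K ->
  K `<=` U -> compact (f @` K).
Proof.
move=> oU [hf _] cK KU; apply: continuous_compact cK.
apply/subspace_continuousP => z Kz; apply: cvg_within_filter.
exact: cdiff_continuous (holomorphic_cdiff hf (KU _ Kz)).
Qed.

Local Open Scope ereal_scope.

Lemma conformal_area_le U V f K rho : open U -> conformal_map U V f -> compact K ->
  K `<=` U -> (forall z, V z -> {for z, continuous rho}) ->
  (forall z, V z -> 0 <= rho z)%R ->
  \int[area]_(p in pull (f @` K)) (rho (pt p.1 p.2))%:E <=
  \int[area]_(p in pull K)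
    (rho (f (pt p.1 p.2)) * modulus (derive1 f (pt p.1 p.2)) ^+ 2)%:E.
Proof.
move=> oU cf cK KU rc r0; have [hf bf] := cf; have [fV _ _ _] := set_bij_inv bf.
have cfK := conformal_image_compact oU cf cK KU.
have mfK := measurable_pull_compact cfK.
apply: area_transport_le => //.
- by move=> z /KU; exact: conformal_derive_neq0 oU cf.
- move=> e e0; have [d d0 Hd] := compact_strict_diff oU hf cK KU e0.
  exists d => // z c Kz Kc zc; apply: Hd => //.
  by rewrite subrr modulus0.
- by move=> z /KU; exact: derive1_modulus_continuous.
- move=> z /KU Uz; have cz := cdiff_continuous (holomorphic_cdiff hf Uz).
  exact: (@continuous_comp _ _ _ f rho _ cz (rc _ (fV _ Uz))).
- by move=> z /KU/fV/r0.
- apply: measurable_pull_continuous => // z [w /KU/fV Vw <-]; exact: rc.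
Qed.

(** The inequality for the inverse map gives the converse one. *)
Lemma conformal_area U V f K rho : open U -> open V -> conformal_map U V f ->
  compact K -> K `<=` U -> (forall z, V z -> {for z, continuous rho}) ->
  (forall z, V z -> 0 <= rho z)%R ->
  \int[area]_(p in pull (f @` K)) (rho (pt p.1 p.2))%:E =
  \int[area]_(p in pull K)
    (rho (f (pt p.1 p.2)) * modulus (derive1 f (pt p.1 p.2)) ^+ 2)%:E.
Proof.
move=> oU oV cf cK KU rc r0; apply/eqP; rewrite eq_le (conformal_area_le oU cf)//=.
have [hf bf] := cf; have cg := conformal_pinv oU cf; have [hg bg] := cg.
have [fV gU gf fg] := set_bij_inv bf; set g := pinv U f in cg hg bg gU gf fg.
pose h z := (rho (f z) * modulus (derive1 f z) ^+ 2)%R.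
have hc z : U z -> {for z, continuous h}.
  move=> Uz; have cz := cdiff_continuous (holomorphic_cdiff hf Uz).
  have cd := derive1_modulus_continuous oU hf Uz.
  apply: continuousM; first exact: (@continuous_comp _ _ _ f rho _ cz (rc _ (fV _ Uz))).
  have -> : (fun w => modulus (derive1 f w) ^+ 2)%R =
      (fun w => modulus (derive1 f w) * modulus (derive1 f w))%R.
    by apply/funext => w; rewrite expr2.
  exact: continuousM.
have h0 z : U z -> (0 <= h z)%R.
  by move=> Uz; rewrite mulr_ge0 ?sqr_ge0//; exact/r0/fV.
have gfK : g @` (f @` K) = K.
  apply/seteqP; split => [z [_ [w Kw <-] <-]|z Kz]; first by rewrite gf//; exact: KU.
  by exists (f z); [exists z|rewrite gf//; exact: KU].
have cfK := conformal_image_compact oU cf cK KU.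
have fKV : f @` K `<=` V by move=> _ [z /KU/fV Vz <-].
have := conformal_area_le oV cg cfK fKV hc h0; rewrite gfK => /le_trans; apply.
rewrite le_eqVlt; apply/orP; left; apply/eqP; apply: eq_integral => p /set_mem fKp.
have Vp := fKV _ fKp; congr EFin; rewrite /h fg// -mulrA -exprMn -modulusM.
have := inverse_derive oV hg hf gU fg Vp => ->.
by rewrite modulus1 expr1n mulr1.
Qed.

End conformal_area.

Section hyperbolic_area.
Context {R : realType}.
Local Notation C := (cplx R).
Local Notation mR := (measurableTypeR R).
Local Notation leb := (@lebesgue_measure R).
Local Notation plane := (mR * mR)%type.
Local Notation area := (leb \x leb)%E.
Implicit Types (z w c : C) (U V K E : set C) (f : C -> C) (t s : R).

Lemma cvg_sqr_EFin (u : nat -> R) (l : R) : u n @[n --> \oo] --> l ->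
  (u n ^+ 2)%:E @[n --> \oo] --> (l ^+ 2)%:E.
Proof.
move=> cu; apply: cvg_EFin; first by near=> n.
have -> : fine \o (fun n => (u n ^+ 2)%:E) = (fun n => u n * u n).
  by apply/funext => n; rewrite /= expr2.
by rewrite expr2; exact: cvgM.
Unshelve. all: by end_near. Qed.

(** By [hyp_densityE], the hyperbolic density of [U] when [f] maps [U] conformally
    onto the disk; for [psi t] it is the density seen from the petal at time [-t]. *)
Definition pullback_density f z : R := disk_density (f z) * modulus (derive1 f z).

Lemma pullback_density_ge0 f z : disk (f z) -> 0 <= pullback_density f z.
Proof. by move=> fz; rewrite mulr_ge0 ?modulus_ge0// ltW// disk_density_gt0. Qed.

Lemma pullback_density_continuous U f z : open U -> holomorphic_on U f -> U z ->
  disk (f z) -> {for z, continuous (pullback_density f)}.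
Proof.
move=> oU hf Uz fz; apply: continuousM; last exact: derive1_modulus_continuous hf Uz.
have cz := cdiff_continuous (holomorphic_cdiff hf Uz).
exact: (@continuous_comp _ _ _ f (@disk_density R) _ cz (disk_density_continuous fz)).
Qed.

Lemma measurable_pullback_density U f K : open U -> holomorphic_on U f -> compact K ->
  K `<=` U -> (forall z, K z -> disk (f z)) ->
  measurable_fun (pull K) (fun p : plane => (pullback_density f (pt p.1 p.2) ^+ 2)%:E).
Proof.
move=> oU hf cK KU fK; apply/measurable_EFinP; apply: measurable_funX.
apply: measurable_pull_continuous; first exact: measurable_pull_compact.
by move=> z Kz; exact: pullback_density_continuous oU hf (KU _ Kz) (fK _ Kz).
Qed.

Variables (phi : R -> C -> C) (tau : C) (D : set C).
Hypothesis sg : semigroup phi.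
Hypothesis petD : petal phi tau D.

Let psi t : C -> C := pinv D (phi t).
Let oD := petal_open petD.

Let psi_disk t z : 0 <= t -> D z -> disk (psi t z).
Proof.
move=> t0 Dz; have [_ bt] := petal_backward_conformal petD t0.
by have [h _ _ _] := set_bij_inv bt; exact/(petal_disk sg petD)/h.
Qed.

Local Open Scope ereal_scope.

Lemma hyp_area_backward t K : (0 <= t)%R -> compact K -> K `<=` D ->
  hyp_area disk (psi t @` K) =
  \int[area]_(p in pull K) (pullback_density (psi t) (pt p.1 p.2) ^+ 2)%:E.
Proof.
move=> t0 cK KD; have ct := petal_backward_conformal petD t0.
have [h _ _ _] := set_bij_inv ct.2.
transitivity (\int[area]_(p in pull (psi t @` K)) (disk_density (pt p.1 p.2) ^+ 2)%:E).
  apply: eq_integral => p /set_mem [z Kz fz]; congr (_ ^+ 2)%:E.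
  by apply: hyp_density_disk; rewrite -[(_ +i* _)%C]fz; apply: psi_disk => //; exact: KD.
rewrite (conformal_area oD oD ct cK KD (rho := fun z => disk_density z ^+ 2)%R); last 2 first.
- move=> z /(petal_disk sg petD) z1.
  have -> : (fun w : C => disk_density w ^+ 2)%R = (fun w => disk_density w * disk_density w)%R.
    by apply/funext => w; rewrite expr2.
  by apply: continuousM; exact: disk_density_continuous.
- by move=> z _; exact: sqr_ge0.
by apply: eq_integral => p _; rewrite -exprMn.
Qed.

(** The squares of the pulled back densities increase to the square of the
    hyperbolic density of [D]. Monotone convergence along the integers gives the
    limit, and monotonicity in [t] interpolates. *)
Lemma hyp_area_petal K : compact K -> K `<=` D ->
  hyp_area disk (flow phi D t @` K) @[t --> (-oo)%R] --> hyp_area D K.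
Proof.
move=> cK KD; have [g cg [Hd _]] := petal_uniformization sg petD.
have [hg bg] := cg; have [gD _ _ _] := set_bij_inv bg.
have mK := measurable_pull_compact cK.
pose A t := \int[area]_(p in pull K) (pullback_density (psi t) (pt p.1 p.2) ^+ 2)%:E.
have EA : hyp_area D K =
    \int[area]_(p in pull K) (pullback_density g (pt p.1 p.2) ^+ 2)%:E.
  apply: eq_integral => p /set_mem Kp; congr (_ ^+ 2)%:E.
  exact: hyp_densityE oD cg (KD _ Kp).
have mt t : (0 <= t)%R -> measurable_fun (pull K)
    (fun p : plane => (pullback_density (psi t) (pt p.1 p.2) ^+ 2)%:E).
  move=> t0; have [hp _] := petal_backward_conformal petD t0.
  by apply: (measurable_pullback_density oD hp cK KD) => z /KD; exact: psi_disk.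
have mg : measurable_fun (pull K)
    (fun p : plane => (pullback_density g (pt p.1 p.2) ^+ 2)%:E).
  by apply: (measurable_pullback_density oD hg cK KD) => z /KD; exact: gD.
have homo s t z : (0 <= s)%R -> (s <= t)%R -> D z ->
    (pullback_density (psi s) z ^+ 2 <= pullback_density (psi t) z ^+ 2)%R.
  move=> s0 st Dz; have t0 := le_trans s0 st.
  apply: lerXn2r; rewrite ?nnegrE.
  - exact: pullback_density_ge0 (psi_disk s0 Dz).
  - exact: pullback_density_ge0 (psi_disk t0 Dz).
  - exact: (backward_density_homo sg petD s0 st Dz).
have le_g t : (0 <= t)%R -> A t <= hyp_area D K.
  move=> t0; rewrite EA; apply: ge0_le_integral.
  - exact: mK.
  - by move=> p _; rewrite lee_fin; exact: sqr_ge0.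
  - exact: mt.
  - exact: mg.
  - move=> p Kp; have [h _] := Hd _ (KD _ Kp); rewrite lee_fin.
    have Dp := KD _ Kp; apply: lerXn2r; rewrite ?nnegrE.
    + exact: pullback_density_ge0 (psi_disk t0 Dp).
    + exact: pullback_density_ge0 (gD _ Dp).
    + by have := h t t0; rewrite (hyp_densityE oD cg Dp).
have A_n : A n%:R @[n --> \oo] --> hyp_area D K.
  have lim z : K z -> (pullback_density (psi n%:R) z ^+ 2)%:E @[n --> \oo] -->
      (pullback_density g z ^+ 2)%:E.
    move=> Kz; have [_ H] := Hd _ (KD _ Kz).
    have c1 : pullback_density (psi n%:R) z @[n --> \oo] --> pullback_density g z.
      apply/cvgrPdist_lt => e /H[T _ HT]; near=> n.
      rewrite distrC /pullback_density -(hyp_densityE oD cg (KD _ Kz)); apply: HT.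
      near: n; exact: nbhs_infty_ger.
    exact: cvg_sqr_EFin c1.
  rewrite EA.
  have -> : \int[area]_(p in pull K) (pullback_density g (pt p.1 p.2) ^+ 2)%:E =
      \int[area]_(p in pull K)
        limn (fun n => (pullback_density (psi n%:R) (pt p.1 p.2) ^+ 2)%:E).
    by apply: eq_integral => p /set_mem Kp; apply/esym/cvg_lim => //; exact: lim.
  apply: cvg_monotone_convergence; first exact: mK.
  - by move=> n; exact: mt.
  - by move=> n p _; rewrite lee_fin; exact: sqr_ge0.
  - by move=> p Kp m n mn; rewrite lee_fin homo ?ler_nat//; exact: KD.
apply/cvgNy_compNP.
have near_eq : \forall t \near (+oo)%R, A t =
    ((fun t => hyp_area disk (flow phi D t @` K)) \o -%R) t.
  near=> t; have t0 : (0 < t)%R by near: t; exact: nbhs_pinfty_gt.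
  have E : flow phi D (- t) = psi t by rewrite /flow oppr_ge0 leNgt t0 /= opprK.
  by rewrite /comp E; exact: esym (hyp_area_backward (ltW t0) cK KD).
apply: cvg_trans (near_eq_cvg near_eq) _.
apply: (@squeeze_cvge _ _ _ _ (fun t => A (Num.truncn t)%:R) _ (fun=> hyp_area D K)).
- near=> t; have t0 : (0 <= t)%R by near: t; exact: nbhs_pinfty_ge.
  apply/andP; split; last exact: le_g.
  have /andP[h _] := truncn_itv t0.
  apply: ge0_le_integral.
  - exact: mK.
  - by move=> p _; rewrite lee_fin; exact: sqr_ge0.
  - exact: mt.
  - exact: mt.
  - by move=> p Kp; rewrite lee_fin homo//; exact: KD.
- apply: (@cvg_comp _ _ _ (@Num.truncn R) (fun n : nat => A n%:R) _ \oo) => //.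
  move=> P [N _ HN].
  have H : \forall t \near (+oo)%R, (N%:R <= t :> R)%R.
    by apply: nbhs_pinfty_ge; rewrite num_real.
  apply: (@filterS _ (+oo_R) _ _ _ _ H) => t Nt; apply: HN => /=.
  have /andP[_ h] := truncn_itv (le_trans (ler0n R N) Nt).
  by rewrite -ltnS -(ltr_nat R); exact: le_lt_trans Nt h.
- exact: cvg_cst.
Unshelve. all: by end_near. Qed.

End hyperbolic_area.

(** * The theorem *)

Theorem theorem1p5 (R : realType) (phi : R -> cplx R -> cplx R)
    (tau : cplx R) (Delta K : set (cplx R)) :
  semigroup phi -> denjoy_wolff phi tau -> petal phi tau Delta ->
  compact K -> K `<=` Delta ->
  (hyp_area disk (flow phi Delta t @` K) @[t --> -oo] --> hyp_area Delta K) /\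
  (forall n : nat, (2 <= n)%N ->
    hyp_diam n disk (flow phi Delta t @` K) @[t --> -oo]
      --> hyp_diam n Delta K).
Proof.
move=> sg _ petD cK KD; split; first exact: (hyp_area_petal sg petD cK KD).
by move=> n n2; exact: (hyp_diam_petal sg petD n2 KD).
Qed.
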